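(* Let $p\ge1$ and let $a:\mathbb{R}^d\to\mathbb{R}$ satisfy: $a(x)\ge0$, $a(x)=a(-x)$, $a\in L^\infty(\mathbb{R}^d)\cap L^1(\mathbb{R}^d)$, $\int_{\mathbb{R}^d}a(x)\,dx=1$, $\int_{\mathbb{R}^d}|x|^2a(x)\,dx<\infty$, and $0\le a(x)\le C_1e^{-b|x|^p}$ for all $x$, with some constants $C_1,b>0$. Assume additionally that in the case $p=1$ one has $\mathbb{E}\,|X|e^{bX\cdot\theta}=\infty$ for any $\theta\in S^{d-1}$. Let $v(x,t)=e^{-t}\sum_{k=1}^{\infty}\frac{t^k a^{\ast k}(x)}{k!}$. Then for any $r\in\mathbb{R}^d\setminus\{0\}$ and $x=rt(1+o(1))$, $$v(x,t)=e^{-\Phi(r)t(1+o(1))}\quad\text{as }t\to\infty,$$ where the function $\Phi$ (defined in the context) possesses the following properties: (i) $\Phi(0)=0$, $\Phi(r)>0$ if $r\ne0$, $\Phi$ is convex, $\Phi(r)=\frac12\sigma^{-1}r\cdot r\,(1+o(1))$ as $r\to0$, and $\Phi(r)\to\infty$ as $|r|\to\infty$; (ii) if $p=1$, then $\Phi(r)=b|r|(1+o(1))$ as $|r|\to\infty$; (iii) if $p>1$ and $L(\gamma)=\frac{p-1}{p}(bp)^{-1/(p-1)}|\gamma|^{p/(p-1)}(1+o(1))$ as $|\gamma|\to\infty$, then $\Phi(r)=\frac{p}{p-1}(b(p-1))^{1/p}|r|(\ln|r|)^{\frac{p-1}{p}}(1+o(1))$ as $|r|\to\infty$; (iv) if $a\in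 C_0(\mathbb{R}^d)$ is compactly supported and $\mu>0$ is the minimal number such that $\operatorname{supp}a\subset\{|x|\le\mu\}$, then $\Phi(r)\ge\frac1\mu|r|\ln|r|$ as $|r|\to\infty$ (i.e. for all $r$ with $|r|$ sufficiently large).
   Context: $a^{\ast k}$ is the $k$-fold convolution power of $a$ ($a^{\ast1}=a$). $X$ is a random vector with density $a$; $S^{d-1}$ is the unit sphere. $\sigma_{ij}=\int x_ix_ja(x)\,dx$ is the positive definite covariance matrix. $\Lambda(\gamma)=\mathbb{E}e^{\gamma\cdot X}\in(0,\infty]$, $L(\gamma)=\ln\Lambda(\gamma)$, and $I(r)=\sup_{\gamma\in\mathbb{R}^d}(\gamma\cdot r-L(\gamma))\in[0,\infty]$, for $r,\gamma\in\mathbb{R}^d$. For $r\in\mathbb{R}^d$, $\xi_r$ denotes the positive solution $\xi$ of $$\ln\xi=I(\xi r)-\xi r\cdot\nabla I(\xi r)$$ (with $\xi r$ in the interior of the set where $I<\infty$). For $r\ne0$ this solution exists, is unique, and lies in $(0,1)$; for $r=0$ the equation gives $\xi_0=1$. The function $\Phi$ is defined by $$\Phi(r)=1-\frac{1}{\xi_r}\bigl(1+\ln\xi_r-I(\xi_rr)\bigr).$$ $x=rt(1+o(1))$ means $x=x(t)\in\mathbb{R}^d$ with $x(t)/t\to r$ as $t\to\infty$. *)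

(* Defs.v *)
From HB Require Import structures.
From mathcomp Require Import all_boot all_order all_algebra.
From mathcomp Require Import all_classical all_reals all_analysis.

Set Implicit Arguments.
Unset Strict Implicit.
Unset Printing Implicit Defensive.

Import Order.TTheory GRing.Theory Num.Theory.
Import numFieldTopology.Exports numFieldNormedType.Exports.

Local Open Scope classical_set_scope.
Local Open Scope ring_scope.

(* R^d is ['rV[R]_d]. It carries the sigma-algebra generated by the coordinate
   maps, which is the Borel sigma-algebra of R^d. *)
Section measurable_rV.
Context (R : realType) (n : nat).

Let coors : 'I_n -> 'rV[R]_n -> R := fun i x => x ord0 i.

Let rV_set0 : g_sigma_preimage coors set0.
Proof. exact: sigma_algebra0. Qed.

Let rV_setC A : g_sigma_preimage coors A -> g_sigma_preimage coors (~` A).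
Proof. exact: sigma_algebraC. Qed.

Let rV_bigcup (F : _^nat) : (forall i, g_sigma_preimage coors (F i)) ->
  g_sigma_preimage coors (\bigcup_i (F i)).
Proof. exact: sigma_algebra_bigcup. Qed.

HB.instance Definition _ := @isMeasurable.Build default_measure_display
  'rV[R]_n (g_sigma_preimage coors) rV_set0 rV_setC rV_bigcup.

Lemma measurable_coord (i : 'I_n) :
  measurable_fun [set: 'rV[R]_n] (fun x : 'rV[R]_n => x ord0 i).
Proof.
move=> _ Y mY; rewrite setTI; apply: sub_sigma_algebra => /=.
rewrite -bigcup_seq/=; exists i => /=; first by rewrite mem_index_enum.
by exists Y => //; rewrite setTI.
Qed.

Lemma measurable_fun_rVP d (T : measurableType d) (f : T -> 'rV[R]_n) :
  (forall i, measurable_fun [set: T] (fun t => f t ord0 i)) ->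
  measurable_fun [set: T] f.
Proof.
move=> mf _ Y; rewrite setTI => mY.
suff : g_sigma_preimage coors `<=` [set A | measurable (f @^-1` A)] by exact.
apply: smallest_sub.
  split => /=.
  - by rewrite preimage_set0.
  - by move=> A mA; rewrite setTD preimage_setC; exact: measurableC.
  - by move=> F mF; rewrite preimage_bigcup; exact: bigcupT_measurable.
rewrite -bigcup_seq/= => A [i _ [B mB <-]] /=.
rewrite setTI -comp_preimage -[X in measurable X]setTI.
exact: mf.
Qed.

End measurable_rV.

Section sigma_finite_copy.
Context d (T : measurableType d) (R : realType).
Variable nu : {measure set T -> \bar R}.
Hypothesis nuS : sigma_finite setT nu.

Definition sigma_finite_copy : set T -> \bar R := nu.
HB.instance Definition _ := Measure.on sigma_finite_copy.
HB.instance Definition _ :=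
  Measure_isSigmaFinite.Build _ _ _ sigma_finite_copy nuS.

Lemma sigma_finite_measureP :
  exists mu : {sigma_finite_measure set T -> \bar R},
    nu = mu :> (set T -> \bar R).
Proof. by exists sigma_finite_copy. Qed.

End sigma_finite_copy.

Lemma product_pushforward_sigma_finite d1 d2 d3 (T1 : measurableType d1)
    (T2 : measurableType d2) (T3 : measurableType d3) (R : realType)
    (m1 : {sigma_finite_measure set T1 -> \bar R})
    (m2 : {sigma_finite_measure set T2 -> \bar R})
    (f : T1 * T2 -> T3) (g : T3 -> T1 * T2) :
  measurable_fun setT f -> measurable_fun setT g -> cancel f g ->
  exists mu : {sigma_finite_measure set T3 -> \bar R},
    pushforward (m1 \x m2)%E f = mu.
Proof.
move=> mf mg fK.
pose nu : {measure set T3 -> \bar R} :=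
  measure_function_pushforward__canonical__measure_function_Measure
    (m1 \x m2)%E mf.
have nuS : sigma_finite setT nu.
  have [F FT mF] : sigma_finite [set: T1 * T2] (m1 \x m2)%E.
    pose H :=
      lebesgue_integral_fubini.measure_function_Measure_isSigmaFinite__to__measure_function_isSigmaFinite.
    by case: (H _ _ _ _ _ m1 m2).
  exists (fun i => g @^-1` F i); first by rewrite -preimage_bigcup -FT.
  move=> i; have [mFi Fi] := mF i; split.
    by rewrite -[X in measurable X]setTI; exact: mg.
  rewrite /nu/= /pushforward -comp_preimage.
  by rewrite (_ : _ \o _ = idfun)//; apply/funext => p /=; exact: fK.
exact: (sigma_finite_measureP nuS).
Qed.

Section lebesgue_measure_rV.
Context (R : realType).

Definition rV_cons n (p : measurableTypeR R * 'rV[R]_n) : 'rV[R]_n.+1 :=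
  \row_i oapp (p.2 ord0) p.1 (unlift ord0 i).

Definition rV_uncons n (v : 'rV[R]_n.+1) : measurableTypeR R * 'rV[R]_n :=
  (v ord0 ord0, \row_i v ord0 (lift ord0 i)).

Lemma rV_cons0 n (p : measurableTypeR R * 'rV[R]_n) : rV_cons p ord0 ord0 = p.1.
Proof. by rewrite mxE unlift_none. Qed.

Lemma rV_consS n (p : measurableTypeR R * 'rV[R]_n) i :
  rV_cons p ord0 (lift ord0 i) = p.2 ord0 i.
Proof. by rewrite mxE liftK. Qed.

Lemma rV_consK n : cancel (@rV_cons n) (@rV_uncons n).
Proof.
move=> [x y]; congr pair; first exact: rV_cons0.
by apply/rowP => i; rewrite mxE rV_consS.
Qed.

Lemma measurable_rV_cons n : measurable_fun setT (@rV_cons n).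
Proof.
apply: measurable_fun_rVP => i; case: (unliftP ord0 i) => [j|] ->.
  under eq_fun do rewrite rV_consS.
  by apply: (measurableT_comp (measurable_coord j)); exact: measurable_snd.
by under eq_fun do rewrite rV_cons0; exact: measurable_fst.
Qed.

Lemma measurable_rV_uncons n : measurable_fun setT (@rV_uncons n).
Proof.
apply: measurable_fun_pair; first exact: measurable_coord.
by apply: measurable_fun_rVP => i; under eq_fun do rewrite mxE;
  exact: measurable_coord.
Qed.

(* Lebesgue measure on the Borel sets of R^n, as an iterated product measure *)
Fixpoint borel_lebesgue n : set 'rV[R]_n -> \bar R :=
  if n is m.+1
  then pushforward (lebesgue_measure \x @borel_lebesgue m)%E (@rV_cons m)
  else dirac (0 : 'rV[R]_0).

Lemma borel_lebesgueP n :
  exists mu : {sigma_finite_measure set 'rV[R]_n -> \bar R},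
    @borel_lebesgue n = mu.
Proof.
elim: n => [|n [mu ih]]; first by exists (dirac (0 : 'rV[R]_0)).
rewrite /= ih; apply: product_pushforward_sigma_finite.
- exact: measurable_rV_cons.
- exact: measurable_rV_uncons.
- exact: rV_consK.
Qed.

Let borel_lebesgue0 n : @borel_lebesgue n set0 = 0%E.
Proof. by have [mu ->] := borel_lebesgueP n; exact: measure0. Qed.

Let borel_lebesgue_ge0 n A : (0 <= @borel_lebesgue n A)%E.
Proof. by have [mu ->] := borel_lebesgueP n; exact: measure_ge0. Qed.

Let borel_lebesgue_semi_sigma_additive n :
  semi_sigma_additive (@borel_lebesgue n).
Proof.
by have [mu ->] := borel_lebesgueP n; exact: measure_semi_sigma_additive.
Qed.

HB.instance Definition _ n := isMeasure.Build _ _ _ (@borel_lebesgue n)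
  (borel_lebesgue0 n) (@borel_lebesgue_ge0 n)
  (@borel_lebesgue_semi_sigma_additive n).

Let borel_lebesgue_sigma_finite n : sigma_finite setT (@borel_lebesgue n).
Proof. by have [mu ->] := borel_lebesgueP n; exact: sigma_finiteT. Qed.

HB.instance Definition _ n := Measure_isSigmaFinite.Build _ _ _
  (@borel_lebesgue n) (borel_lebesgue_sigma_finite n).

Lemma borel_lebesgue_box n (A : 'I_n -> set (measurableTypeR R)) :
  (forall i, measurable (A i)) ->
  borel_lebesgue [set x : 'rV[R]_n | forall i, A i (x ord0 i)] =
  (\prod_(i < n) lebesgue_measure (A i))%E.
Proof.
elim: n A => [|n ih] A mA.
  by rewrite big_ord0 /= diracE mem_set//=; case.
have mB : measurable [set x : 'rV[R]_n | forall i, A (lift ord0 i) (x ord0 i)].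
  rewrite [X in measurable X](_ : _ = \big[setI/setT]_(i < n)
      ((fun x : 'rV[R]_n => x ord0 i) @^-1` A (lift ord0 i))).
    apply: bigsetI_measurable => i _; rewrite -[X in measurable X]setTI.
    exact: (measurable_coord i measurableT (mA _)).
  rewrite -bigcap_seq; apply/seteqP; split=> x /= Ax i.
    by move=> _; exact: Ax.
  by apply: Ax => /=; rewrite mem_index_enum.
rewrite big_ord_recl -ih// /= /pushforward -product_measure1E//.
congr product_measure1; apply/seteqP; split=> -[x y] /=.
  move=> Axy; split; first by have := Axy ord0; rewrite rV_cons0.
  by move=> i; have := Axy (lift ord0 i); rewrite rV_consS.
by move=> [Ax Ay] i; case: (unliftP ord0 i) => [j|] ->;
  rewrite ?rV_consS ?rV_cons0.
Qed.

End lebesgue_measure_rV.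

Section completed_lebesgue_measure_rV.
Context (R : realType).

(* R^n with the Lebesgue sigma-algebra, i.e. the Caratheodory-measurable sets *)
Definition rV_lebesgue n := caratheodory_type ((@borel_lebesgue R n)^*)%mu.

HB.instance Definition _ n := Measurable.on (rV_lebesgue n).

Definition lebesgue_rV n : set (rV_lebesgue n) -> \bar R :=
  @completed_measure_extension _ _ _ (@borel_lebesgue R n).

HB.instance Definition _ n := Measure.on (@lebesgue_rV n).

Let lebesgue_rV_sigma_finite n : sigma_finite setT (@lebesgue_rV n).
Proof. exact/completed_measure_extension_sigma_finite/sigma_finiteT. Qed.

HB.instance Definition _ n := Measure_isSigmaFinite.Build _ _ _
  (@lebesgue_rV n) (@lebesgue_rV_sigma_finite n).

End completed_lebesgue_measure_rV.

Arguments lebesgue_rV {R n}.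

Section euclidean.
Context {R : realType} {d : nat}.
Implicit Types x y : 'rV[R]_d.

Definition dot x y : R := \sum_(i < d) x ord0 i * y ord0 i.

(* The library norm of ['rV[R]_d] is the sup norm, hence this one. *)
Definition enorm x : R := Num.sqrt (dot x x).

Definition grad (f : 'rV[R]_d -> R) x : 'rV[R]_d :=
  \row_i 'D_(delta_mx ord0 i) f x.

(* the filter of neighborhoods of infinity in R^d *)
Definition rV_infty : set_system 'rV[R]_d :=
  filter_from setT (fun M : R => [set x | M < enorm x]).

Global Instance rV_infty_filter : Filter rV_infty.
Proof.
apply: filter_from_filter; first by exists 0.
move=> M N _ _; exists (Num.max M N) => // x /=.
by rewrite gt_max => /andP[].
Qed.

End euclidean.

(* f = g (1 + o(1)) along F *)
Definition asymp {R : realType} {T : Type} (F : set_system T) (f g : T -> R) :=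
  exists2 e : T -> R, e x @[x --> F] --> 0
    & \forall x \near F, f x = g x * (1 + e x).

Section compound_poisson.
Context {R : realType} {d : nat}.
Variable a : 'rV[R]_d -> R.
Implicit Types (r x g : 'rV[R]_d) (t : R).

Definition convolution (f h : 'rV[R]_d -> R) x : R :=
  \int[lebesgue_rV]_y (f (x - y) * h y).

(* The k-fold convolution power of [a] for k >= 1; the value at k = 0, where
   the convolution power is not a function, is never used. *)
Definition conv_pow (k : nat) : 'rV[R]_d -> R := iter k.-1 (convolution a) a.

Definition v x t : R :=
  expR (- t) * \big[+%R/0]_(1 <= k <oo) (t ^+ k * conv_pow k x / k`!%:R).

Definition covariance_mx : 'M[R]_d :=
  \matrix_(i, j) \int[lebesgue_rV]_x
    ((x : 'rV[R]_d) ord0 i * (x : 'rV[R]_d) ord0 j * a x).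

(* E e^(g . X), where the random vector X has density [a] *)
Definition Lambda g : \bar R :=
  (\int[lebesgue_rV]_x (expR (dot g x) * a x)%:E)%E.

Definition logLambda g : \bar R := lne (Lambda g).

Definition rate r : \bar R :=
  ereal_sup [set ((dot g r)%:E - logLambda g)%E | g in [set: 'rV[R]_d]].

Definition xi_eq r (xi : R) : Prop :=
  [/\ 0 < xi, ([set y | rate y < +oo]%E)° (xi *: r)
    & ln xi = fine (rate (xi *: r))
              - dot (xi *: r) (grad (fine \o rate) (xi *: r))].

(* [get] picks the positive solution of [xi_eq], which is unique. *)
Definition xi r : R := get (xi_eq r).

Definition Phi r : R :=
  1 - (xi r)^-1 * (1 + ln (xi r) - fine (rate (xi r *: r))).

End compound_poisson.

(* Main.v *)
Require Import Defs.
From mathcomp Require Import all_boot all_order all_algebra.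
From mathcomp Require Import all_classical all_reals all_analysis.
From mathcomp Require Import measurable_realfun.
From mathcomp Require Import ring lra.

(** The exponentials [exp (- g.x)] are eigenfunctions of the convolution
    with the even density [a], with eigenvalue [Lambda g]. Summing over the
    number of convolution factors with Poisson weights turns this eigenvalue
    into [exp (t (Lambda g - 1))], so the decay rate of [v] at [x = r t]
    should be the Legendre transform [sup_g (g.r - Lambda g + 1)]. The proof
    has three parts: this supremum is [Phi r], it is the decay rate, and the
    listed properties of [Phi] can be read off from it.

    Duality. Let [g0] maximize [g.r - Lambda g] and put [xi = 1 / Lambda
    g0], [s = xi r]. Since [exp] lies above its tangents and [L] is convex,
    [g0] also maximizes [g.s - L g], and conversely ([is_maxL_is_max],
    [is_max_is_maxL]). Strict convexity of [L] makes [g0] the gradient of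
    [I] at [s] ([is_max_grad]), so that [I s - s.grad I s = - L g0 = ln xi]:
    this is the equation that defines [xi_r]. In the other direction, at a
    solution the rate function is finite near [xi r], hence its supremum is
    attained ([exists_is_max]) and the solution comes from a maximizer.
    Substitution gives [Phi r = g0.r - Lambda g0 + 1] ([Phi_max],
    [Phi_legendre]).

    Upper bound. A bound [a <= M exp (- g0.x)] propagates to all convolution
    powers by the eigenvalue property and sums to [v <= M exp (- (g0.x - t
    Lambda g0 + t))] ([v_between]).

    Lower bound. A single Poisson term suffices, with [k + 2 m] factors
    where [k] is close to [t Lambda g0] and [m] to [e t] for a small [e].
    The convolution square of [a] is bounded below near the origin
    ([square_lower], by the Steinhaus theorem), so the first [2 m] factors
    give at least [kap ^ m] on a ball of radius proportional to [m]
    ([ball_growth]). Up to a constant, [exp (- g0.y)] is therefore bounded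
    by this convolution power inside the ball and, outside it, by a small
    multiple of the sum of the [exp (- (g0 + s e_i).y)], [s = h] or [s = -
    h]. Convolving [k] times multiplies each exponential by the [k]-th power
    of its eigenvalue ([exp_domination]); because [Lambda] exceeds its
    tangent at the maximizer only quadratically ([axis_bound]), the
    auxiliary exponentials become negligible against the main one when [h]
    is small compared with [e], and what remains is a lower bound for the
    convolution power ([conv_lower], [v_lower], [v_log_bounds]). This needs
    [g0] to be interior to the domain of [Lambda]; for [p = 1] that is the
    content of the steepness condition ([is_maxL_lt_b]).

    Properties. Near the origin [2 + q g <= 2 Lambda g <= 2 + q g + C |g|^3]
    with the covariance form [q] ([Phi_gauss_asymp]). At infinity,
    boundedness of [Lambda] on balls bounds [Phi] below by linear functions
    ([Phi_ge_linear]), boundedness of its domain bounds [Phi] above by one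
    ([Phi_le_radius]), a prescribed growth of [L] is inverted
    ([Phi_super_asymp]), and for a support of radius [m] the supremum is
    tested at [|g| = ln (2 |r|) / m] ([Phi_ge_support]).

    The density is only Lebesgue measurable, that is, measurable for the
    completed measure, while Fubini and the translation arguments are
    carried out for Borel functions. It is replaced by an even Borel
    function below it, equal to it almost everywhere, with the same
    integrals and the same convolution powers from the second one on
    ([borel_version]). *)

Set Implicit Arguments.
Unset Strict Implicit.
Unset Printing Implicit Defensive.

Import Order.TTheory GRing.Theory Num.Theory.
Import numFieldTopology.Exports numFieldNormedType.Exports.

Local Open Scope classical_set_scope.
Local Open Scope ring_scope.

(** * Borel cores of Caratheodory measurable functions *)

Section measurable_core.
Local Open Scope ereal_scope.
Context d (T : measurableType d) (R : realType).
Variable mu : {sigma_finite_measure set T -> \bar R}.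

(** Covers of [E] by countably many measurable sets whose measure exceeds
    the outer measure by less and less; the envelope is their intersection. *)
Lemma measurable_envelope (E : set T) :
  exists2 F : set T, measurable F & E `<=` F /\ mu F = (mu^*)%mu E.
Proof.
have [Eoo|Efin] := eqVneq ((mu^*)%mu E) +oo.
  exists setT => //; split => //; apply/eqP; rewrite Eoo -leye_eq -Eoo.
  by rewrite -(measurable_mu_extE mu)//; exact: le_mu_ext.
have Efn : (mu^*)%mu E \is a fin_num.
  by rewrite ge0_fin_numE ?mu_ext_ge0// ltey.
(* the defining infimum is taken over covers; the n-th one is within 1/(n+1)
   of it *)
have cover (n : nat) : exists A : (set T)^nat, [/\ forall k, measurable (A k),
    E `<=` \bigcup_k A k & mu (\bigcup_k A k) <= (mu^*)%mu E + n.+1%:R^-1%:E].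
  have n0 : (0 < n.+1%:R^-1 :> R)%R by rewrite invr_gt0.
  have [_ [A [mA EA] <-] lt] := lb_ereal_inf_adherent n0 Efn.
  exists A; split => //.
  apply: le_trans (ltW lt).
  by apply: measure_sigma_subadditive => //; exact: bigcupT_measurable.
move/choice : cover => [A AP].
exists (\bigcap_n \bigcup_k A n k).
  by apply: bigcapT_measurable => n; apply: bigcupT_measurable => k;
    have [] := AP n.
split; first by apply: sub_bigcap => n _; have [] := AP n.
apply/eqP; rewrite eq_le; apply/andP; split; last first.
  rewrite -(measurable_mu_extE mu).
    by apply: le_mu_ext; apply: sub_bigcap => n _; have [] := AP n.
  by apply: bigcapT_measurable => n; apply: bigcupT_measurable => k;
    have [] := AP n.
apply/lee_addgt0Pr => e e0.
have [N _ NP] := near_infty_natSinv_lt (PosNum e0).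
have ne := NP N (leqnn N); set n := N in ne.
apply: (@le_trans _ _ (mu (\bigcup_k A n k))).
  apply: le_measure; rewrite ?inE.
  - by apply: bigcapT_measurable => m; apply: bigcupT_measurable => k;
      have [] := AP m.
  - by apply: bigcupT_measurable => k; have [] := AP n.
  - exact: bigcap_inf.
have [_ _ /le_trans] := AP n; apply.
by rewrite leeD2l// lee_fin ltW.
Qed.

Let cmu := @completed_measure_extension _ _ _ mu.

Lemma caratheodory_sub (A : set T) : measurable A ->
  measurable (A : set (caratheodory_type (mu^*)%mu)).
Proof.
by move=> mA; apply: (@sub_caratheodory _ _ _ mu); exact: sub_sigma_algebra.
Qed.

Lemma completed_measureE (A : set T) : measurable A ->
  @completed_measure_extension _ _ _ mu A = mu A.
Proof. by move=> mA; rewrite /completed_measure_extension measurable_mu_extE. Qed.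

(** With [F] an envelope of [E], the set [F] minus [E] is null for the outer
    measure by finiteness, and an envelope [G] of it is the null set to
    remove: [E] minus [G] is then [F] minus [G]. *)
Lemma caratheodory_borel_core_fin (E : set (caratheodory_type (mu^*)%mu)) :
  measurable E -> cmu E < +oo ->
  exists2 G : set T, measurable G /\ mu G = 0 & measurable (E `\` G : set T).
Proof.
move=> mE Efin.
have [F mF [EF FE]] := measurable_envelope E.
have [G mG [FEG GE]] := measurable_envelope (F `\` E).
exists G.
  split => //; rewrite GE.
  have /= : cmu (F `\` E) = cmu F - cmu (F `&` E).
    apply: measureD => //; first exact: caratheodory_sub.
    by have := Efin; rewrite -[X in X < _ -> _]FE -(measurable_mu_extE mu).
  rewrite setIidr//; rewrite {2}/cmu completed_measureE// FE subee//.
  by rewrite ge0_fin_numE// mu_ext_ge0.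
rewrite (_ : E `\` G = F `\` G); first exact: measurableD.
apply/seteqP; split => x [xE xG]; split => //; first exact: EF.
by apply: contrapT => nE; apply: xG; apply: FEG.
Qed.

(** Sigma-finiteness reduces to pieces of finite measure, the exceptional
    sets of the pieces being joined. *)
Lemma caratheodory_borel_core (E : set (caratheodory_type (mu^*)%mu)) :
  measurable E ->
  exists2 G : set T, measurable G /\ mu G = 0 & measurable (E `\` G : set T).
Proof.
move=> mE.
have [S ST mS] := sigma_finiteT mu.
have /choice[G GP] (n : nat) : exists G : set T,
    [/\ measurable G, mu G = 0 & measurable ((E `&` S n) `\` G : set T)].
  have [||G [mG G0] mEG] := @caratheodory_borel_core_fin (E `&` S n).
  - by apply: measurableI => //; apply: caratheodory_sub; have [] := mS n.
  - apply: (@le_lt_trans _ _ (cmu (S n))).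
      by apply: le_measure; rewrite ?inE//; [apply: measurableI => //|];
        apply: caratheodory_sub; have [] := mS n.
    by rewrite /cmu completed_measureE; have [] := mS n.
  by exists G.
have mGG : measurable (\bigcup_n G n).
  by apply: bigcupT_measurable => n; have [] := GP n.
exists (\bigcup_n G n).
  split => //; apply: measure_negligible => //.
  by apply: negligible_bigcup => n; apply/negligibleP; have [] := GP n.
rewrite (_ : E `\` _ = (\bigcup_n ((E `&` S n) `\` G n)) `\` \bigcup_n G n).
  apply: measurableD => //; apply: bigcupT_measurable => n.
  by have [] := GP n.
apply/seteqP; split => x.
  move=> [Ex Gx]; split => //.
  have [n _ Sn] : (\bigcup_n S n) x by rewrite -ST.
  by exists n => //; split => // Gn; apply: Gx; exists n.
by move=> [[n _ [[Ex _] _]] Gx].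
Qed.

Lemma measurable_id_caratheodory :
  measurable_fun setT (idfun : caratheodory_type (mu^*)%mu -> T).
Proof. by move=> _ A mA; rewrite setTI; exact: caratheodory_sub. Qed.

Lemma integral_completed (f : T -> \bar R) : measurable_fun setT f ->
  (forall x, 0 <= f x) ->
  \int[cmu]_x (f : caratheodory_type (mu^*)%mu -> \bar R) x = \int[mu]_x f x.
Proof.
move=> mf f0.
have := @ge0_integral_pushforward _ _ (caratheodory_type (mu^*)%mu) T R _
  measurable_id_caratheodory cmu setT f measurableT mf (fun x _ => f0 x).
rewrite preimage_setT => <-.
apply: eq_measure_integral; first exact: measurable_id_caratheodory.
by move=> ? A mA _; exact: completed_measureE.
Qed.

(** Completeness makes [h] measurable, being almost everywhere equal to the
    Borel function [g]. *)
Lemma integral_completed_ae (h : caratheodory_type (mu^*)%mu -> \bar R)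
    (g : T -> \bar R) (Z : set T) :
  measurable_fun setT g -> (forall x, 0 <= h x) -> (forall x, 0 <= g x) ->
  measurable Z -> mu Z = 0 -> (forall x, ~ Z x -> h x = g x) ->
  \int[cmu]_x h x = \int[mu]_x g x.
Proof.
move=> mg h0 g0 mZ Z0 hg.
have mg' : measurable_fun setT (g : caratheodory_type (mu^*)%mu -> \bar R).
  exact: measurableT_comp mg measurable_id_caratheodory.
have gh : ae_eq cmu setT (g : caratheodory_type (mu^*)%mu -> \bar R) h.
  exists Z; split; first exact: caratheodory_sub.
    by rewrite /= -[LHS]/((mu^*)%mu Z) measurable_mu_extE.
  move=> x /= hx; apply: contrapT => nZ; apply: hx => _.
  by rewrite hg.
have mh : measurable_fun setT h.
  by apply: ae_measurable_fun gh mg'; exact: measure_is_complete_caratheodory.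
rewrite -integral_completed//; apply: ge0_ae_eq_integral => //.
exact: ae_eq_sym.
Qed.

(** The exceptional set collects those of the superlevel sets at rational
    levels. Every measurable [Z] containing it is allowed as well, which
    leaves room to symmetrize it when [f] is even. *)
Lemma caratheodory_fun_borel_core (f : caratheodory_type (mu^*)%mu -> R) :
  measurable_fun setT f -> exists2 G : set T, measurable G /\ mu G = 0 &
  forall Z : set T, measurable Z -> G `<=` Z ->
    measurable_fun (setT : set T) (fun x => f x * \1_(~` Z) x)%R.
Proof.
move=> mf.
have /choice[G GP] (q : rat) : exists G : set T, [/\ measurable G, mu G = 0 &
    measurable ([set x | (ratr q < f x)%R] `\` G : set T)].
  have [|G [mG G0] mEG] := @caratheodory_borel_core [set x | (ratr q < f x)%R].
    rewrite -[X in measurable X]setTI; have := mf measurableT `]ratr q, +oo[%classic.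
    by rewrite set_itvE; apply; rewrite -set_itvE; exact: measurable_itv.
  by exists G.
have [e eP] : exists e : nat -> option rat, forall q, exists n, e n = Some q.
  by exists unpickle => q; exists (pickle q); exact: pickleK.
pose H n := if e n is Some q then G q else set0.
have mH n : measurable (H n) /\ mu (H n) = 0.
  rewrite /H; case: (e n) => [q|]; last by split.
  by have [] := GP q.
have GH q : G q `<=` \bigcup_n H n.
  by have [n en] := eP q; move=> x Gx; exists n => //; rewrite /H en.
have mGG : measurable (\bigcup_n H n).
  by apply: bigcupT_measurable => n; case: (mH n).
exists (\bigcup_n H n).
  split => //; apply: measure_negligible => //.
  by apply: negligible_bigcup => n; apply/negligibleP; case: (mH n).
move=> Z mZ HZ.
have mfZ c : measurable ([set x | (c < f x)%R] `\` Z : set T).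
  rewrite (_ : _ `\` _ = (\bigcup_n (if e n is Some q then
      if (c < ratr q)%R then [set x | (ratr q < f x)%R] `\` G q else set0
      else set0)) `\` Z).
    apply: measurableD => //; apply: bigcupT_measurable => n.
    case: (e n) => [q|] //; case: ifPn => // _.
    by have [] := GP q.
  apply/seteqP; split => x /=.
    move=> [cf Zx]; split => //.
    have [q] := rat_in_itvoo cf; rewrite in_itv/= => /andP[cq qf].
    have [n en] := eP q; exists n => //; rewrite en cq; split => // Gq.
    by apply: Zx; apply: HZ; exact: GH Gq.
  move=> [[n _]]; case: (e n) => [q|] //; case: ifPn => // cq [qf _] Zx.
  by split => //; exact: lt_trans qf.
apply: (measurability _ (RGenOInfty.measurableE R)) => // _ [_ [c ->] <-].
rewrite setTI (_ : _ @^-1` _ = ([set x | (c < f x)%R] `\` Z) `|`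
    (if (c < 0)%R then Z else set0)); last first.
  apply/seteqP; split => x /=; rewrite in_itv/= andbT indicE.
    have [Zx|Zx] := pselect (Z x).
      rewrite memNset ?mulr0; last by move=> /(_ Zx).
      by move=> ->; right.
    by rewrite mem_set// mulr1; left.
  move=> [[cf Zx]|]; first by rewrite mem_set// mulr1.
  case: ifPn => // c0 Zx.
  by rewrite memNset ?mulr0//; apply.
by apply: measurableU => //; case: ifPn.
Qed.

End measurable_core.

(** * Lebesgue measure of boxes and its invariance *)

Section lebesgue_invariance.
Context (R : realType).

(** The image under the reflection agrees with Lebesgue measure on half-open
    intervals up to exchange of the endpoints, which are null. *)
Lemma lebesgue_measure_subl (c : R) (A : set (measurableTypeR R)) :
  measurable A -> lebesgue_measure [set y | A (c - y)] = lebesgue_measure A.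
Proof.
move=> mA.
have mc : measurable_fun setT (fun y : measurableTypeR R => c - y : measurableTypeR R).
  by apply: measurable_funB => //; exact: measurable_id.
apply/esym; rewrite -[RHS]/(pushforward lebesgue_measure
  (fun y : measurableTypeR R => c - y : measurableTypeR R) A).
apply: (@lebesgue_measure_unique R (pushforward lebesgue_measure
  (fun y : measurableTypeR R => c - y : measurableTypeR R))) => //.
move=> _ [[a b]] _ <-; rewrite /pushforward/=.
rewrite -[RHS]/(lebesgue_measure ((fun y : measurableTypeR R => c - y) @^-1` `]a, b])).
rewrite (_ : _ @^-1` _ = `[c - b, c - a[%classic); last first.
  apply/seteqP; split => y /=; rewrite !in_itv/= => /andP[h1 h2];
    apply/andP; split; lra.
rewrite !lebesgue_measure_itv/= !lte_fin.
rewrite (_ : (c - b < c - a) = (a < b)); last by apply/idP/idP; lra.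
by case: ifPn => // _; rewrite -!EFinB; congr EFin; ring.
Qed.

Variable n : nat.
Notation beta := (@borel_lebesgue R n).
Implicit Types A : set 'rV[R]_n.

Definition box (A : 'I_n -> set (measurableTypeR R)) : set 'rV[R]_n :=
  [set x : 'rV[R]_n | forall i, A i (x ord0 i)].

Definition boxes : set (set 'rV[R]_n) :=
  [set B | exists2 A : 'I_n -> set (measurableTypeR R),
    (forall i, measurable (A i)) & B = box A].

Lemma measurable_box (A : 'I_n -> set (measurableTypeR R)) :
  (forall i, measurable (A i)) ->
  measurable (box A).
Proof.
move=> mA; rewrite [X in measurable X](_ : _ = \big[setI/setT]_(i < n)
    ((fun x : 'rV[R]_n => x ord0 i) @^-1` A i)).
  apply: bigsetI_measurable => i _; rewrite -[X in measurable X]setTI.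
  exact: (measurable_coord i measurableT (mA _)).
rewrite -bigcap_seq; apply/seteqP; split=> x /= Ax i.
  by move=> _; exact: Ax.
by apply: Ax => /=; rewrite mem_index_enum.
Qed.

Lemma measurable_boxesE : @measurable _ 'rV[R]_n = <<s boxes >>.
Proof.
apply/seteqP; split.
  apply: smallest_sub; first exact: smallest_sigma_algebra.
  rewrite -bigcup_seq/= => A [i _ [B mB <-]]; apply: sub_sigma_algebra.
  exists (fun j => if j == i then B else setT).
    by move=> j; case: ifPn => // _; exact: measurableT.
  apply/seteqP; split => x /=.
    by move=> [_ Bx] j; case: ifPn => // /eqP ->.
  by move=> /(_ i); rewrite eqxx.
apply: smallest_sub.
  split; [exact: measurable0|by move=> A mA; rewrite setTD; exact: measurableC|].
  by move=> F mF; exact: bigcupT_measurable.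
by move=> _ [A mA ->]; exact: measurable_box.
Qed.

Lemma borel_lebesgue_boxE (A : 'I_n -> set (measurableTypeR R)) :
  (forall i, measurable (A i)) ->
  beta (box A) = (\prod_(i < n) lebesgue_measure (A i))%E.
Proof. exact: borel_lebesgue_box. Qed.

Lemma borel_lebesgue_cube_lty (c : R) :
  (beta (box (fun=> `[(- c)%R, c]%classic)) < +oo)%E.
Proof.
rewrite borel_lebesgue_boxE => [|i]; last exact: measurable_itv.
suff : (\prod_(i < n) lebesgue_measure (`[(- c)%R, c]%classic : set (measurableTypeR R)))%E \is a fin_num.
  by rewrite fin_numElt => /andP[].
elim/big_ind : _ => [//|x y|i _]; first exact: fin_numM.
by rewrite lebesgue_measure_itv/=; case: ifPn.
Qed.

(** Boxes form a pi-system generating the Borel sets, and cubes of finite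
    measure exhaust the space. *)
Lemma borel_lebesgue_unique (mu : {measure set 'rV[R]_n -> \bar R}) :
  (forall A : 'I_n -> set (measurableTypeR R), (forall i, measurable (A i)) ->
   mu (box A) =
     (\prod_(i < n) lebesgue_measure (A i))%E) ->
  forall A, measurable A -> beta A = mu A.
Proof.
move=> muE A mA.
pose g (k : nat) : set 'rV[R]_n :=
  box (fun=> `[- k%:R, k%:R]%classic).
apply: (measure_unique boxes g) => //.
- exact: measurable_boxesE.
- move=> _ _ [A1 mA1 ->] [A2 mA2 ->]; exists (fun i => A1 i `&` A2 i).
    by move=> i; exact: measurableI.
  apply/seteqP; split => x /=; first by move=> [h1 h2] i; split.
  by move=> h; split => i; have [] := h i.
- by move=> k; exists (fun=> `[- k%:R, k%:R]%classic).
- apply/seteqP; split => // x _.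
  exists (\sum_i (Num.truncn `|x ord0 i|).+1)%N => // i /=.
  rewrite in_itv/= -ler_norml.
  apply: (le_trans (ltW (truncnS_gt _))).
  by rewrite ler_nat (bigD1 i)//= leq_addr.
- by move=> _ [B mB ->]; rewrite muE//; exact: borel_lebesgue_boxE.
- by move=> k; exact: borel_lebesgue_cube_lty.
Qed.

Lemma measurable_subl (x : 'rV[R]_n) :
  measurable_fun setT (fun y : 'rV[R]_n => x - y).
Proof.
apply: measurable_fun_rVP => i; under eq_fun do rewrite !mxE.
by apply: measurable_funB => //; exact: measurable_coord.
Qed.

(** The preimage of a box is a box whose sides are reflected, so that the
    one-dimensional invariance and uniqueness apply. With [x] arbitrary this
    covers both the reflection at the origin and, by composing two of them,
    all translations. *)
Lemma borel_lebesgue_subl (x : 'rV[R]_n) A : measurable A ->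
  beta ((fun y => x - y) @^-1` A) = beta A.
Proof.
move=> mA; apply/esym.
apply: (@borel_lebesgue_unique (pushforward beta (fun y => x - y))) => //.
  exact: measurable_subl.
move=> mx B mB; rewrite /pushforward/= /pushforward.
transitivity (beta (box (fun i => [set t | B i (x ord0 i - t)]))).
  congr (beta _); apply/seteqP; split => y /= h i; have := h i; by rewrite !mxE.
rewrite borel_lebesgue_boxE; last first.
  move=> i; rewrite -[X in measurable X]setTI.
  have : measurable_fun setT (fun y : measurableTypeR R => x ord0 i - y : measurableTypeR R).
    by apply: measurable_funB => //; exact: measurable_id.
  by apply.
by apply: eq_bigr => i _; rewrite lebesgue_measure_subl.
Qed.

Lemma integral_subl (x : 'rV[R]_n) (f : 'rV[R]_n -> \bar R) :
  measurable_fun setT f -> (forall y, (0 <= f y)%E) ->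
  (\int[beta]_y f (x - y)%R = \int[beta]_y f y)%E.
Proof.
move=> mf f0.
have := @ge0_integral_pushforward _ _ _ _ R _ (measurable_subl x)
  beta setT f measurableT mf (fun x _ => f0 x).
rewrite preimage_setT => <-.
apply: eq_measure_integral => [|mx A mA _]; first exact: measurable_subl.
exact: borel_lebesgue_subl.
Qed.

End lebesgue_invariance.

Section norms.
Context (R : realType) (n : nat).
Implicit Types x y : 'rV[R]_n.

Lemma ler_coord_norm x i : `|x ord0 i| <= `|x|.
Proof.
rewrite /Num.norm/= mx_normrE.
exact: (le_bigmax _ (fun ij => `|x ij.1 ij.2|) (ord0, i)).
Qed.

Lemma mx_norm_le x (e : R) : 0 <= e ->
  (`|x| <= e) = [forall i, `|x ord0 i| <= e].
Proof.
move=> e0; apply/idP/forallP => [xe i|h].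
  exact: le_trans (ler_coord_norm x i) xe.
rewrite /Num.norm/= mx_normrE; apply/bigmax_leP; split => // -[i j] _ /=.
by rewrite (ord1 i).
Qed.

End norms.

(** * Continuity of translations and the Steinhaus theorem *)

Section steinhaus.
Context (R : realType) (n : nat).
Notation beta := (@borel_lebesgue R n).
Implicit Types (A : set 'rV[R]_n) (x y : 'rV[R]_n) (K e : R).

Definition cball x e : set 'rV[R]_n := [set y | `|x - y| <= e].

Lemma cball_box x e : 0 <= e ->
  cball x e = box (fun i => `[x ord0 i - e, x ord0 i + e]%classic).
Proof.
move=> e0; apply/seteqP; split => y; rewrite /cball/= mx_norm_le//.
  move=> /forallP h i /=; rewrite in_itv/=; have := h i.
  by rewrite !mxE ler_norml => /andP[? ?]; apply/andP; split; lra.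
move=> h; apply/forallP => i; have /= := h i; rewrite in_itv/= => /andP[? ?].
by rewrite !mxE ler_norml; apply/andP; split; lra.
Qed.

Lemma measurable_cball x e : measurable (cball x e).
Proof.
have [e0|e0] := leP 0 e; first by rewrite cball_box//; exact: measurable_box.
rewrite (_ : cball x e = set0)//; apply/seteqP; split => // y /= /le_lt_trans.
by move=> /(_ _ e0); rewrite normr_lt0.
Qed.

Lemma prod_EFin_cst (m : nat) (c : R) : (\prod_(i < m) c%:E)%E = (c ^+ m)%:E.
Proof.
elim: m => [|m ih]; first by rewrite big_ord0.
by rewrite big_ord_recl ih exprS EFinM.
Qed.

Lemma borel_lebesgue_cball x e : 0 <= e ->
  beta (cball x e) = ((2 * e) ^+ n)%:E.
Proof.
move=> e0; rewrite cball_box// borel_lebesgue_boxE => [|i]; last exact: measurable_itv.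
rewrite -prod_EFin_cst; apply: eq_bigr => i _.
rewrite lebesgue_measure_itv/= lte_fin.
case: ifPn => [_|]; first by rewrite -EFinB; congr EFin; ring.
by rewrite -leNgt => h; congr EFin; lra.
Qed.

Lemma cballS x e e' : e <= e' -> cball x e `<=` cball x e'.
Proof. by move=> ee y /= /le_trans; exact. Qed.

Lemma measurable_addr x : measurable_fun setT (fun y : 'rV[R]_n => y - x).
Proof.
apply: measurable_fun_rVP => i; under eq_fun do rewrite !mxE.
by apply: measurable_funB => //; exact: measurable_coord.
Qed.

Definition translate x A : set 'rV[R]_n := (fun y => y - x) @^-1` A.

Lemma measurable_translate x A : measurable A -> measurable (translate x A).
Proof.
by move=> mA; rewrite -[X in measurable X]setTI; exact: measurable_addr.
Qed.

Lemma borel_lebesgue_translate x A : measurable A ->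
  beta (translate x A) = beta A.
Proof.
move=> mA; rewrite -[RHS](borel_lebesgue_subl 0 mA).
rewrite -[RHS](borel_lebesgue_subl x); last first.
  by rewrite -[X in measurable X]setTI; exact: measurable_subl.
by congr (beta _); apply/seteqP; split => y /=; rewrite sub0r opprB.
Qed.

Definition symdiff_translate x A := (A `\` translate x A) `|` (translate x A `\` A).

(** Only the part of the symmetric difference in a ball is measured, because
    sets of infinite measure must be allowed for the closure under
    complements. *)
Definition translation_continuous A := measurable A /\
  forall K e, 0 < e -> exists2 del, 0 < del &
  forall x, `|x| <= del -> (beta (cball 0%R K `&` symdiff_translate x A) <= e%:E)%E.

Lemma measurable_symdiff_translate x A : measurable A -> measurable (symdiff_translate x A).
Proof.
move=> mA; have mtA := measurable_translate x mA.
by apply: measurableU; exact: measurableD.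
Qed.

Lemma translation_continuousC A :
  translation_continuous A -> translation_continuous (~` A).
Proof.
move=> [mA cA]; split; first exact: measurableC.
move=> K e e0; have [del d0 cAd] := cA K e e0; exists del => // x xd.
apply: le_trans (cAd x xd); rewrite le_eqVlt; apply/orP; left; apply/eqP.
congr (beta (_ `&` _)); apply/seteqP; split => y.
  by move=> [[h /contrapT h']|[h /contrapT h']]; [right|left].
by move=> [[h h']|[h h']]; [right|left]; split => // /(_ _).
Qed.

Lemma translation_continuous0 : translation_continuous set0.
Proof.
split; first exact: measurable0.
move=> K e e0; exists 1 => // x _.
rewrite (_ : _ `&` _ = set0) ?measure0 ?lee_fin ?ltW//.
by apply/seteqP; split => // y [_ [[]|[]]].
Qed.

Lemma symdiff_translateU x A B : symdiff_translate x (A `|` B) `<=` symdiff_translate x A `|` symdiff_translate x B.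
Proof.
move=> y [[[Ay|By] h]|[[Ay|By] h]].
- by left; left; split => // ?; apply: h; left.
- by right; left; split => // ?; apply: h; right.
- by left; right; split => // ?; apply: h; left.
- by right; right; split => // ?; apply: h; right.
Qed.

Lemma translation_continuousU A B : translation_continuous A ->
  translation_continuous B -> translation_continuous (A `|` B).
Proof.
move=> [mA cA] [mB cB]; split; first exact: measurableU.
move=> K e e0; have e20 : 0 < e / 2 by rewrite divr_gt0.
have [d1 d10 h1] := cA K _ e20; have [d2 d20 h2] := cB K _ e20.
exists (Num.min d1 d2); first by rewrite lt_min d10.
move=> x; rewrite le_min => /andP[xd1 xd2].
apply: (@le_trans _ _ (beta ((cball 0 K `&` symdiff_translate x A) `|` (cball 0 K `&` symdiff_translate x B)))).
  apply: le_measure; rewrite ?inE.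
  - by apply: measurableI; [exact: measurable_cball|apply: measurable_symdiff_translate; exact: measurableU].
  - by apply: measurableU; (apply: measurableI; [exact: measurable_cball|exact: measurable_symdiff_translate]).
  - by rewrite -setIUr; apply: setIS; exact: symdiff_translateU.
apply: le_trans.
  by apply: measureU2; (apply: measurableI; [exact: measurable_cball|exact: measurable_symdiff_translate]).
by rewrite [e]splitr EFinD leeD// ?h1 ?h2.
Qed.

(** A finite union [B N] approximates the whole union [A] in measure on the
    ball of radius [K + 1]. For shifts of length at most one, a point of the
    ball of radius [K] in the symmetric difference for [A] is in the one for
    [B N], or it or its translate lies in [A] minus [B N]: three
    contributions of at most [e / 3]. *)
Lemma translation_continuous_bigcup (F : (set 'rV[R]_n)^nat) :
  (forall i, translation_continuous (F i)) ->
  translation_continuous (\bigcup_i F i).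
Proof.
move=> cF; have mF i : measurable (F i) by case: (cF i).
split; first exact: bigcupT_measurable.
pose B N := \big[setU/set0]_(i < N) F i.
have cB N : translation_continuous (B N).
  by rewrite /B; apply: big_ind => //; [exact: translation_continuous0|exact: translation_continuousU].
have mB N : measurable (B N) by case: (cB N).
set A := \bigcup_i F i; have mA : measurable A by exact: bigcupT_measurable.
move=> K e e0; have e30 : 0 < e / 3 by rewrite divr_gt0.
have [N hN] : exists N, (beta (cball 0%R (K + 1) `&` (A `\` B N)) <= (e / 3)%:E)%E.
  have : beta (cball 0 (K + 1) `&` (A `\` B N)) @[N --> \oo] -->
      beta (\bigcap_N (cball 0 (K + 1) `&` (A `\` B N))).
    apply: nonincreasing_cvg_mu.
    - apply: le_lt_trans (_ : (beta (cball 0 (`|K| + 1)) < +oo)%E); last first.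
        by rewrite borel_lebesgue_cball ?ltry// addr_ge0.
      apply: le_measure; rewrite ?inE; [|exact: measurable_cball|].
        by apply: measurableI; [exact: measurable_cball|exact: measurableD].
      by move=> y [h _]; apply: cballS h; rewrite lerD2r ler_norm.
    - by move=> N; apply: measurableI; [exact: measurable_cball|exact: measurableD].
    - by apply: bigcapT_measurable => N; apply: measurableI; [exact: measurable_cball|exact: measurableD].
    - move=> N M NM; apply/subsetPset => y [h [Ay nB]]; split => //; split => // By.
      apply: nB; move: By; rewrite /B -!bigcup_mkord => -[i iN Fi].
      by exists i => //; exact: leq_trans iN NM.
  rewrite (_ : \bigcap_N _ = set0); last first.
    apply/seteqP; split => // y h.
    have [_ [[i _ Fi] _]] := h 0%N I.
    have [_ [_]] := h i.+1 I; apply; rewrite /B -bigcup_mkord.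
    by exists i => //=.
  rewrite measure0 => /fine_cvgP[fB].
  move/cvgrPdist_le => /(_ _ e30) hB.
  have [N [fN hN]] : exists N, beta (cball 0 (K + 1) `&` (A `\` B N)) \is a fin_num /\
     `|0 - fine (beta (cball 0 (K + 1) `&` (A `\` B N)))| <= e / 3.
    near \oo => N; exists N; split; first by near: N.
    by near: N.
  exists N; rewrite -(fineK fN) lee_fin; move: hN; rewrite sub0r normrN.
  by apply: le_trans; exact: ler_norm.
have [_ /(_ K _ e30)[d1 d10 h1]] := cB N.
exists (Num.min d1 1); first by rewrite lt_min d10 ltr01.
move=> x; rewrite le_min => /andP[xd1 x1].
have mC : measurable (cball 0 (K + 1) `&` (A `\` B N)).
  by apply: measurableI; [exact: measurable_cball|exact: measurableD].
have mT := measurable_translate x mC.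
have mS : measurable (cball 0 K `&` symdiff_translate x (B N)).
  by apply: measurableI; [exact: measurable_cball|exact: measurable_symdiff_translate].
apply: (@le_trans _ _ (beta ((cball 0 K `&` symdiff_translate x (B N)) `|`
   ((cball 0 (K + 1) `&` (A `\` B N)) `|` translate x (cball 0 (K + 1) `&` (A `\` B N)))))).
  apply: le_measure; rewrite ?inE.
  - by apply: measurableI; [exact: measurable_cball|exact: measurable_symdiff_translate].
  - by apply: measurableU => //; exact: measurableU.
  - have BA : B N `<=` A.
      by rewrite /B -bigcup_mkord => y [i _ Fi]; exists i.
    move=> y [yK Sy].
    have yK1 : cball 0 (K + 1) y by apply: cballS yK; rewrite lerDl.
    have xyK1 : cball 0 (K + 1) (y - x).
      move: yK; rewrite /cball/= !sub0r !normrN => yK.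
      by apply: le_trans (ler_normB _ _) _; exact: lerD.
    case: Sy => [[Ay nAy]|[Ay nAy]].
      have [By|nBy] := pselect (B N y); last by right; left.
      left; split => //; left; split => //.
      by move=> /BA.
    have [By|nBy] := pselect (B N (y - x)); last by right; right.
    by left; split => //; right; split => // /BA.
apply: le_trans; first by apply: measureU2 => //; exact: measurableU.
rewrite (_ : e = e / 3 + (e / 3 + e / 3)); last by field.
rewrite !EFinD leeD ?h1//.
apply: le_trans; first exact: measureU2.
by rewrite leeD//; move: hN; rewrite -(borel_lebesgue_translate x mC).
Unshelve. all: by end_near. Qed.

(** For a half-open interval, a point moves in or out of the slab under a
    small shift only if its coordinate is close to one of the two endpoints:
    the symmetric difference lies in two thin slabs. *)
Lemma translation_continuous_coord i (B : set (measurableTypeR R)) :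
  measurable B -> translation_continuous [set y : 'rV[R]_n | B (y ord0 i)].
Proof.
pose G := [set B : set (measurableTypeR R) |
  translation_continuous [set y : 'rV[R]_n | B (y ord0 i)]].
suff : @measurable _ (measurableTypeR R) `<=` G by exact.
apply: smallest_sub.
  split.
  - exact: translation_continuous0.
  - by move=> C GC; rewrite setTD; exact: translation_continuousC GC.
  - move=> F GF; rewrite /G/=.
    rewrite (_ : [set y : 'rV[R]_n | _] = \bigcup_k [set y : 'rV[R]_n | F k (y ord0 i)]).
      by apply: translation_continuous_bigcup => k; exact: GF.
    by apply/seteqP; split => y [k _ Fk]; exists k.
move=> _ [[a b]] _ <-; rewrite /G/=.
set A := [set y | _].
have mA : measurable A.
  have := @measurable_coord R n i measurableT `]a, b]%classic (measurable_itv _).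
  by rewrite setTI.
split => // K e e0.
have [K0|K0] := ltP K 0.
  exists 1 => // x _; rewrite (_ : _ `&` _ = set0) ?measure0 ?lee_fin ?ltW//.
  apply/seteqP; split => // y [/= h _]; have := le_lt_trans h K0.
  by rewrite normr_lt0.
pose M := \prod_(j < n | j != i) (2 * K).
have M0 : 0 <= M by apply: prodr_ge0 => j _; rewrite mulr_ge0.
pose S (c del : R) : set 'rV[R]_n :=
  box (fun j => if j == i then `[c - del, c + del] else `[- K, K])%classic.
have slab (c del : R) : 0 <= del -> beta (S c del) = (2 * del * M)%:E.
  move=> d0; rewrite borel_lebesgue_boxE; last by move=> j; case: ifPn => _; exact: measurable_itv.
  rewrite (bigD1 i)//= eqxx EFinM; congr (_ * _)%E.
    rewrite lebesgue_measure_itv/= lte_fin; case: ifPn => [_|].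
      by rewrite -EFinB; congr EFin; ring.
    by rewrite -leNgt => h; congr EFin; lra.
  rewrite /M; elim/big_ind2 : _ => [//|x1 x2 y1 y2 -> ->|j ji]; first by rewrite EFinM.
  rewrite (negbTE ji) lebesgue_measure_itv/= lte_fin; case: ifPn => [_|].
    by rewrite -EFinB; congr EFin; ring.
  by rewrite -leNgt => h; congr EFin; lra.
pose del := e / (4 * (M + 1)).
have d0 : 0 < del by rewrite divr_gt0// mulr_gt0// ltr_wpDl.
have mslab c : measurable (S c del).
  by apply: measurable_box => j; case: ifPn => _; exact: measurable_itv.
exists del => // x xd.
apply: (@le_trans _ _ (beta (S a del `|` S b del))).
  apply: le_measure; rewrite ?inE.
  - by apply: measurableI; [exact: measurable_cball|exact: measurable_symdiff_translate].
  - by apply: measurableU => //; exact: mslab.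
  - move=> y [yK Sy].
    have hK j : - K <= y ord0 j <= K.
      rewrite -ler_norml; move: yK; rewrite /cball/= sub0r normrN; apply: le_trans.
      exact: ler_coord_norm.
    have /andP[xi1 xi2] : - del <= x ord0 i <= del.
      by rewrite -ler_norml; apply: le_trans xd; exact: ler_coord_norm.
    have : (a - del <= y ord0 i <= a + del) \/ (b - del <= y ord0 i <= b + del).
      case: Sy => -[]; rewrite /A/translate/= !mxE !in_itv/= => /andP[h1 h2] /negP;
        rewrite negb_and -!ltNge -!leNgt => /orP[h3|h3]; (try by left; apply/andP; split; lra);
        by right; apply/andP; split; lra.
    move=> [hi|hi]; [left|right] => j /=; case: ifPn => [/eqP ->|_];
      by rewrite /= in_itv/=.
apply: le_trans; first by apply: measureU2; exact: mslab.
apply: (@le_trans _ _ ((2 * del * M)%:E + (2 * del * M)%:E)%E).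
  by apply: leeD; [rewrite -(slab a _ (ltW d0))|rewrite -(slab b _ (ltW d0))].
rewrite -EFinD lee_fin -mulrDl.
rewrite (_ : (2 * del + 2 * del) * M = e * (M / (M + 1))); last first.
  by rewrite /del; field; rewrite gt_eqF// ltr_wpDl.
by rewrite ger_pMr// ler_pdivrMr ?ltr_wpDl// mul1r lerDl.
Qed.

(** The Borel sets are generated by the preimages of Borel sets under the
    coordinates. *)
Lemma measurable_translation_continuous A :
  measurable A -> translation_continuous A.
Proof.
suff : @measurable _ 'rV[R]_n `<=` translation_continuous by exact.
apply: smallest_sub.
  split.
  - exact: translation_continuous0.
  - by move=> C GC; rewrite setTD; exact: translation_continuousC GC.
  - by move=> F GF; exact: translation_continuous_bigcup.
rewrite -bigcup_seq/= => _ [i _ [B mB <-]].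
by rewrite setTI; exact: translation_continuous_coord.
Qed.

(** A point [y] of [A] whose difference [x - y] is outside [A] has, by
    symmetry, [y - x] outside [A], hence belongs to the symmetric difference
    of [A] and its translate by [x]. For small [x] the latter has at most
    half the measure of [A]. *)
Lemma steinhaus A K : measurable A -> A `<=` cball 0 K ->
  (forall y, A y -> A (- y)) -> (0 < beta A)%E ->
  exists2 c, 0 < c & exists2 del, 0 < del & forall x, `|x| <= del ->
    (c%:E <= beta (A `&` [set y | A (x - y)%R]))%E.
Proof.
move=> mA AK sA A0.
have Afin : beta A \is a fin_num.
  rewrite ge0_fin_numE// (@le_lt_trans _ _ (beta (cball 0 `|K|)))//.
    apply: le_measure; rewrite ?inE//; first exact: measurable_cball.
    by move=> y /AK; apply: cballS; exact: ler_norm.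
  by rewrite borel_lebesgue_cball ?ltry.
pose c := fine (beta A) / 2.
have c0 : 0 < c by rewrite divr_gt0// fine_gt0// A0/= ltey_eq Afin.
exists c => //.
have [_ /(_ K c c0)[del d0 hd]] := measurable_translation_continuous mA.
exists del => // x xd.
have mI : measurable (A `&` [set y | A (x - y)%R]).
  by apply: measurableI => //; rewrite -[X in measurable X]setTI; exact: measurable_subl.
have mD : measurable (cball 0 K `&` symdiff_translate x A).
  by apply: measurableI; [exact: measurable_cball|exact: measurable_symdiff_translate].
have : (beta A <= beta (A `&` [set y | A (x - y)%R]) + beta (cball 0 K `&` symdiff_translate x A))%E.
  apply: le_trans (measureU2 _ mI mD); apply: le_measure; rewrite ?inE//.
    exact: measurableU.
  move=> y Ay; have [h|h] := pselect (A (x - y)); first by left.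
  right; split; first exact: AK.
  by left; split => // /sA; rewrite opprB.
move=> /le_trans/(_ (leeD2l _ (hd _ xd))).
rewrite -leeBlDr//; apply: le_trans.
by rewrite -(fineK Afin) -EFinB lee_fin /c; lra.
Qed.

End steinhaus.

(** * Scalar product and Euclidean norm *)

Section dot_theory.
Context {R : realType} {n : nat}.
Implicit Types (x y z : 'rV[R]_n) (c : R).

Lemma dotC x y : dot x y = dot y x.
Proof. by apply: eq_bigr => i _; rewrite mulrC. Qed.

Lemma dotDl x y z : dot (x + y) z = dot x z + dot y z.
Proof. by rewrite -big_split; apply: eq_bigr => i _; rewrite mxE mulrDl. Qed.

Lemma dotZl c x y : dot (c *: x) y = c * dot x y.
Proof. by rewrite /dot mulr_sumr; apply: eq_bigr => i _; rewrite mxE mulrA. Qed.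

Lemma dotNl x y : dot (- x) y = - dot x y.
Proof. by rewrite -scaleN1r dotZl mulN1r. Qed.

Lemma dotBl x y z : dot (x - y) z = dot x z - dot y z.
Proof. by rewrite dotDl dotNl. Qed.

Lemma dot0l x : dot 0 x = 0.
Proof. by rewrite -(scale0r 0) dotZl mul0r. Qed.

Lemma dotDr x y z : dot x (y + z) = dot x y + dot x z.
Proof. by rewrite dotC dotDl !(dotC x). Qed.

Lemma dotZr c x y : dot x (c *: y) = c * dot x y.
Proof. by rewrite dotC dotZl dotC. Qed.

Lemma dotNr x y : dot x (- y) = - dot x y.
Proof. by rewrite dotC dotNl dotC. Qed.

Lemma dotBr x y z : dot x (y - z) = dot x y - dot x z.
Proof. by rewrite dotDr dotNr. Qed.

Lemma dot0r x : dot x 0 = 0.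
Proof. by rewrite dotC dot0l. Qed.

Lemma dot_delta x i : dot x (delta_mx ord0 i) = x ord0 i.
Proof.
rewrite /dot (bigD1 i)//= big1 ?addr0 => [|j ji]; first by rewrite mxE !eqxx mulr1.
by rewrite mxE eqxx (negbTE ji) mulr0.
Qed.

Lemma dotxx_ge0 x : 0 <= dot x x.
Proof. by apply: sumr_ge0 => i _; rewrite -expr2 sqr_ge0. Qed.

Lemma enorm_ge0 x : 0 <= enorm x. Proof. exact: sqrtr_ge0. Qed.

Lemma sqr_enorm x : enorm x ^+ 2 = dot x x.
Proof. by rewrite sqr_sqrtr// dotxx_ge0. Qed.

Lemma normr_le_enorm x : `|x| <= enorm x.
Proof.
rewrite mx_norm_le ?enorm_ge0//; apply/forallP => i.
rewrite -sqrtr_sqr ler_sqrt ?dotxx_ge0// /dot (bigD1 i)//= -expr2 lerDl.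
by apply: sumr_ge0 => j _; rewrite -expr2 sqr_ge0.
Qed.

Lemma enorm_eq0 x : (enorm x == 0) = (x == 0).
Proof.
apply/eqP/eqP => [x0|->]; last by rewrite /enorm dot0l sqrtr0.
by apply/eqP; rewrite -normr_eq0 eq_le normr_ge0 andbT -x0 normr_le_enorm.
Qed.

Lemma enorm_gt0 x : (0 < enorm x) = (x != 0).
Proof. by rewrite lt_def enorm_ge0 andbT enorm_eq0. Qed.

Lemma enorm0 : enorm (0 : 'rV[R]_n) = 0.
Proof. by apply/eqP; rewrite enorm_eq0. Qed.

Lemma enormZ c x : enorm (c *: x) = `|c| * enorm x.
Proof.
rewrite /enorm dotZl dotZr mulrA -expr2 sqrtrM ?sqr_ge0//.
by rewrite sqrtr_sqr.
Qed.

Lemma enormN x : enorm (- x) = enorm x.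
Proof. by rewrite -scaleN1r enormZ normrN1 mul1r. Qed.

Lemma enorm_delta i : enorm (delta_mx ord0 i : 'rV[R]_n) = 1.
Proof. by rewrite /enorm dot_delta mxE !eqxx sqrtr1. Qed.

Lemma dot_le_enorm x y : dot x y <= enorm x * enorm y.
Proof.
have [->|x0] := eqVneq x 0; first by rewrite dot0l enorm0 mul0r.
have [->|y0] := eqVneq y 0; first by rewrite dot0r enorm0 mulr0.
have := dotxx_ge0 (enorm y *: x - enorm x *: y).
have ? : 0 < enorm x by rewrite enorm_gt0.
have ? : 0 < enorm y by rewrite enorm_gt0.
have xy0 : 0 < enorm x * enorm y by rewrite mulr_gt0.
rewrite !(dotBl, dotBr, dotZl, dotZr) (dotC y x) -!sqr_enorm => h.
rewrite -(ler_pM2l xy0); nra.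
Qed.

Lemma normr_dot_le x y : `|dot x y| <= enorm x * enorm y.
Proof.
by rewrite ler_norml dot_le_enorm andbT lerNl -dotNl -(enormN x) dot_le_enorm.
Qed.

Lemma enormD x y : enorm (x + y) <= enorm x + enorm y.
Proof.
rewrite -(@ler_pXn2r _ 2) ?nnegrE ?addr_ge0 ?enorm_ge0// sqr_enorm.
rewrite dotDl !dotDr (dotC y x) sqrrD !sqr_enorm.
by have := dot_le_enorm x y; lra.
Qed.

Lemma enorm_le_normr x : enorm x <= n%:R * `|x|.
Proof.
rewrite -(@ler_pXn2r _ 2) ?nnegrE ?mulr_ge0 ?enorm_ge0// sqr_enorm.
apply: (@le_trans _ _ (\sum_(i < n) `|x| ^+ 2)).
  apply: ler_sum => i _; rewrite -expr2 -real_normK ?num_real//.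
  by rewrite ler_pXn2r ?nnegrE// ler_coord_norm.
rewrite sumr_const card_ord exprMn -[X in X <= _]mulr_natl ler_wpM2r ?sqr_ge0//.
rewrite -natrX ler_nat; case: (n) => // m; exact: (@leq_pexp2l m.+1 1 2).
Qed.

Lemma normr_dot_le_normr x y : `|dot x y| <= n%:R * `|x| * enorm y.
Proof.
apply: le_trans (normr_dot_le x y) _; rewrite ler_wpM2r ?enorm_ge0//.
exact: enorm_le_normr.
Qed.

Lemma measurable_dot y : measurable_fun setT (fun x => dot x y).
Proof.
apply: measurable_sum => i; apply: measurable_funM => //.
exact: measurable_coord.
Qed.

Lemma measurable_dotl y : measurable_fun setT (dot y).
Proof.
by have := measurable_dot y; under eq_fun do rewrite dotC.
Qed.

Lemma measurable_expR_dot y : measurable_fun setT (fun x => expR (dot y x)).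
Proof. by apply: measurableT_comp => //; exact: measurable_dotl. Qed.

Lemma measurable_expN y : measurable_fun setT (fun x => expR (- dot y x)).
Proof.
have := measurable_expR_dot (- y); apply: eq_measurable_fun => x _.
by rewrite dotNl.
Qed.

Lemma measurable_enorm : measurable_fun setT (@enorm R n).
Proof.
have m1 : measurable_fun setT (@Num.sqrt R).
  by apply: continuous_measurable_fun; exact: sqrt_continuous.
have m2 : measurable_fun setT (fun x : 'rV[R]_n => dot x x).
  by apply: measurable_sum => i; apply: measurable_funM => //; exact: measurable_coord.
exact: measurableT_comp m1 m2.
Qed.

End dot_theory.

(** * Reduction to a Borel density *)

Section exp_integrable.
Context (R : realType) (n : nat).
Notation beta := (@borel_lebesgue R n).

(** Comparison with a sum over unit shells: the polynomial volume of the
    k-th ball is absorbed by half of the exponent and a geometric series is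
    left. *)
Lemma exp_tail_integral_lty (g : 'rV[R]_n -> R) (C c : R) : 0 < c ->
  measurable_fun setT g -> (forall x, 0 <= g x) ->
  (forall x, g x <= C * expR (- (c * `|x|))) ->
  (\int[beta]_x (g x)%:E < +oo)%E.
Proof.
move=> c0 mg g0 gC.
have C0 : 0 <= C.
  have := le_trans (g0 0) (gC 0).
  by rewrite pmulr_lge0// expR_gt0.
pose u (k : nat) (x : 'rV[R]_n) := (C * expR (- (c * k%:R)) * \1_(cball 0 k.+1%:R) x)%:E.
have mu_ k : measurable_fun setT (u k).
  apply/measurable_EFinP; apply: measurable_funM => //.
  by apply: measurable_indic; exact: measurable_cball.
have u0 k x : (0 <= u k x)%E.
  by rewrite lee_fin mulr_ge0// mulr_ge0// expR_ge0.
have gu x : ((g x)%:E <= \sum_(k <oo) u k x)%E.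
  pose k := Num.truncn `|x|.
  apply: (@le_trans _ _ (u k x)); last first.
    rewrite (nneseries_split 0 k.+1)//= big_mkord big_ord_recr/=.
    rewrite -addeA addeCA leeDl// adde_ge0//; first exact: sume_ge0.
    exact: nneseries_ge0.
  rewrite /u indicE mem_set/=; last first.
    by rewrite /cball/= sub0r normrN ltW// truncnS_gt.
  rewrite mulr1 lee_fin; apply: le_trans (gC x) _; rewrite ler_wpM2l// ler_expR.
  by rewrite lerN2 ler_pM2l// truncn_le.
have mS : measurable_fun setT (fun x => \sum_(k <oo) u k x)%E.
  by apply: ge0_emeasurable_sum => // k x _ _; exact: u0.
apply: (@le_lt_trans _ _ (\int[beta]_x (\sum_(k <oo) u k x)%E)%E).
  apply: ge0_le_integral => //.
  - by move=> x _; rewrite lee_fin.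
  - exact/measurable_EFinP.
rewrite integral_nneseries//.
pose q := expR (- (c / 2)).
have q1 : q < 1 by rewrite -expR0 ltr_expR; lra.
have q0 : 0 < q by exact: expR_gt0.
pose M := C * (4 * (n.+1%:R / c)) ^+ n * expR (c / 2).
have M0 : 0 <= M by rewrite mulr_ge0 ?expR_ge0// mulr_ge0// exprn_ge0// mulr_ge0// divr_ge0// ltW.
have uq k : (\int[beta]_x u k x <= (M * q ^+ k)%:E)%E.
  rewrite /u; under eq_integral do rewrite EFinM.
  rewrite ge0_integralZl//; last 2 first.
  - by apply/measurable_EFinP; apply: measurable_indic; exact: measurable_cball.
  - by rewrite lee_fin mulr_ge0// expR_ge0.
  rewrite integral_indic//= ?setIT; last exact: measurable_cball.
  rewrite borel_lebesgue_cball// -EFinM lee_fin.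
  (* [y ^+ n <= expR (n * y)] at [y = c (k + 1) / (2 (n + 1))] *)
  have h : (2 * k.+1%:R) ^+ n <= (4 * (n.+1%:R / c)) ^+ n * expR (c / 2 * k.+1%:R).
    rewrite (_ : 2 * k.+1%:R = 4 * (n.+1%:R / c) * (c / 2 * k.+1%:R / n.+1%:R)); last first.
      by field; rewrite gt_eqF//= ?pnatr_eq0 ?gt_eqF.
    rewrite [X in X <= _]exprMn; apply: ler_wpM2l.
      by apply: exprn_ge0; rewrite mulr_ge0// divr_ge0// ltW.
    apply: (@le_trans _ _ (expR (c / 2 * k.+1%:R / n.+1%:R) ^+ n)).
      rewrite lerXn2r ?nnegrE ?expR_ge0 ?mulr_ge0 ?invr_ge0 ?(ltW c0)//.
      by apply: le_trans (expR_ge1Dx _); rewrite lerDr.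
    rewrite -expRM_natl ler_expR mulrA ler_pdivrMr//.
    by rewrite mulrC ler_wpM2l ?ler_nat// mulr_ge0 ?divr_ge0 ?ltW.
  apply: (@le_trans _ _ (C * expR (- (c * k%:R)) * ((4 * (n.+1%:R / c)) ^+ n * expR (c / 2 * k.+1%:R)))).
    by rewrite ler_wpM2l// mulr_ge0// expR_ge0.
  rewrite /M /q -expRM_natl le_eqVlt; apply/orP; left; apply/eqP.
  rewrite -!mulrA; congr (_ * _); rewrite mulrCA; congr (_ * _).
  by rewrite -!expRD; congr expR; rewrite -natr1; field.
apply: (@le_lt_trans _ _ (M / (1 - q))%:E); last exact: ltry.
apply: lime_le.
  by apply: is_cvg_nneseries => k _ _; apply: integral_ge0 => x _; exact: u0.
apply: nearW => N; apply: (@le_trans _ _ (\sum_(0 <= k < N) (M * q ^+ k)%:E)%E).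
  by apply: lee_sum => k _; exact: uq.
rewrite sumEFin lee_fin -mulr_sumr ler_wpM2l// -div1r ler_pdivlMr ?subr_gt0//.
rewrite big_mkord mulrC.
have := subrX1 q N; rewrite -opprB => /eqP; rewrite eqr_oppLR => /eqP; rewrite -mulNr opprB => <-.
by rewrite gerBl exprn_ge0// ltW.
Qed.

End exp_integrable.

Lemma measureU_eq0 d (T : measurableType d) (R : realType)
    (mu : {measure set T -> \bar R}) (A B : set T) : measurable A -> measurable B ->
  mu A = 0%E -> mu B = 0%E -> mu (A `|` B) = 0%E.
Proof.
move=> mA mB A0 B0; apply: measure_negligible; first exact: measurableU.
by apply: negligibleU; apply/negligibleP.
Qed.

Section reduction.
Context {R : realType} {n : nat}.
Notation beta := (@borel_lebesgue R n).
Notation lam := (@lebesgue_rV R n).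
Implicit Types f h : 'rV[R]_n -> R.

(** Convolution with respect to the Borel measure rather than its
    completion, so that the theorems on product measures apply. *)
Definition bconv f h x : R := fine (\int[beta]_y (f (x - y) * h y)%:E).

Lemma measurable_sub2 : measurable_fun setT (fun z : 'rV[R]_n * 'rV[R]_n => z.1 - z.2).
Proof.
apply: measurable_fun_rVP => i; under eq_fun do rewrite !mxE.
apply: measurable_funB.
  exact: (measurableT_comp (measurable_coord i) measurable_fst).
exact: (measurableT_comp (measurable_coord i) measurable_snd).
Qed.

Lemma measurable_bconv f h : measurable_fun setT f -> measurable_fun setT h ->
  (forall x, 0 <= f x) -> (forall x, 0 <= h x) -> measurable_fun setT (bconv f h).
Proof.
move=> mf mh f0 h0.
pose F (z : 'rV[R]_n * 'rV[R]_n) := (f (z.1 - z.2) * h z.2)%:E.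
suff mI : measurable_fun setT (fun x => \int[beta]_y F (x, y))%E.
  exact: (measurableT_comp (fine_measurable measurableT) mI).
apply: (@measurable_fun_fubini_tonelli_F _ _ _ _ _ beta F).
- apply/measurable_EFinP; apply: measurable_funM.
    exact: measurableT_comp mf measurable_sub2.
  exact: (measurableT_comp mh measurable_snd).
- by move=> z; rewrite lee_fin mulr_ge0.
Qed.

Lemma bconv_ge0 f h x : (forall x, 0 <= f x) -> (forall x, 0 <= h x) -> 0 <= bconv f h x.
Proof.
by move=> f0 h0; apply: fine_ge0; apply: integral_ge0 => y _; rewrite lee_fin mulr_ge0.
Qed.

(** Setting [a] to zero on a Borel null set [Z] makes it Borel; the union of
    the null set with its reflection keeps the result even. For each [x] the
    integrands of the two convolutions differ only on a null set, so already
    the convolution square is unchanged at every point, and the later powers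
    with it; only the first power itself depends on the representative. *)
Lemma borel_version (a : 'rV[R]_n -> R) :
  measurable_fun setT (a : rV_lebesgue R n -> R) ->
  (forall x, 0 <= a x) -> (forall x, a x = a (- x)) ->
  exists f : 'rV[R]_n -> R, [/\ measurable_fun setT f,
    forall x, 0 <= f x <= a x, forall x, f (- x) = f x,
    forall h, measurable_fun setT h -> (forall x, 0 <= h x) ->
      (\int[lam]_x (h x * a x)%:E = \int[beta]_x (h x * f x)%:E)%E &
    forall k, conv_pow a k.+2 = iter k.+1 (bconv f) f].
Proof.
move=> ma a0 aE.
have [G [mG G0] GP] := caratheodory_fun_borel_core ma.
have mNG : measurable (-%R @^-1` G : set 'rV[R]_n).
  rewrite -[X in measurable X]setTI.
  have := @measurable_subl R n 0 measurableT G mG.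
  by rewrite (_ : (fun y => 0 - y) = -%R)//; apply/funext => y; rewrite sub0r.
have NG0 : beta (-%R @^-1` G) = 0%E.
  rewrite -[RHS]G0 -[RHS](borel_lebesgue_subl 0 mG).
  by congr (beta _); apply/seteqP; split => y /=; rewrite sub0r.
pose Z := G `|` -%R @^-1` G.
have mZ : measurable Z by exact: measurableU.
have Z0 : beta Z = 0%E.
  exact: measureU_eq0.
have ZN x : Z (- x) = Z x.
  by rewrite /Z/=; apply/propext; split => -[]; rewrite /= ?opprK; tauto.
pose f := (fun x => a x * \1_(~` Z) x).
have mf : measurable_fun setT f by apply: GP => // x Gx; left.
have fa x : ~ Z x -> f x = a x.
  by move=> Zx; rewrite /f indicE mem_set// mulr1.
have f0a x : 0 <= f x <= a x.
  have [Zx|Zx] := pselect (Z x); last by rewrite fa// a0 lexx.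
  by rewrite /f indicE memNset ?mulr0 ?lexx ?a0//; apply.
have f0 x : 0 <= f x by have /andP[] := f0a x.
have mZx (x : 'rV[R]_n) : measurable ((fun y => x - y) @^-1` Z).
  by rewrite -[X in measurable X]setTI; exact: (measurable_subl x measurableT mZ).
have mfx (x : 'rV[R]_n) : measurable_fun setT (fun y : 'rV[R]_n => f (x - y)).
  exact: (measurableT_comp mf (measurable_subl x)).
have conv2 x (b h : 'rV[R]_n -> R) (W : set 'rV[R]_n) : measurable_fun setT h ->
    (forall y, 0 <= h y) -> (forall y, 0 <= b y) -> measurable W -> beta W = 0%E ->
    (forall y, ~ W y -> b y = h y) -> convolution a b x = bconv f h x.
  move=> mh h0 b0 mW W0 bh; congr fine.
  apply: (@integral_completed_ae _ _ _ beta _ _ (((fun y => x - y) @^-1` Z) `|` W)).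
  - by apply/measurable_EFinP; apply: measurable_funM => //; exact: mfx.
  - by move=> y; rewrite lee_fin mulr_ge0.
  - by move=> y; rewrite lee_fin mulr_ge0.
  - exact: measurableU.
  - by apply: measureU_eq0 => //; rewrite -[RHS]Z0; exact: borel_lebesgue_subl.
  - by move=> y /not_orP[Zy Wy]; rewrite bh// fa.
exists f; split => //.
- move=> x; have [Zx|Zx] := pselect (Z x); last first.
    by rewrite !fa// ?ZN// -aE.
  by rewrite /f !indicE !memNset ?mulr0//= ?ZN; apply.
- move=> h mh h0; apply: (@integral_completed_ae _ _ _ beta _ _ Z) => //.
  - by apply/measurable_EFinP; exact: measurable_funM.
  - by move=> y; rewrite lee_fin mulr_ge0.
  - by move=> y; rewrite lee_fin mulr_ge0.
  - by move=> y Zy; rewrite fa.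
- have mk k : measurable_fun setT (iter k (bconv f) f) /\ forall x, 0 <= iter k (bconv f) f x.
    elim: k => [|k [mk k0]]; first by split.
    by split; [exact: measurable_bconv|move=> x; exact: bconv_ge0].
  elim=> [|k ih].
    by apply/funext => x; apply: (conv2 _ _ _ Z) => // y Zy; rewrite fa.
  apply/funext => x; rewrite [LHS]/(convolution a (conv_pow a k.+2) x) ih.
  have [m1 m2] := mk k.+1.
  by apply: (conv2 _ _ _ set0) => //; rewrite measure0.
Qed.

End reduction.

(** * Lower semicontinuity and compactness *)

Section lsc_margin.
Context (R : realType) (n : nat).
Implicit Types (G : 'rV[R]_n -> \bar R) (K : set 'rV[R]_n) (phi : 'rV[R]_n -> R).

Definition lsc G := forall x (y : R), (y%:E < G x)%E ->
  \forall x' \near x, (y%:E < G x')%E.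

(** A lower semicontinuous function strictly above a continuous one on a
    compact set stays above it by a positive margin; locally, a value
    strictly between the two separates them. In this form it gives the
    attainment of suprema below, for functions that may be infinite. *)
Lemma lsc_compact_margin G K phi : lsc G -> compact K -> continuous phi ->
  (forall x, K x -> ((phi x)%:E < G x)%E) ->
  exists2 eta, 0 < eta & forall x, K x -> ((phi x + eta)%:E <= G x)%E.
Proof.
move=> lscG /compact_near_coveringP cK cphi phiG.
have H : \forall eta \near (0 : R)^'+, K `<=` [set x | ((phi x + eta)%:E <= G x)%E].
  apply: cK => x Kx.
  have [y /andP[phiy yG]] : exists y : R, (phi x < y) && (y%:E < G x)%E.
    case: (G x) (phiG x Kx) => [g| |//]; rewrite ?lte_fin => h.
      by exists ((phi x + g) / 2); rewrite lte_fin; apply/andP; split; lra.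
    by exists (phi x + 1); rewrite ltry andbT ltrDl.
  have t0 : 0 < (y - phi x) / 2 by rewrite divr_gt0// subr_gt0.
  have h1 := lscG _ _ yG.
  have h2 : \forall x' \near x, phi x' < phi x + (y - phi x) / 2.
    have /cvgrPdist_lt/(_ _ t0) := cphi x.
    apply: filterS => x' /=; rewrite distrC => /ltr_distlDr.
    by rewrite addrC.
  have h3 := nbhs_right_lt t0.
  exists ([set x' | (y%:E < G x')%E] `&` [set x' | phi x' < phi x + (y - phi x) / 2],
          [set eta | eta < (y - phi x) / 2]).
    by split => //=; exact: filterI.
  move=> [x' eta] /= [[yG' phi'] etat]; apply: ltW; apply: lt_trans yG'.
  by rewrite lte_fin; lra.
near (0 : R)^'+ => eta; exists eta => //.
suff : K `<=` [set x | ((phi x + eta)%:E <= G x)%E] by exact.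
by near: eta.
Unshelve. all: by end_near. Qed.

Lemma lipschitz_continuous (f : 'rV[R]_n -> R) (C : R) : 0 <= C ->
  (forall x y, `|f x - f y| <= C * `|x - y|) -> continuous f.
Proof.
move=> C0 fC x A /nbhs_ballP[e /= e0 eA]; apply/nbhs_ballP.
have C1 : 0 < C + 1 by rewrite ltr_wpDl.
exists (e / (C + 1)) => /=; first by rewrite divr_gt0.
move=> y; rewrite -ball_normE/= ltr_pdivlMr// => xy; apply: eA.
rewrite -ball_normE/=; apply: le_lt_trans (fC x y) _; apply: le_lt_trans xy.
by rewrite mulrC ler_wpM2l// lerDl.
Qed.

Lemma continuous_dotB (s : 'rV[R]_n) (m : R) : continuous (fun x => dot x s - m).
Proof.
apply: (@lipschitz_continuous _ (n%:R * enorm s)).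
  by rewrite mulr_ge0// enorm_ge0.
move=> x y; rewrite opprB addrA subrK -dotBl mulrAC.
exact: normr_dot_le_normr.
Qed.

Lemma compact_ball0 (r : R) : compact [set x : 'rV[R]_n | `|x| <= r].
Proof.
apply: bounded_closed_compact.
  by exists r; split; [exact: num_real|move=> M rM x /= xr; exact: le_trans xr (ltW rM)].
apply: (@closed_comp _ _ (fun x : 'rV[R]_n => `|x|) [set y | y <= r]).
  by move=> x _; exact: norm_continuous.
exact: closed_le.
Qed.

Lemma compact_sphere (x0 : 'rV[R]_n) (r : R) : compact [set x : 'rV[R]_n | `|x - x0| = r].
Proof.
apply: bounded_closed_compact.
  exists (r + `|x0|); split; first exact: num_real.
  move=> M rM x /= xr; apply: le_trans (ltW rM).
  by rewrite -(subrK x0 x) (le_trans (ler_normD _ _))// xr.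
apply: (@closed_comp _ _ (fun x : 'rV[R]_n => `|x - x0|) [set y | y = r]).
  move=> x _; apply: (@lipschitz_continuous _ 1) => // {}x y.
  rewrite mul1r; apply: le_trans (ler_dist_dist _ _) _.
  by rewrite opprB addrA subrK.
exact: closed_eq.
Qed.

End lsc_margin.

Section exp_bounds.
Context {R : realType}.

Lemma expR_le_quad (x : R) : x <= 2^-1 -> expR x <= 1 + x + 2 * x ^+ 2.
Proof.
move=> x2; have h : 1 - x <= expR (- x) by exact: expR_ge1Dx.
have x1 : 0 < 1 - x by lra.
rewrite -[expR x]invrK -expRN.
apply: (@le_trans _ _ (1 - x)^-1).
  by rewrite lef_pV2// posrE expR_gt0.
rewrite -div1r ler_pdivrMr//; nra.
Qed.

(** First-order comparison at [h = 0]: the slope [u] of the lower line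
    cannot exceed the derivative [c]. *)
Lemma expR_slope_le (c u : R) :
  (forall h, 0 < h -> h <= 1 -> 1 + h * u <= expR (h * c)) -> u <= c.
Proof.
move=> H; rewrite leNgt; apply/negP => cu.
(* [h = 1 / D] is so small that [h c <= 1/2], where the quadratic bound for
   [expR] holds, and that its error [2 h c^2] is below half of [u - c] *)
pose D := 2 * (1 + `|c|) + 4 * (1 + c ^+ 2) / (u - c).
have uc : 0 < u - c by rewrite subr_gt0.
have c1 : c <= `|c| by exact: ler_norm.
have c2 : 0 <= c ^+ 2 by exact: sqr_ge0.
have q0 : 0 < 4 * (1 + c ^+ 2) / (u - c) by rewrite divr_gt0// mulr_gt0//; lra.
have D0 : 2 <= D by have := normr_ge0 c; rewrite /D; lra.
pose h := D^-1.
have h0 : 0 < h by rewrite invr_gt0; lra.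
have h1 : h <= 2^-1 by rewrite lef_pV2 ?posrE; lra.
have hD : h * D = 1 by rewrite mulVf// gt_eqF//; lra.
have hA : h * (2 * (1 + `|c|)) <= 1.
  by rewrite -[X in _ <= X]hD ler_pM2l// lerDl ltW.
have hq : h * (4 * (1 + c ^+ 2) / (u - c)) <= 1.
  rewrite -[X in _ <= X]hD ler_pM2l// lerDr.
  by have := normr_ge0 c; lra.
have hB : h * (4 * (1 + c ^+ 2)) <= u - c by rewrite mulrA ler_pdivrMr// mul1r in hq.
have hc : h * c <= 2^-1 by nra.
have hh1 : h <= 1 by lra.
have := le_trans (H h h0 hh1) (expR_le_quad hc).
rewrite exprMn -addrA lerD2l -subr_ge0.
rewrite (_ : _ - _ = h * (c - u + 2 * (h * c ^+ 2))); last by ring.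
rewrite pmulr_rge0// => hf.
have : h * c ^+ 2 <= (u - c) / 4 - h by lra.
lra.
Qed.

End exp_bounds.

(** * Legendre duality for the rate function *)

Section rate_duality.
Context {R : realType} {n : nat}.
Variable a : 'rV[R]_n -> R.
Implicit Types (g r s x : 'rV[R]_n).

(** The duality uses the following properties of [Lambda] only: [lam] and
    [ell] stand for its values and their logarithms on the set [dom] where
    it is finite. *)
Variables (dom : 'rV[R]_n -> Prop) (lam ell : 'rV[R]_n -> R).
Hypothesis domE : forall g, dom g -> Lambda a g = (lam g)%:E.
Hypothesis not_dom : forall g, ~ dom g -> Lambda a g = +oo%E.
Hypothesis expR_ell : forall g, dom g -> expR (ell g) = lam g.
Hypothesis dom0 : dom 0.
Hypothesis lam0 : lam 0 = 1.
Hypothesis Lam_lsc : lsc (Lambda a).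
Hypothesis ell_convex : forall g g' t, dom g -> dom g' -> 0 <= t -> t <= 1 ->
  dom (t *: g + (1 - t) *: g') /\
  ell (t *: g + (1 - t) *: g') <= t * ell g + (1 - t) * ell g'.
Hypothesis ell_strict : forall g g', dom g -> dom g' ->
  2^-1 * ell g + (1 - 2^-1) * ell g' <= ell (2^-1 *: g + (1 - 2^-1) *: g') -> g = g'.
Variable sig : R.
Hypothesis sig_gt0 : 0 < sig.
Hypothesis Lam_grow : forall g, dom g -> 1 + sig * `|g| ^+ 2 <= lam g.

Hypothesis lam_ge1 : forall g, dom g -> 1 <= lam g.

Lemma lam_pos g : dom g -> 0 < lam g.
Proof. by move=> /lam_ge1; apply: lt_le_trans. Qed.

Lemma ellE g : dom g -> ell g = ln (lam g).
Proof. by move=> dg; rewrite -expR_ell// expRK. Qed.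

Lemma ell0 : ell 0 = 0. Proof. by rewrite ellE// lam0 ln1. Qed.

Lemma logLambdaE g : dom g -> logLambda a g = (ell g)%:E.
Proof. by move=> dg; rewrite /logLambda domE// lne_EFin ?lam_pos// ellE. Qed.

Lemma logLambday g : ~ dom g -> logLambda a g = +oo%E.
Proof.
by move=> /not_dom dg; rewrite /logLambda dg.
Qed.

Opaque Lambda dot enorm.

Lemma rate_ge g s : dom g -> ((dot g s - ell g)%:E <= rate a s)%E.
Proof.
move=> dg; apply: ereal_sup_ubound; exists g => //.
by rewrite logLambdaE.
Qed.

Lemma rate_le s m : (forall g, dom g -> dot g s - ell g <= m) -> (rate a s <= m%:E)%E.
Proof.
move=> H; apply: ge_ereal_sup => _ [g _ <-].
have [dg|dg] := pselect (dom g); first by rewrite logLambdaE// lee_fin; exact: H.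
by rewrite logLambday// leNye.
Qed.

Lemma rate_ge0 s : (0 <= rate a s)%E.
Proof. by have := rate_ge s dom0; rewrite dot0l ell0 subr0. Qed.

Definition is_max s g0 := dom g0 /\
  forall g, dom g -> dot g s - ell g <= dot g0 s - ell g0.

Lemma rate_max s g0 : is_max s g0 -> rate a s = (dot g0 s - ell g0)%:E.
Proof.
move=> [dg h]; apply/eqP; rewrite eq_le rate_ge// andbT.
exact: rate_le.
Qed.

Lemma is_max_uniq s g1 g2 : is_max s g1 -> is_max s g2 -> g1 = g2.
Proof.
move=> [d1 h1] [d2 h2]; apply: ell_strict => //.
have [dm _] := @ell_convex g1 g2 2^-1 d1 d2 ltac:(lra) ltac:(lra).
have := h1 _ dm; have := h2 _ d1; have := h1 _ d2.
rewrite !dotDl !dotZl.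
move: (ell (_ + _)) (ell g1) (ell g2) (dot g1 s) (dot g2 s) => A B C D E.
lra.
Qed.

Lemma logLambda_lsc : lsc (logLambda a).
Proof.
move=> x y; have [dx|dx] := pselect (dom x).
  rewrite logLambdaE// lte_fin -ltr_expR expR_ell// => h.
  have : ((expR y)%:E < Lambda a x)%E by rewrite domE// lte_fin.
  move=> /Lam_lsc; apply: filterS => x'.
  have [dx'|dx'] := pselect (dom x'); last by rewrite logLambday// ltry.
  by rewrite domE// lte_fin logLambdaE// lte_fin -[y < _]ltr_expR expR_ell.
move=> _; have : ((expR y)%:E < Lambda a x)%E.
  by rewrite not_dom// ltry.
move=> /Lam_lsc; apply: filterS => x'.
have [dx'|dx'] := pselect (dom x'); last by rewrite logLambday// ltry.
by rewrite domE// lte_fin logLambdaE// lte_fin -[y < _]ltr_expR expR_ell.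
Qed.

(** The gap between [g.s - ell g] and its maximum is positive on the sphere
    of radius [rho] around [g0] by uniqueness of the maximizer, hence
    bounded below there, hence by concavity it grows at least linearly
    outside the sphere. For small [v] the term [g.v] cannot make up for this
    gap, so that only the [g] within [rho] of [g0] matter for the supremum
    at [s + v]. *)
Lemma rate_expansion s g0 : is_max s g0 -> forall e, 0 < e ->
  exists2 del, 0 < del & forall v, enorm v <= del ->
    (rate a (s + v) <= (dot g0 (s + v) - ell g0 + e * enorm v)%:E)%E.
Proof.
move=> maxg0 e e0; have [dg0 max0] := maxg0.
set m := dot g0 s - ell g0.
(* within [rho] of [g0] in the maximum norm, [g.v] changes by at most [e *
   enorm v] *)
pose rho := e / n.+1%:R.
have rho0 : 0 < rho by rewrite divr_gt0.
have [eta eta0 heta] : exists2 eta, 0 < eta & forall g, `|g - g0| = rho ->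
    ((dot g s - m + eta)%:E <= logLambda a g)%E.
  apply: (@lsc_compact_margin _ _ _ _ (fun g => dot g s - m) logLambda_lsc).
  - exact: compact_sphere.
  - exact: continuous_dotB.
  - move=> g /= grho; have [dg|dg] := pselect (dom g); last by rewrite logLambday// ltry.
    rewrite logLambdaE// lte_fin lt_neqAle; apply/andP; split; last first.
      by rewrite lerBlDl -lerBlDr; exact: max0.
    apply/eqP => gm; have maxg : is_max s g.
      split => [//|g' dg']; have := max0 _ dg'; rewrite -gm /m.
      by move: (ell g') (dot g' s) (dot g s) (dot g0 s) (ell g0) => A B C D E; lra.
    move: grho; rewrite (is_max_uniq maxg maxg0) subrr normr0 => rho00.
    by rewrite -rho00 ltxx in rho0.
have far g : dom g -> rho <= `|g - g0| -> dot g s - ell g <= m - eta / rho * `|g - g0|.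
  move=> dg rg; pose t := rho / `|g - g0|.
  have N0 : 0 < `|g - g0| by exact: lt_le_trans rho0 rg.
  have t0 : 0 < t by rewrite divr_gt0.
  have t1 : t <= 1 by rewrite ler_pdivrMr// mul1r.
  have [dt ct] := ell_convex dg dg0 (ltW t0) t1.
  have := heta (t *: g + (1 - t) *: g0).
  rewrite (_ : t *: g + (1 - t) *: g0 - g0 = t *: (g - g0)); last first.
    by apply/rowP => i; rewrite !mxE; ring.
  rewrite normrZ (ger0_norm (ltW t0)) /t divfK ?gt_eqF// => /(_ erefl).
  rewrite -/t logLambdaE// lee_fin dotDl !dotZl => h.
  have h2 : t * (dot g s - ell g) <= t * m - eta.
    move: h ct; rewrite /m.
    move: (ell (_ + _)) (ell g) (ell g0) (dot g s) (dot g0 s) => A B C D E h ct.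
    by lra.
  rewrite -(ler_pM2l t0); apply: le_trans h2 _.
  have e1 : t * (eta / rho * `|g - g0|) = eta by rewrite /t; field; rewrite !gt_eqF.
  by rewrite [X in _ <= X]mulrBr e1.
exists (eta / (rho * n.+1%:R)); first by rewrite divr_gt0// mulr_gt0.
move=> v vd; apply: rate_le => g dg; rewrite !dotDr.
have dv : dot g v <= dot g0 v + n.+1%:R * `|g - g0| * enorm v.
  rewrite -lerBlDl -dotBl; apply: le_trans (ler_norm _) _.
  apply: le_trans (normr_dot_le_normr _ _) _.
  by rewrite ler_wpM2r ?enorm_ge0// ler_wpM2r// ler_nat.
have [rg|rg] := leP rho `|g - g0|.
  have := far g dg rg.
  have : n.+1%:R * `|g - g0| * enorm v <= eta / rho * `|g - g0|.
    rewrite mulrAC ler_wpM2r//; move: vd; rewrite ler_pdivlMr ?mulr_gt0//.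
    move=> h; rewrite ler_pdivlMr//; apply: le_trans h.
    by rewrite le_eqVlt; apply/orP; left; apply/eqP; ring.
  have := mulr_ge0 (ltW e0) (enorm_ge0 v); rewrite /m; move: dv.
  by move: (_ * `|_| * enorm v) (e * _) (_ / _ * _) (ell g) (ell g0) (dot g s) (dot g0 s)
    (dot g v) (dot g0 v) => A B C D E F G H I *; lra.
have := max0 _ dg.
have : n.+1%:R * `|g - g0| * enorm v <= e * enorm v.
  rewrite ler_wpM2r ?enorm_ge0//.
  by have := ltW rg; rewrite /rho ler_pdivlMr// mulrC.
rewrite /m; move: dv.
by move: (_ * `|_| * enorm v) (e * _) (ell g) (ell g0) (dot g s) (dot g0 s)
    (dot g v) (dot g0 v) => A B D E F G H I *; lra.
Qed.

Lemma rate_lower s g0 v : is_max s g0 ->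
  ((dot g0 (s + v) - ell g0)%:E <= rate a (s + v))%E.
Proof. by move=> [dg0 _]; exact: rate_ge. Qed.

Lemma is_max_interior s g0 : is_max s g0 -> ([set y | rate a y < +oo]%E)° s.
Proof.
move=> maxg0; have [del d0 hd] := rate_expansion maxg0 ltr01.
have d1 : 0 < del / n.+1%:R by rewrite divr_gt0.
apply/nbhs_ballP; exists (del / n.+1%:R) => // y; rewrite -ball_normE/= => yd.
have := hd (y - s); rewrite (_ : s + (y - s) = y); last by rewrite addrC subrK.
move=> h.
apply: le_lt_trans (h _) (ltry _).
apply: le_trans (enorm_le_normr _) _; rewrite distrC.
have := ltW yd; rewrite ler_pdivlMr// mulrC; apply: le_trans.
by rewrite ler_wpM2r// ler_nat.
Qed.

(** Differentiability from two affine bounds: [rate_lower] from below and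
    [rate_expansion] from above. *)
Lemma is_max_grad s g0 : is_max s g0 -> grad (fine \o rate a) s = g0.
Proof.
move=> maxg0; apply/rowP => i; rewrite mxE.
apply: cvg_lim => //.
apply/cvgrPdist_le => e e0.
have [del d0 hd] := rate_expansion maxg0 e0.
near=> h.
have h0 : h != 0 by near: h; exact: nbhs_dnbhs_neq.
have hdel : `|h| <= del.
  near: h; apply: dnbhs0_le => //.
have env : enorm (h *: delta_mx ord0 i : 'rV[R]_n) = `|h|.
  by rewrite enormZ enorm_delta mulr1.
have := hd (h *: delta_mx ord0 i); rewrite env => /(_ hdel) up.
have := rate_lower (h *: delta_mx ord0 i) maxg0 => lo.
have fin : rate a (s + h *: delta_mx ord0 i) \is a fin_num.
  by rewrite ge0_fin_numE ?rate_ge0// (le_lt_trans up) ?ltry.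
rewrite /= (addrC _ s) (rate_max maxg0)/=.
move: up lo; rewrite -(fineK fin) !lee_fin dotDr dotZr dot_delta.
set f := fine _ => up lo.
rewrite (_ : g0 ord0 i - _ = h^-1 * (dot g0 s + h * g0 ord0 i - ell g0 - f)); last first.
  by rewrite /GRing.scale/=; field.
rewrite normrM normfV mulrC ler_pdivrMr ?normr_gt0// ler_norml.
by apply/andP; split; have := mulr_ge0 (ltW e0) (normr_ge0 h); lra.
Unshelve. all: by end_near. Qed.

(** Finiteness of the rate function at the points [s + c e_i], [|c| = d],
    makes [g.s - ell g] decrease linearly at infinity, so the supremum is a
    supremum over a ball; if it were not attained there,
    [lsc_compact_margin] would contradict that it is the supremum. *)
Lemma exists_is_max s : ([set y | rate a y < +oo]%E)° s -> exists g0, is_max s g0.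
Proof.
rewrite /interior => /nbhs_ballP[del /= d0]; rewrite -ball_normE => hd.
pose d := del / 2.
have dd0 : 0 < d by rewrite divr_gt0.
have fin i (c : R) : `|c| = d -> (rate a (s + c *: delta_mx ord0 i) < +oo)%E.
  move=> cd; apply: hd; rewrite /= opprD addrA subrr sub0r normrN.
  apply: le_lt_trans (normr_le_enorm _) _.
  rewrite enormZ enorm_delta mulr1 cd /d; lra.
pose B := \sum_(i < n) (fine (rate a (s + d *: delta_mx ord0 i)) +
                        fine (rate a (s + (- d) *: delta_mx ord0 i))).
have rf s' : 0 <= fine (rate a s') by rewrite fine_ge0// rate_ge0.
have B0 : 0 <= B by apply: sumr_ge0 => i _; rewrite addr_ge0.
have val g : dom g -> dot g s - ell g <= B - d * `|g|.
  move=> dg; suff : `|g| <= (B - (dot g s - ell g)) / d.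
    by rewrite ler_pdivlMr// => ?; lra.
  have coord i : d * `|g ord0 i| <= B - (dot g s - ell g).
    have key c : `|c| = d -> dot g s + c * g ord0 i - ell g <= fine (rate a (s + c *: delta_mx ord0 i)).
      move=> cd; rewrite -lee_fin fineK; last by rewrite ge0_fin_numE ?rate_ge0// fin.
      by have := rate_ge (s + c *: delta_mx ord0 i) dg; rewrite dotDr dotZr dot_delta.
    have Bi : fine (rate a (s + d *: delta_mx ord0 i)) +
              fine (rate a (s + (- d) *: delta_mx ord0 i)) <= B.
      by rewrite /B (bigD1 i)//= lerDl; apply: sumr_ge0 => j _; rewrite addr_ge0.
    have := key d (ger0_norm (ltW dd0)); have := key (- d).
    rewrite normrN (ger0_norm (ltW dd0)) => /(_ erefl).
    have := rf (s + d *: delta_mx ord0 i); have := rf (s + (- d) *: delta_mx ord0 i).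
    have [gi|gi] := leP 0 (g ord0 i); first by rewrite (ger0_norm gi); lra.
    by rewrite (ltr0_norm gi); lra.
  rewrite mx_norm_le.
    by apply/forallP => i; rewrite ler_pdivlMr// mulrC.
  (* in dimension zero there is no coordinate to bound the right-hand side
     by, but [g] is zero *)
  have [n0|n0] := posnP n; last first.
    apply: le_trans (_ : d * `|g ord0 (Ordinal n0)| / d <= _).
      exact: divr_ge0 (mulr_ge0 (ltW dd0) (normr_ge0 _)) (ltW dd0).
    by rewrite ler_pM2r ?invr_gt0.
  have g0 : g = 0 by apply/rowP => i; have := ltn_ord i; rewrite {2}n0.
  by rewrite divr_ge0 ?(ltW dd0)// subr_ge0 g0 dot0l ell0 subr0.
have [|nex] := pselect (exists g0, is_max s g0); first by [].
have sfin : rate a s \is a fin_num.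
  rewrite ge0_fin_numE ?rate_ge0//; have := hd s; apply.
  by rewrite /= subrr normr0.
set c := fine (rate a s).
have ratec : rate a s = c%:E by rewrite fineK.
have valc g : dom g -> dot g s - ell g <= c.
  by move=> dg; rewrite -lee_fin -ratec; exact: rate_ge.
have c0 : 0 <= c by rewrite /c fine_ge0// rate_ge0.
have [eta eta0 heta] : exists2 eta, 0 < eta & forall g, `|g| <= (B + 1) / d ->
    ((dot g s - c + eta)%:E <= logLambda a g)%E.
  apply: (@lsc_compact_margin _ _ _ _ (fun g => dot g s - c) logLambda_lsc).
  - exact: compact_ball0.
  - exact: continuous_dotB.
  - move=> g /= _; have [dg|dg] := pselect (dom g); last by rewrite logLambday// ltry.
    rewrite logLambdaE// lte_fin lt_neqAle; apply/andP; split; last first.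
      by rewrite lerBlDl -lerBlDr; exact: valc.
    apply/eqP => gm; apply: nex; exists g; split => // g' dg'.
    by rewrite -gm opprB addrCA subrr addr0; exact: valc.
suff : c <= c - Num.min eta 1.
  have : 0 < Num.min eta 1 by rewrite lt_min eta0 ltr01.
  by move: (Num.min eta 1) => A m0 h; exfalso; lra.
rewrite -[X in X <= _]/(fine _) -lee_fin -ratec; apply: rate_le => g dg.
have [gK|gK] := leP `|g| ((B + 1) / d).
  have := heta g gK; rewrite logLambdaE// lee_fin => h.
  apply: (@le_trans _ _ (c - eta)); first by lra.
  by rewrite lerD2l lerN2 ge_min lexx.
have := val g dg; move: gK; rewrite ltr_pdivrMr// => h1 h2.
apply: (@le_trans _ _ (c - 1)); first by lra.
by rewrite lerD2l lerN2 ge_min lexx orbT.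
Qed.

(** Maximizers for [Lambda] at [r], as opposed to those for [L] at [s]; the
    two lemmas that follow translate one into the other by tilting, [r = lam
    g0 *: s]. *)
Definition is_maxL r g0 := dom g0 /\
  forall g, dom g -> dot g r - lam g <= dot g0 r - lam g0.

(** The maximality is compared along the segment from [g0] to [g], where
    convexity of [ell] bounds [lam] by an exponential; the first-order
    comparison of [expR_slope_le] gives the claim. *)
Lemma is_maxL_is_max r g0 : is_maxL r g0 -> is_max ((lam g0)^-1 *: r) g0.
Proof.
move=> [dg0 h]; split => [//|g dg].
have l0 := lam_pos dg0.
set s := _ *: r.
have rE x : dot x r = lam g0 * dot x s by rewrite /s dotZr mulrA mulfV ?mul1r// gt_eqF.
suff : dot g s - dot g0 s <= ell g - ell g0.
  by move: (dot g s) (dot g0 s) (ell g) (ell g0) => A B C D; lra.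
apply: expR_slope_le => t t0 t1.
have [dt ct] := ell_convex dg dg0 (ltW t0) t1.
have := h _ dt; rewrite !rE dotDl !dotZl => ht.
have lt : lam (t *: g + (1 - t) *: g0) <= lam g0 * expR (t * (ell g - ell g0)).
  rewrite -(expR_ell dt) -(expR_ell dg0) -expRD ler_expR.
  apply: le_trans ct _; rewrite le_eqVlt; apply/orP; left; apply/eqP; ring.
rewrite -(ler_pM2l l0); apply: le_trans lt.
move: ht; move: (lam (_ + _)) (lam g0) (dot g s) (dot g0 s) => A B C D.
lra.
Qed.

(** The tangent inequality [1 + u <= expR u] at [u = g.s - g0.s], which the
    assumption bounds by [ell g - ell g0]. *)
Lemma is_max_is_maxL s g0 : is_max s g0 -> is_maxL (lam g0 *: s) g0.
Proof.
move=> [dg0 h]; split => [//|g dg].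
have l0 := lam_pos dg0.
have := h g dg; rewrite !dotZr => hg.
have : lam g0 * (1 + (dot g s - dot g0 s)) <= lam g.
  apply: (@le_trans _ _ (lam g0 * expR (dot g s - dot g0 s))).
    by rewrite ler_pM2l//; exact: expR_ge1Dx.
  rewrite -{1}(expR_ell dg0) -expRD -(expR_ell dg) ler_expR.
  by move: hg; move: (dot g s) (dot g0 s) (ell g) (ell g0) => A B C D; lra.
by move: (dot g s) (dot g0 s) (lam g) (lam g0) => A B C D; lra.
Qed.

(** Beyond the radius [K] the quadratic growth of [Lambda] brings the value
    below [-1], the one at zero; inside it the supremum is attained for the
    same reason as in [exists_is_max]. *)
Lemma exists_is_maxL r : exists g0, is_maxL r g0.
Proof.
have [|nex] := pselect (exists g0, is_maxL r g0); first by [].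
pose K := n%:R * enorm r / sig.
have far g : dom g -> K < `|g| -> dot g r - lam g <= - 1.
  move=> dg; rewrite /K ltr_pdivrMr// => Kg.
  have := Lam_grow dg; have := le_trans (ler_norm _) (normr_dot_le_normr g r).
  rewrite mulrAC expr2 => h1 h2.
  suff : n%:R * enorm r * `|g| <= `|g| * sig * `|g|.
    by move: h1 h2; move: (dot g r) (lam g) => A B; lra.
  by rewrite ler_wpM2r// ltW.
pose S := [set dot g r - lam g | g in dom].
have S0 : S (- 1) by exists 0; [exact: dom0|rewrite dot0l lam0 sub0r].
have Sub : ubound S (n%:R * K * enorm r).
  move=> _ [g dg <-]; have := lam_ge1 dg => l1.
  have K0 : 0 <= K by rewrite divr_ge0 ?(ltW sig_gt0)// mulr_ge0// enorm_ge0.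
  have [gK|gK] := leP `|g| K; last first.
    apply: le_trans (far _ dg gK) _; apply: (@le_trans _ _ 0); first by lra.
    by rewrite mulr_ge0 ?enorm_ge0// mulr_ge0.
  have := le_trans (ler_norm _) (normr_dot_le_normr g r).
  have : n%:R * `|g| * enorm r <= n%:R * K * enorm r.
    by rewrite ler_wpM2r ?enorm_ge0// ler_wpM2l.
  by move: (dot g r) (lam g) l1 => A B; lra.
have hS : has_sup S by split; [exists (-1)|exists (n%:R * K * enorm r)].
set c := sup S.
have valc g : dom g -> dot g r - lam g <= c.
  by move=> dg; apply: sup_ubound; [case: hS|exists g].
have c1 : -1 < c.
  rewrite lt_neqAle; apply/andP; split; last by have := valc _ dom0; rewrite dot0l lam0 sub0r.
  apply/eqP => c1; apply: nex; exists 0; split; first exact: dom0.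
  by move=> g dg; rewrite dot0l lam0 sub0r c1; exact: valc.
have [eta eta0 heta] : exists2 eta, 0 < eta & forall g, `|g| <= K ->
    ((dot g r - c + eta)%:E <= Lambda a g)%E.
  apply: (@lsc_compact_margin _ _ _ _ (fun g => dot g r - c) Lam_lsc).
  - exact: compact_ball0.
  - exact: continuous_dotB.
  - move=> g /= _; have [dg|dg] := pselect (dom g); last by rewrite not_dom// ltry.
    rewrite domE// lte_fin lt_neqAle; apply/andP; split; last first.
      by rewrite lerBlDl -lerBlDr; exact: valc.
    apply/eqP => gm; apply: nex; exists g; split => // g' dg'.
    by rewrite -gm opprB addrCA subrr addr0; exact: valc.
have : c <= Num.max (-1) (c - eta).
  apply: ge_sup; first by exists (-1).
  move=> _ [g dg <-]; rewrite le_max.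
  have [gK|gK] := leP `|g| K; last by rewrite far.
  have := heta g gK; rewrite domE// lee_fin => h.
  by apply/orP; right; move: h; move: (dot g r) (lam g) => A B; lra.
by rewrite le_max => /orP[|]; lra.
Qed.

(** A maximizer provides a solution of the equation for [xi], so the chosen
    [xi a r] is a solution, and any solution stems from a maximizer; two
    maximizers give the same value. *)
Lemma Phi_max r g0 : is_maxL r g0 -> Phi a r = dot g0 r - lam g0 + 1.
Proof.
move=> max0.
suff : exists g', is_maxL r g' /\ Phi a r = dot g' r - lam g' + 1.
  move=> [g' [[dg' h'] ->]]; have [dg0 h0] := max0; congr (_ + _).
  by apply/eqP; rewrite eq_le h0// h'.
have [dg0 _] := max0.
have ex : exists x : R, xi_eq a r x.
  exists (lam g0)^-1.
  have maxs := is_maxL_is_max max0.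
  split.
  - by rewrite invr_gt0 lam_pos.
  - exact: is_max_interior maxs.
  - rewrite (is_max_grad maxs) (rate_max maxs)/= lnV ?posrE ?lam_pos//.
    by rewrite (dotC (_ *: r) g0) addrAC subrr add0r ellE.
have [xi0 xiint xieq] : xi_eq a r (xi a r) by exact: getPex ex.
have [g' max'] := exists_is_max xiint.
have [dg' _] := max'.
move: xieq; rewrite (is_max_grad max') (rate_max max')/= dotC.
rewrite addrAC subrr add0r => xieq.
have xiE : xi a r = (lam g')^-1.
  by rewrite -[LHS]lnK ?posrE// xieq expRN expR_ell.
exists g'; split.
  have := is_max_is_maxL max'; rewrite xiE scalerA mulfV ?scale1r//.
  by rewrite gt_eqF// lam_pos.
rewrite /Phi (rate_max max')/= xieq dotZr xiE invrK.
have l0 : lam g' != 0 by rewrite gt_eqF// lam_pos.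
move: (ell g') (dot g' r) => A B; by field.
Qed.

Lemma Phi_legendre r : exists g0, [/\ dom g0, Phi a r = dot g0 r - lam g0 + 1 &
  forall g, dom g -> dot g r - lam g + 1 <= Phi a r].
Proof.
have [g0 max0] := exists_is_maxL r.
exists g0; have [dg0 h] := max0; split => //; first exact: Phi_max.
by move=> g dg; rewrite (Phi_max max0) lerD2r; exact: h.
Qed.

Transparent Lambda dot enorm.

End rate_duality.

(** * Moment generating functions of even densities *)

Section cosh_bounds.
Context {R : realType}.
Implicit Types u v : R.

Lemma expR_ge1Dx2 v : 0 <= v -> 1 + v + v ^+ 2 / 2 <= expR v.
Proof.
move=> v0; rewrite /expR.
apply: (@le_trans _ _ (series (exp_coeff v) 3)).
  rewrite /series/= !big_nat_recr//= big_geq// /exp_coeff/= !fact0 add0r.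
  by rewrite expr0 expr1 divr1 divr1.
apply: nondecreasing_cvgn_le; last exact: is_cvg_series_exp_coeff.
by apply: nondecreasing_series => k _ _; rewrite /exp_coeff/= divr_ge0 ?exprn_ge0.
Qed.

Lemma sinh_ge v : 0 <= v -> 2 * v <= expR v - expR (- v).
Proof.
move=> v0; have := expR_ge1Dx2 v0; rewrite expRN.
set q := 1 + v + v ^+ 2 / 2 => qe.
have v2 : 0 <= v ^+ 2 by exact: sqr_ge0.
have q1 : 1 <= q by rewrite /q; lra.
have : (expR v)^-1 <= q^-1 by rewrite lef_pV2 ?posrE ?expR_gt0//; lra.
have : q^-1 <= q - 2 * v.
  rewrite -div1r ler_pdivrMr; last by lra.
  rewrite (_ : _ * q = 1 + v ^+ 4 / 4); last by rewrite /q; field.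
  by rewrite lerDl divr_ge0// exprn_even_ge0.
lra.
Qed.

Lemma coshB2E v : expR v + expR (- v) - 2 = (expR (v / 2) - expR (- (v / 2))) ^+ 2.
Proof.
rewrite sqrrB -!expRM_natl -expRD subrr expR0.
rewrite (_ : 2 * (v / 2) = v); last by field.
by rewrite (_ : 2 * (- (v / 2)) = - v); [ring|field].
Qed.

(** Both this bound and [cosh_le2] follow from [coshB2E] and a first-order
    bound on the hyperbolic sine. *)
Lemma cosh_ge v : 2 + v ^+ 2 <= expR v + expR (- v).
Proof.
wlog v0 : v / 0 <= v.
  move=> H; have [/H//|/ltW v0] := leP 0 v.
  by have := H (- v); rewrite opprK sqrrN oppr_ge0 addrC [X in _ -> _ <= X]addrC; apply.
have : 0 <= v / 2 by rewrite divr_ge0.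
move=> /sinh_ge; rewrite (_ : 2 * (v / 2) = v); last by field.
move=> h; have : v ^+ 2 <= (expR (v / 2) - expR (- (v / 2))) ^+ 2.
  by rewrite lerXn2r// nnegrE//; lra.
by rewrite -coshB2E; lra.
Qed.

Lemma expR_sub1_le v : expR v - 1 <= v * expR v.
Proof.
have := expR_ge1Dx (- v); rewrite expRN => h.
have : (1 - v) * expR v <= 1.
  by rewrite -[leRHS](@mulVf _ (expR v)) ?gt_eqF ?expR_gt0// ler_pM2r ?expR_gt0.
by lra.
Qed.

Lemma cosh_le2 v : expR v + expR (- v) <= 2 + v ^+ 2 * expR `|v|.
Proof.
wlog v0 : v / 0 <= v.
  move=> H; have [/H//|/ltW v0] := leP 0 v.
  by have := H (- v); rewrite opprK sqrrN normrN oppr_ge0 (addrC (expR (- v))); apply.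
rewrite ger0_norm//.
have s1 := expR_sub1_le v.
have s2 : expR (v / 2) - expR (- (v / 2)) <= v * expR (v / 2).
  rewrite -(ler_pM2r (expR_gt0 (v / 2))) mulrBl -mulrA -!expRD addNr expR0.
  by rewrite (_ : v / 2 + v / 2 = v)//; field.
have s0 : 0 <= expR (v / 2) - expR (- (v / 2)).
  by rewrite subr_ge0 ler_expR; lra.
have : (expR (v / 2) - expR (- (v / 2))) ^+ 2 <= (v * expR (v / 2)) ^+ 2.
  by rewrite lerXn2r// nnegrE//; lra.
rewrite -coshB2E exprMn -expRM_natl (_ : 2 * (v / 2) = v); last by field.
lra.
Qed.

Lemma cosh_le3 v : expR v + expR (- v) <= 2 + v ^+ 2 + `|v| ^+ 3 * expR `|v|.
Proof.
apply: le_trans (cosh_le2 v) _; rewrite -[leRHS]addrA lerD2l -real_normK ?num_real//.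
move: `|v| (normr_ge0 v) => w w0.
have := ler_wpM2l (sqr_ge0 w) (expR_sub1_le w).
rewrite (_ : w ^+ 3 = w ^+ 2 * w); last by ring.
lra.
Qed.

(** The Hellinger identity behind the strict convexity of [ell]. *)
Lemma sqr_expR_half u v :
  (expR (u / 2) - expR (v / 2)) ^+ 2 + 2 * expR ((u + v) / 2) = expR u + expR v.
Proof.
rewrite (_ : expR u = expR (u / 2) * expR (u / 2)); last by rewrite -expRD; congr expR; field.
rewrite (_ : expR v = expR (v / 2) * expR (v / 2)); last by rewrite -expRD; congr expR; field.
rewrite (_ : (u + v) / 2 = u / 2 + v / 2); last by field.
by rewrite expRD; ring.
Qed.

Lemma expR_convex_comb u v t : 0 <= t -> t <= 1 ->
  expR (t * u + (1 - t) * v) <= t * expR u + (1 - t) * expR v.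
Proof.
move=> t0 t1; set m := t * u + (1 - t) * v.
have tangent w : expR m * (1 + (w - m)) <= expR w.
  rewrite (_ : expR w = expR m * expR (w - m)); last first.
    by rewrite -expRD; congr expR; ring.
  by rewrite ler_pM2l ?expR_gt0//; exact: expR_ge1Dx.
have h1 : t * (expR m * (1 + (u - m))) <= t * expR u by rewrite ler_wpM2l.
have h2 : (1 - t) * (expR m * (1 + (v - m))) <= (1 - t) * expR v.
  by rewrite ler_wpM2l// subr_ge0.
apply: le_trans (lerD h1 h2); rewrite le_eqVlt; apply/orP; left; apply/eqP.
by rewrite /m; ring.
Qed.

End cosh_bounds.

Section weighted_integral.
Context {R : realType} {n : nat}.
Notation beta := (@borel_lebesgue R n).
Variable f : 'rV[R]_n -> R.
Implicit Types (h k : 'rV[R]_n -> R) (g x : 'rV[R]_n) (c : R).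
Hypothesis mf : measurable_fun setT f.
Hypothesis f0 : forall x, 0 <= f x.

(** The expectation of [h X] for [X] of density [f]; kept in this form, and
    not as an integral against the law of [X], because the convolution with
    [f] is an expectation of the same form. *)
Definition wint h : \bar R := (\int[beta]_x (h x * f x)%:E)%E.

Lemma wint_measurable h : measurable_fun setT h ->
  measurable_fun setT (fun x => (h x * f x)%:E).
Proof. by move=> mh; apply/measurable_EFinP; exact: measurable_funM. Qed.

Lemma wint_ge0 h : (forall x, 0 <= h x) -> (0 <= wint h)%E.
Proof. by move=> h0; apply: integral_ge0 => x _; rewrite lee_fin mulr_ge0. Qed.

Lemma eq_wint h k : h =1 k -> wint h = wint k.
Proof. by move=> hk; apply: eq_integral => x _; rewrite hk. Qed.

Lemma wint_le h k : measurable_fun setT h -> measurable_fun setT k ->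
  (forall x, 0 <= h x) -> (forall x, h x <= k x) -> (wint h <= wint k)%E.
Proof.
move=> mh mk h0 hk; apply: ge0_le_integral => //.
- by move=> x _; rewrite lee_fin mulr_ge0.
- exact: wint_measurable.
- exact: wint_measurable.
- by move=> x _; rewrite lee_fin ler_wpM2r.
Qed.

Lemma wintD h k : measurable_fun setT h -> measurable_fun setT k ->
  (forall x, 0 <= h x) -> (forall x, 0 <= k x) ->
  (wint (fun x => h x + k x)%R = wint h + wint k)%E.
Proof.
move=> mh mk h0 k0; rewrite /wint -ge0_integralD//.
- by apply: eq_integral => x _; rewrite mulrDl EFinD.
- by move=> x _; rewrite lee_fin mulr_ge0.
- exact: wint_measurable.
- by move=> x _; rewrite lee_fin mulr_ge0.
- exact: wint_measurable.
Qed.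

Lemma wintZ c h : measurable_fun setT h -> 0 <= c -> (forall x, 0 <= h x) ->
  (wint (fun x => c * h x)%R = c%:E * wint h)%E.
Proof.
move=> mh c0 h0; rewrite /wint -ge0_integralZl//.
- by apply: eq_integral => x _; rewrite -mulrA EFinM.
- exact: wint_measurable.
- by move=> x _; rewrite lee_fin mulr_ge0.
Qed.

Lemma wint_eq0 h : measurable_fun setT h -> (forall x, 0 <= h x) -> wint h = 0%E ->
  forall k, measurable_fun setT k -> (forall x, 0 <= k x) ->
  (forall x, h x = 0 -> k x = 0) -> wint k = 0%E.
Proof.
move=> mh h0 hz k mk k0 hk.
have : ae_eq beta setT (fun x => (h x * f x)%:E) (cst 0%E).
  apply/ae_eq_integral_abs => //; first exact: wint_measurable.
  rewrite -[RHS]hz; apply: eq_integral => x _.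
  by rewrite gee0_abs// lee_fin mulr_ge0.
move=> ae; rewrite /wint.
rewrite (@ae_eq_integral _ _ _ _ _ (cst 0%E)) ?integral_cst ?mul0e//.
  exact: wint_measurable.
apply: filterS ae => x /= H _.
have /eqP := H I; rewrite eqe mulf_eq0 => /orP[/eqP/hk ->|/eqP ->].
  by rewrite mul0r.
by rewrite mulr0.
Qed.

Lemma wint_le_mulr h k c : measurable_fun setT h -> measurable_fun setT k ->
  (forall x, 0 <= h x) -> (forall x, 0 <= k x) -> 0 <= c ->
  (forall x, h x <= c * k x) -> (wint k < +oo)%E -> (wint h < +oo)%E.
Proof.
move=> mh mk h0 k0 c0 hk kfin.
apply: (@le_lt_trans _ _ (c%:E * wint k)%E).
  rewrite -wintZ//; apply: wint_le => //.
  exact: measurable_funM.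
by rewrite lte_mul_pinfty// wint_ge0.
Qed.

Hypothesis fE : forall x, f (- x) = f x.

Lemma wint_sym h : measurable_fun setT h -> (forall x, 0 <= h x) ->
  wint (fun x => h (- x)) = wint h.
Proof.
move=> mh h0; rewrite /wint.
rewrite -[RHS](@integral_subl _ _ 0)//.
- by apply: eq_integral => x _; rewrite sub0r fE.
- exact: wint_measurable.
- by move=> x; rewrite lee_fin mulr_ge0.
Qed.

Hypothesis fI : (\int[beta]_x (f x)%:E = 1)%E.

Lemma wint_cst c : 0 <= c -> wint (fun=> c) = c%:E.
Proof.
move=> c0; rewrite (_ : wint _ = wint (fun x => c * 1)); last by apply: eq_wint => x; rewrite mulr1.
rewrite wintZ// /wint; under eq_integral do rewrite mul1r.
by rewrite fI mule1.
Qed.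

Definition mgf g : \bar R := wint (fun x => expR (dot g x)).

Lemma mgfN g : mgf (- g) = mgf g.
Proof.
rewrite /mgf -[RHS](wint_sym (measurable_expR_dot g) (fun x => expR_ge0 _)).
by apply: eq_wint => x; rewrite dotNl dotNr.
Qed.

Lemma mgf_ge0 g : (0 <= mgf g)%E.
Proof. by apply: wint_ge0 => x; exact: expR_ge0. Qed.

Lemma mgf0 : mgf 0 = 1%E.
Proof.
rewrite -[RHS](wint_cst ler01); apply: eq_wint => x.
by rewrite dot0l expR0.
Qed.

(** The covariance form, as an extended real since the second moment may be
    infinite. *)
Definition quad g : \bar R := wint (fun x => dot g x ^+ 2).

Lemma measurable_dot2 g : measurable_fun setT (fun x => dot g x ^+ 2).
Proof. by apply: measurable_funX; exact: measurable_dotl. Qed.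

Lemma mgf_double g : wint (fun x => expR (dot g x) + expR (- dot g x)) = (2%:E * mgf g)%E.
Proof.
rewrite wintD//.
- rewrite (_ : wint (fun x => expR (- dot g x)) = mgf g).
    by rewrite (_ : 2%:E = 1 + 1 :> \bar R)%E// ge0_muleDl// mul1e.
  by rewrite -[RHS]mgfN; apply: eq_wint => x; rewrite dotNl.
- exact: measurable_expR_dot.
- exact: measurable_expN.
Qed.

(** By evenness, [2 mgf g] is the expectation of [2 cosh (g.X)]. *)
Lemma mgf_lower g : (2%:E + quad g <= 2%:E * mgf g)%E.
Proof.
rewrite -mgf_double -(wint_cst (ler0n _ 2)) /quad -wintD//; last 2 first.
- exact: measurable_dot2.
- by move=> x; exact: sqr_ge0.
apply: wint_le => [|||x].
- by apply: measurable_funD => //; exact: measurable_dot2.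
- apply: measurable_funD; first exact: measurable_expR_dot.
  exact: measurable_expN.
- by move=> x; rewrite addr_ge0// sqr_ge0.
- exact: cosh_ge.
Qed.

Lemma mgf_ge1 g : (1 <= mgf g)%E.
Proof.
have q0 : (0 <= quad g)%E by apply: wint_ge0 => x; exact: sqr_ge0.
have := mgf_lower g; have := mgf_ge0 g.
case: (mgf g) => [m| |]; [|by move=> *; rewrite leey|by []].
case: (quad g) q0 => [q| |]//.
rewrite -EFinM -EFinD !lee_fin => q0 m0 h; lra.
Qed.

(** A bounded piece of the hyperplane is disjoint from its small translates
    along [g], so it lies in its symmetric difference with them, whose
    measure tends to zero. *)
Lemma hyperplane_null g : g != 0 -> beta [set x | dot g x = 0] = 0%E.
Proof.
move=> g0; set H := [set x | _].
have mH : measurable H.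
  have := @measurable_dotl R n g measurableT [set 0] (measurable_set1 _).
  by rewrite setTI.
have HK (K : R) : beta (H `&` cball 0 K) = 0%E.
  have mA : measurable (H `&` cball 0 K).
    by apply: measurableI => //; exact: measurable_cball.
  have [_ /(_ K) tc] := measurable_translation_continuous mA.
  apply/eqP; rewrite eq_le measure_ge0 andbT.
  apply/lee_addgt0Pr => e e0; rewrite add0e.
  have [del d0 hd] := tc e e0.
  have gn0 : 0 < `|g| by rewrite normr_gt0.
  pose t := del / `|g|.
  have t0 : 0 < t by rewrite divr_gt0.
  apply: le_trans (hd (t *: g) _); last first.
    by rewrite normrZ gtr0_norm// divfK ?gt_eqF.
  apply: le_measure; rewrite ?inE//.
    by apply: measurableI; [exact: measurable_cball|exact: measurable_symdiff_translate].
  move=> y [Hy yK]; split => //; left; split => // -[Hty _].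
  move: Hty; rewrite /H/= dotBr (Hy : _ = 0) dotZr sub0r => /eqP.
  by rewrite oppr_eq0 mulf_eq0 (gt_eqF t0)/= -sqr_enorm sqrf_eq0 enorm_eq0 (negbTE g0).
have -> : H = \bigcup_k (H `&` cball 0 k%:R).
  apply/seteqP; split => y; last by move=> [k _ []].
  move=> Hy; exists (Num.truncn `|y|).+1 => //; split => //.
  by rewrite /cball/= sub0r normrN ltW// truncnS_gt.
apply: measure_negligible.
  by apply: bigcupT_measurable => k; apply: measurableI => //; exact: measurable_cball.
apply: negligible_bigcup => k; apply/negligibleP; last exact: HK.
by apply: measurableI => //; exact: measurable_cball.
Qed.

(** Otherwise [f] would be carried by a hyperplane, which is null. *)
Lemma quad_gt0 g : g != 0 -> (0 < quad g)%E.
Proof.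
move=> g0; rewrite lt0e wint_ge0 ?andbT; last by move=> x; exact: sqr_ge0.
apply/eqP => q0.
have mI : measurable [set x : 'rV[R]_n | dot g x = 0].
  have := @measurable_dotl R n g measurableT [set 0] (measurable_set1 _).
  by rewrite setTI.
have h1 : wint (\1_(~` [set x | dot g x = 0])) = 0%E.
  apply: (wint_eq0 _ _ q0).
  - exact: measurable_dot2.
  - by move=> x; exact: sqr_ge0.
  - by apply: measurable_indic; exact: measurableC.
  - by [].
  - by move=> x /eqP; rewrite sqrf_eq0 => /eqP gx; rewrite indicE memNset//= => /(_ gx).
have h2 : wint (\1_[set x | dot g x = 0]) = 0%E.
  rewrite /wint (@ae_eq_integral _ _ _ _ _ (cst 0%E)) ?integral_cst ?mul0e//.
    by apply: wint_measurable; exact: measurable_indic.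
  exists [set x | dot g x = 0]; split => //; first exact: hyperplane_null.
  move=> x /= hx; apply: contrapT => gx; apply: hx => _.
  by rewrite indicE memNset// mul0r.
have : wint (fun=> 1) = 1%E by exact: wint_cst.
rewrite (_ : wint _ = wint (fun x => \1_[set x | dot g x = 0] x + \1_(~` [set x | dot g x = 0]) x)); last first.
  apply: eq_wint => x; rewrite !indicE in_setC.
  by case: (x \in _); rewrite /= ?addr0 ?add0r.
rewrite wintD// ?h1 ?h2 ?adde0.
  by move=> /eqP; rewrite eqe eq_sym oner_eq0.
by apply: measurable_indic; exact: measurableC.
Qed.

End weighted_integral.

Lemma convex_comb_sub (R : realType) (t u w l l' : R) :
  t * u + (1 - t) * w - (t * l + (1 - t) * l') = t * (u - l) + (1 - t) * (w - l').
Proof. ring. Qed.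

Lemma midpoint_sub (R : realType) (u w l l' : R) :
  2^-1 * u + (1 - 2^-1) * w - (2^-1 * l + (1 - 2^-1) * l') = ((u - l) + (w - l')) / 2.
Proof. by field. Qed.

Lemma halves_sub_eq0 (R : realType) (u w l l' : R) :
  (u - l) / 2 = (w - l') / 2 -> u - w - (l - l') = 0.
Proof. lra. Qed.

Section mgf_theory.
Context {R : realType} {n : nat}.
Notation beta := (@borel_lebesgue R n).
Variable f : 'rV[R]_n -> R.
Implicit Types (h k : 'rV[R]_n -> R) (g x : 'rV[R]_n) (c : R).
Hypothesis mf : measurable_fun setT f.
Hypothesis f0 : forall x, 0 <= f x.
Hypothesis fE : forall x, f (- x) = f x.
Hypothesis fI : (\int[beta]_x (f x)%:E = 1)%E.

Lemma measurable_trunc h (r : R) : measurable_fun setT h ->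
  measurable_fun setT (fun x => \1_(cball 0 r) x * h x).
Proof.
move=> mh; apply: measurable_funM => //; apply: measurable_indic.
exact: measurable_cball.
Qed.

Lemma wint_trunc h (y : R) : measurable_fun setT h -> (forall x, 0 <= h x) ->
  (y%:E < wint f h)%E ->
  exists k : nat, (y%:E < wint f (fun x => (\1_(cball 0 k%:R) x * h x)%R))%E.
Proof.
move=> mh h0 yh; apply: contrapT => /forallNP H.
pose u (k : nat) x := (\1_(cball 0 k%:R) x * h x * f x)%:E.
have mu_ (k : nat) : measurable_fun setT (u k).
  exact: (wint_measurable mf (measurable_trunc _ mh)).
have u0 (k : nat) x : setT x -> (0 <= u k x)%E by move=> _; rewrite lee_fin !mulr_ge0.
have nd x : setT x -> {homo u ^~ x : i j / (i <= j)%N >-> (i <= j)%E}.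
  move=> _ i j ij; rewrite lee_fin ler_wpM2r// ler_wpM2r// !indicE ler_nat.
  case: (boolP (x \in cball 0 i%:R)) => //; rewrite inE => xi.
  by rewrite mem_set//; apply: cballS xi; rewrite ler_nat.
have := @cvg_monotone_convergence _ _ _ beta setT measurableT u mu_ u0 nd.
have -> : (\int[beta]_x limn (u ^~ x) = wint f h)%E.
  apply: eq_integral => x _; apply/cvg_lim => //.
  apply: (@cvg_near_cst).
  exists (Num.truncn `|x|).+1 => // k /= xk.
  rewrite /u indicE mem_set ?mul1r//= /cball/= sub0r normrN.
  by apply: le_trans (ltW (truncnS_gt _)) _; rewrite ler_nat.
move=> cv.
have : (wint f h <= y%:E)%E.
  have /cvg_lim <- := cv => //.
  apply: lime_le; first by apply/cvg_ex; exists (wint f h).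
  by apply: nearW => k; rewrite leNgt; apply/negP; exact: H.
by rewrite leNgt yh.
Qed.

(** Truncation to a ball gives a functional that is continuous in [g]
    because [F] is Lipschitz there, and by monotone convergence the integral
    is the supremum of its truncations. *)
Lemma wint_lsc (F : 'rV[R]_n -> 'rV[R]_n -> R) :
  (forall g, measurable_fun setT (F g)) -> (forall g x, 0 <= F g x) ->
  (forall g (r : R), exists2 M, 0 <= M & forall g' x, `|x| <= r ->
    F g x <= F g' x + M * `|g - g'|) ->
  lsc (fun g => wint f (F g)).
Proof.
move=> mF F0 FL g y yg.
have [k yk] := wint_trunc (mF g) (F0 g) yg.
have [z /andP[yz zk]] : exists z : R, (y < z) && (z%:E <= wint f (fun x => (\1_(cball 0 k%:R) x * F g x)%R))%E.
  move: yk; case: (wint _ _) => [w| |//]; rewrite ?lte_fin => h.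
    by exists w; rewrite h lexx.
  by exists (y + 1); rewrite leey andbT ltrDl.
have [M M0 HM] := FL g k%:R.
have M1 : 0 < M + 1 by rewrite ltr_wpDl.
apply/nbhs_ballP; exists ((z - y) / (M + 1)); first by rewrite /= divr_gt0// subr_gt0.
move=> g'; rewrite -ball_normE/= ltr_pdivlMr// => gg'.
have c0 : 0 <= M * `|g - g'| by rewrite mulr_ge0.
have : (z%:E <= wint f (F g') + (M * `|g - g'|)%:E)%E.
  apply: (le_trans zk); rewrite -(wint_cst mf f0 fI c0) -wintD//.
  apply: wint_le => //.
  - exact: measurable_trunc.
  - exact: measurable_funD.
  - by move=> x; rewrite mulr_ge0.
  - move=> x; rewrite indicE; case: (boolP (x \in _)) => [|_]; last by rewrite mul0r addr_ge0.
    by rewrite inE /cball/= sub0r normrN mul1r; exact: HM.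
apply: contraTT; rewrite -!leNgt => h.
rewrite -ltNge; apply: le_lt_trans (leeD2r _ h) _.
rewrite -EFinD lte_fin.
have : M * `|g - g'| <= `|g - g'| * (M + 1).
  by rewrite mulrC ler_wpM2l// lerDl.
lra.
Qed.

Lemma mgf_lsc : lsc (mgf f).
Proof.
apply: wint_lsc => [g|g x|g r].
- exact: measurable_expR_dot.
- exact: expR_ge0.
- exists (expR (enorm g * (n%:R * `|r|)) * (n%:R * (n%:R * `|r|))).
    by rewrite !mulr_ge0 ?expR_ge0.
  move=> g' x xr.
  have ex : enorm x <= n%:R * `|r|.
    apply: le_trans (enorm_le_normr x) _; rewrite ler_wpM2l//.
    by apply: le_trans xr _; exact: ler_norm.
  have h1 : expR (dot g x) * (1 - (dot g x - dot g' x)) <= expR (dot g' x).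
    rewrite (_ : dot g' x = dot g x + - (dot g x - dot g' x)); last by ring.
    rewrite expRD ler_pM2l ?expR_gt0// (_ : dot g x - _ = dot g x - dot g' x); last by ring.
    exact: expR_ge1Dx.
  have h2 : dot g x - dot g' x <= n%:R * `|g - g'| * (n%:R * `|r|).
    rewrite -dotBl; apply: le_trans (ler_norm _) _.
    apply: le_trans (normr_dot_le_normr _ _) _.
    by rewrite ler_wpM2l// mulr_ge0.
  have h3 : expR (dot g x) <= expR (enorm g * (n%:R * `|r|)).
    rewrite ler_expR; apply: le_trans (dot_le_enorm _ _) _.
    by rewrite ler_wpM2l// enorm_ge0.
  have h4 : expR (dot g x) * (dot g x - dot g' x) <=
     expR (enorm g * (n%:R * `|r|)) * (n%:R * `|g - g'| * (n%:R * `|r|)).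
    have [s|/ltW s] := leP 0 (dot g x - dot g' x).
      by rewrite ler_pM// expR_ge0.
    apply: le_trans (_ : 0 <= _); first by rewrite mulr_ge0_le0 ?expR_ge0.
    by rewrite !mulr_ge0 ?expR_ge0.
  rewrite (_ : _ * `|g - g'| = expR (enorm g * (n%:R * `|r|)) * (n%:R * `|g - g'| * (n%:R * `|r|))); last by ring.
  move: h1 h4; rewrite mulrBr mulr1.
  move: (expR (dot g x)) (expR (dot g' x)) (_ * (dot g x - dot g' x)) => A B C.
  by move: (_ * _) => D; lra.
Qed.

Lemma quad_lsc : lsc (quad f).
Proof.
apply: wint_lsc => [g|g x|g r].
- exact: measurable_dot2.
- exact: sqr_ge0.
- exists (2 * (enorm g * (n%:R * `|r|)) * (n%:R * (n%:R * `|r|))).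
    by rewrite !mulr_ge0 ?enorm_ge0.
  move=> g' x xr.
  have ex : enorm x <= n%:R * `|r|.
    apply: le_trans (enorm_le_normr x) _; rewrite ler_wpM2l//.
    by apply: le_trans xr _; exact: ler_norm.
  have h2 : `|dot g x - dot g' x| <= n%:R * `|g - g'| * (n%:R * `|r|).
    rewrite -dotBl; apply: le_trans (normr_dot_le_normr _ _) _.
    by rewrite ler_wpM2l// mulr_ge0.
  have h3 : `|dot g x| <= enorm g * (n%:R * `|r|).
    apply: le_trans (normr_dot_le _ _) _.
    by rewrite ler_wpM2l// enorm_ge0.
  have h4 : dot g x * (dot g x - dot g' x) <= enorm g * (n%:R * `|r|) * (n%:R * `|g - g'| * (n%:R * `|r|)).
    by apply: le_trans (ler_norm _) _; rewrite normrM ler_pM.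
  rewrite (_ : _ * `|g - g'| = 2 * (enorm g * (n%:R * `|r|) * (n%:R * `|g - g'| * (n%:R * `|r|)))); last by ring.
  have := sqr_ge0 (dot g x - dot g' x).
  move: h4; rewrite sqrrB mulrBr.
  move: (enorm g * _ * _) => D; move: (dot g x) (dot g' x) => A B h h'.
  by nra.
Qed.

(** [lam] and [ell] are meaningful on [dom] only: outside it [mgf] is
    infinite and [lam] takes the default value zero of [fine]. *)
Definition dom g := (mgf f g < +oo)%E.
Definition lam g : R := fine (mgf f g).
Definition ell g : R := ln (lam g).

Lemma domE g : dom g -> mgf f g = (lam g)%:E.
Proof. by move=> dg; rewrite fineK// ge0_fin_numE// mgf_ge0. Qed.

Lemma not_dom g : ~ dom g -> mgf f g = +oo%E.
Proof. by rewrite /dom => /negP; rewrite -leNgt leye_eq => /eqP. Qed.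

Lemma lam_ge1 g : dom g -> 1 <= lam g.
Proof. by move=> dg; rewrite -lee_fin -domE// mgf_ge1. Qed.

Lemma lam_gt0 g : dom g -> 0 < lam g.
Proof. by move=> /lam_ge1; apply: lt_le_trans. Qed.

Lemma expR_ell g : dom g -> expR (ell g) = lam g.
Proof. by move=> dg; rewrite lnK// posrE lam_gt0. Qed.

Lemma dom0 : dom 0. Proof. by rewrite /dom mgf0// ltry. Qed.

Lemma lam0 : lam 0 = 1. Proof. by rewrite /lam mgf0. Qed.

Lemma dom_le g (m : R) : (mgf f g <= m%:E)%E -> dom g /\ lam g <= m.
Proof.
move=> h; have dg : dom g by exact: le_lt_trans h (ltry _).
by split => //; rewrite -lee_fin -domE.
Qed.

Opaque lam ell wint.

Lemma measurable_tilt g c : measurable_fun setT (fun x => expR (dot g x - c)).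
Proof.
apply: measurableT_comp => //; apply: measurable_funB => //.
exact: measurable_dotl.
Qed.

Lemma wint_expRB g c : wint f (fun x => expR (dot g x - c)) = ((expR (- c))%:E * mgf f g)%E.
Proof.
rewrite -wintZ ?expR_ge0//; last exact: measurable_expR_dot.
by apply: eq_wint => x; rewrite addrC expRD.
Qed.

Lemma wint_tilt g : dom g -> wint f (fun x => expR (dot g x - ell g)) = 1%E.
Proof.
move=> dg; rewrite wint_expRB domE// -EFinM expRN expR_ell// mulVf//.
by rewrite gt_eqF// lam_gt0.
Qed.

(** Both tilted functions [expR (dot g x - ell g)] integrate to one against
    [f], and the exponential of a convex combination is at most the convex
    combination of exponentials; this is the Hoelder inequality for the two
    tilted densities. *)
Lemma ell_convex g g' t : dom g -> dom g' -> 0 <= t -> t <= 1 ->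
  dom (t *: g + (1 - t) *: g') /\
  ell (t *: g + (1 - t) *: g') <= t * ell g + (1 - t) * ell g'.
Proof.
move=> dg dg' t0 t1; have t1' : 0 <= 1 - t by rewrite subr_ge0.
set m := t * ell g + (1 - t) * ell g'; set gm := t *: g + (1 - t) *: g'.
have : (mgf f gm <= (expR m)%:E)%E.
  have -> : mgf f gm = ((expR m)%:E * wint f (fun x => expR (dot gm x - m)))%E.
    by rewrite wint_expRB muleA -EFinM expRN mulfV ?mul1e// gt_eqF// expR_gt0.
  rewrite -[X in (_ <= X)%E]mule1 lee_pmul2l ?lte_fin ?expR_gt0//.
  apply: (@le_trans _ _ (wint f (fun x => t * expR (dot g x - ell g) + (1 - t) * expR (dot g' x - ell g')))).
    apply: wint_le => //.
    - exact: measurable_tilt.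
    - by apply: measurable_funD; apply: measurable_funM => //; exact: measurable_tilt.
    - move=> x; apply: le_trans (expR_convex_comb _ _ t0 t1).
      by rewrite ler_expR /gm /m dotDl !dotZl convex_comb_sub.
  rewrite wintD//.
  - have e1 (c : R) g1 : 0 <= c -> dom g1 -> wint f (fun x => (c * expR (dot g1 x - ell g1))%R) = c%:E.
      move=> c0 dg1; rewrite wintZ ?wint_tilt ?mule1//; exact: measurable_tilt.
    have E1 := e1 t g t0 dg; have E2 := e1 (1 - t) g' t1' dg'.
    apply: (@le_trans _ _ (t%:E + (1 - t)%:E)%E).
      by apply: leeD; [rewrite E1|rewrite E2].
    by rewrite -EFinD lee_fin addrC subrK.
  - by apply: measurable_funM => //; exact: measurable_tilt.
  - by apply: measurable_funM => //; exact: measurable_tilt.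
  - by move=> x; rewrite mulr_ge0// expR_ge0.
  - by move=> x; rewrite mulr_ge0// expR_ge0.
move=> /dom_le[dm lm]; split => //.
by rewrite -ler_expR expR_ell.
Qed.

(** Equality at the midpoint makes the Hellinger distance of the two tilted
    densities zero, so [(g - g').X] is almost surely a constant [c]. By
    evenness it is also the constant [- c], so that the second moment of [(g
    - g').X] vanishes and [quad_gt0] applies. *)
Lemma ell_strict g g' : dom g -> dom g' ->
  2^-1 * ell g + (1 - 2^-1) * ell g' <= ell (2^-1 *: g + (1 - 2^-1) *: g') -> g = g'.
Proof.
move=> dg dg'; set gm := _ *: g + _; set m := _ + _ => hm.
have [dm _] : dom gm /\ ell gm <= m by apply: ell_convex => //; lra.
pose A x := dot g x - ell g; pose B x := dot g' x - ell g'.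
have mA (s : R) g1 c1 : measurable_fun setT (fun x => expR (s * (dot g1 x - c1))).
  apply: measurableT_comp => //; apply: measurable_funM => //; apply: measurable_funB => //.
  exact: measurable_dotl.
pose D x := (expR (A x / 2) - expR (B x / 2)) ^+ 2.
have mD : measurable_fun setT D.
  apply: measurable_funX; apply: measurable_funB.
    by have := mA 2^-1 g (ell g); apply: eq_measurable_fun => x _; rewrite mulrC.
  by have := mA 2^-1 g' (ell g'); apply: eq_measurable_fun => x _; rewrite mulrC.
have D0 : wint f D = 0%E.
  have key : (wint f D + (2 * expR (ell gm - m))%:E = 2%:E)%E.
    have -> : (2 * expR (ell gm - m))%:E = wint f (fun x => (2 * expR (dot gm x - m))%R).
      rewrite wintZ//; [|exact: measurable_tilt].
      by rewrite wint_expRB domE// -!EFinM -expR_ell// -expRD (addrC (ell _)).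
    rewrite -wintD//; last 2 first.
    - by apply: measurable_funM => //; exact: measurable_tilt.
    - by move=> x; exact: sqr_ge0.
    rewrite (_ : wint _ _ = wint f (fun x => expR (dot g x - ell g) + expR (dot g' x - ell g'))); last first.
      apply: eq_wint => x; have -> : dot gm x - m = (A x + B x) / 2.
        by rewrite /A /B /gm /m dotDl !dotZl midpoint_sub.
      exact: sqr_expR_half.
    have e1 := wint_tilt dg; have e2 := wint_tilt dg'.
    rewrite wintD.
    - by rewrite (f_equal2 (fun u v : \bar R => (u + v)%E) e1 e2) -EFinD.
    - exact: mf.
    - exact: f0.
    - exact: measurable_tilt.
    - exact: measurable_tilt.
    - by move=> x; exact: expR_ge0.
    - by move=> x; exact: expR_ge0.
  have D00 : (0 <= wint f D)%E by apply: wint_ge0 => // x; exact: sqr_ge0.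
  have e1 : 1 <= expR (ell gm - m) by rewrite -expR0 ler_expR subr_ge0.
  move: key D00; case: (wint f D) => [w| |]// [] key; rewrite lee_fin => w0.
  by congr EFin; apply/eqP; rewrite eq_le w0 andbT; lra.
pose c := ell g - ell g'; pose w := g - g'.
have h1 : wint f (fun x => (dot w x - c) ^+ 2) = 0%E.
  apply: (wint_eq0 mf f0 mD _ D0) => //.
  - by move=> x; exact: sqr_ge0.
  - by apply: measurable_funX; apply: measurable_funB => //; exact: measurable_dotl.
  - by move=> x; exact: sqr_ge0.
  - move=> x /eqP; rewrite /D sqrf_eq0 subr_eq0 => /eqP/expR_inj AB.
    by apply/eqP; rewrite sqrf_eq0 /w /c dotBl; apply/eqP; exact: halves_sub_eq0 AB.
have mw (s : R) : measurable_fun setT (fun x => (dot w x - s) ^+ 2).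
  by apply: measurable_funX; apply: measurable_funB => //; exact: measurable_dotl.
have h2 : wint f (fun x => (dot w x - (- c)) ^+ 2) = 0%E.
  rewrite -h1 -[RHS]wint_sym//; last by move=> x; exact: sqr_ge0.
  by apply: eq_wint => x; rewrite dotNr -[in LHS]sqrrN opprB addrC; congr (_ ^+ 2); ring.
have q0 : quad f w = 0%E.
  have hs : wint f (fun x => ((dot w x - c) ^+ 2 + (dot w x - (- c)) ^+ 2)%R) = 0%E.
    rewrite wintD//; try by move=> x; exact: sqr_ge0.
    by rewrite (f_equal2 (fun u v : \bar R => (u + v)%E) h1 h2) adde0.
  apply/eqP; rewrite eq_le wint_ge0// ?andbT; last by move=> x; exact: sqr_ge0.
  rewrite -hs; apply: wint_le => //.
  - exact: measurable_dot2.
  - exact: measurable_funD.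
  - by move=> x; exact: sqr_ge0.
  - have aux (d e : R) : d ^+ 2 <= (d - e) ^+ 2 + (d - - e) ^+ 2.
      have -> : (d - e) ^+ 2 + (d - - e) ^+ 2 = d ^+ 2 + (d ^+ 2 + 2 * e ^+ 2) by ring.
      by rewrite lerDl addr_ge0 ?sqr_ge0 // mulr_ge0 ?sqr_ge0.
    by move=> x; exact: aux.
apply/eqP; rewrite -subr_eq0; apply/negPn/negP => w0.
by have := quad_gt0 mf f0 fI w0; rewrite -/w q0 ltxx.
Qed.

(** Homogeneity reduces to the unit sphere, where the lower semicontinuous
    form is positive. *)
Lemma quad_coercive : exists2 sig, 0 < sig & forall g,
  ((sig * `|g| ^+ 2)%:E <= quad f g)%E.
Proof.
have [|sig s0 hs] := @lsc_compact_margin _ _ (quad f) [set g : 'rV[R]_n | `|g - 0| = 1] (fun=> 0)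
  quad_lsc (@compact_sphere _ _ _ _) (@cst_continuous _ _ _).
  move=> g /= g1; apply: quad_gt0 => //.
  by apply/eqP => g0; move: g1; rewrite g0 subr0 normr0 => /esym/eqP; rewrite oner_eq0.
exists sig => // g; have [->|g0] := eqVneq g 0.
  by rewrite normr0 expr0n mulr0 wint_ge0// => x; exact: sqr_ge0.
have gn : 0 < `|g| by rewrite normr_gt0.
have := hs (`|g|^-1 *: g); rewrite /= subr0 normrZ normfV normr_id mulVf ?gt_eqF// => /(_ erefl).
rewrite add0r => h.
rewrite (_ : quad f g = (`|g| ^+ 2)%:E * quad f (`|g|^-1 *: g))%E.
  by rewrite mulrC EFinM lee_pmul2l// lte_fin exprn_gt0.
rewrite -wintZ//.
- by apply: eq_wint => x; rewrite dotZl exprMn mulrA -exprMn mulfV ?expr1n ?mul1r ?gt_eqF.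
- exact: measurable_dot2.
- by move=> x; exact: sqr_ge0.
Qed.

Lemma lam_grow : exists2 sig, 0 < sig & forall g, dom g -> 1 + sig * `|g| ^+ 2 <= lam g.
Proof.
have [sig s0 hs] := quad_coercive; exists (sig / 2); first by rewrite divr_gt0.
move=> g dg; have := mgf_lower mf f0 fE fI g; rewrite domE//.
move=> /(le_trans (leeD2l _ (hs g))); rewrite -EFinD -EFinM lee_fin; lra.
Qed.

Transparent lam ell wint.

End mgf_theory.

(** * Exponentially decaying densities and steepness *)

Section tail_bounds.
Context {R : realType}.

Lemma poly_exp_bound (k : nat) (c : R) : 0 < c ->
  exists2 K, 0 <= K & forall u, 0 <= u -> u ^+ k <= K * expR (c * u).
Proof.
move=> c0; exists (k`!%:R / c ^+ k).
  by rewrite divr_ge0// exprn_ge0// ltW.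
move=> u u0; case: k => [|k].
  by rewrite !expr0 fact0 divr1 mul1r -expR0 ler_expR mulr_ge0// ltW.
have cu0 : 0 <= c * u by rewrite mulr_ge0// ltW.
have := expR_ge1Dxn k cu0 => h.
have f0 : 0 < k.+1`!%:R :> R by rewrite ltr0n fact_gt0.
have ck : 0 < c ^+ k.+1 by rewrite exprn_gt0.
rewrite mulrAC ler_pdivlMr// -exprMn (mulrC u).
have : (c * u) ^+ k.+1 / k.+1`!%:R <= expR (c * u) by lra.
by rewrite ler_pdivrMr// [in leRHS]mulrC.
Qed.

(** For [p = 1] the exponents are compared directly. For [p > 1] the power
    dominates [(G + 1) u] as soon as [u `^ (p - 1)] exceeds [(G + 1) / b];
    below this threshold the constant does. *)
Lemma decay_tilt (p b C1 G : R) : 1 <= p -> 0 < b -> 0 <= C1 -> 0 <= G ->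
  (1 < p \/ G < b) -> exists C c, [/\ 0 <= C, 0 < c &
  forall u, 0 <= u -> C1 * expR (- (b * u `^ p)) * expR (G * u) <= C * expR (- (c * u))].
Proof.
move=> p1 b0 C10 G0 pG.
have [pE|pN] := eqVneq p 1.
  case: pG => [|Gb]; first by rewrite pE ltxx.
  exists C1, (b - G); split => //; first by rewrite subr_gt0.
  move=> u u0; rewrite pE powRr1// -mulrA -expRD ler_wpM2l// ler_expR.
  by rewrite le_eqVlt; apply/orP; left; apply/eqP; ring.
have p1' : 1 < p by rewrite lt_neqAle eq_sym pN.
pose u0 := ((G + 1) / b) `^ (p - 1)^-1.
have p10 : 0 < p - 1 by rewrite subr_gt0.
have Gb0 : 0 <= (G + 1) / b by rewrite divr_ge0 ?(ltW b0)// addr_ge0.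
exists (C1 * expR ((G + 1) * u0)), 1; split => //.
  by rewrite mulr_ge0// expR_ge0.
move=> u un; rewrite -!mulrA -!expRD ler_wpM2l// ler_expR.
have [uu0|/ltW uu0] := leP u0 u; last first.
  have : 0 <= b * u `^ p by rewrite mulr_ge0 ?(ltW b0)// powR_ge0.
  have : (G + 1) * u <= (G + 1) * u0 by rewrite ler_wpM2l// addr_ge0.
  lra.
have [->|une] := eqVneq u 0.
  rewrite powR0 ?gt_eqF//; last by lra.
  by rewrite !mulr0 oppr0 !addr0 mulr_ge0// ?addr_ge0// powR_ge0.
have up : 0 < u by rewrite lt_neqAle eq_sym une.
have key : (G + 1) * u <= b * u `^ p.
  rewrite (_ : u `^ p = u `^ (p - 1) * u); last first.
    rewrite -{3}(powRr1 un) -powRD ?subrK//.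
    by rewrite une implybT.
  rewrite mulrA ler_wpM2r// mulrC -ler_pdivrMr//.
  apply: (@le_trans _ _ (u0 `^ (p - 1))).
    by rewrite /u0 -powRrM mulVf ?gt_eqF// powRr1.
  by rewrite ge0_ler_powR ?nnegrE ?powR_ge0// ltW.
have : 0 <= (G + 1) * u0 by rewrite mulr_ge0 ?powR_ge0// addr_ge0.
lra.
Qed.

(** The three lemmas from here on control the derivative [v expR (t v)] of
    [expR (t v)] in [t]: it is bounded below, at most the slope of the chord
    from [t] to one, and for bounded [v] Lipschitz in [t]. *)
Lemma mul_expR_ge v (t : R) : 2^-1 <= t -> - 2 <= v * expR (t * v).
Proof.
move=> t2; have t0 : 0 < t by lra.
have [v0|v0] := leP 0 v.
  by apply: le_trans (_ : 0 <= _); [lra|rewrite mulr_ge0// expR_ge0].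
have h : - (t * v) <= expR (- (t * v)) by have := expR_ge1Dx (- (t * v)); lra.
have : - (t * v) * expR (t * v) <= 1.
  rewrite -[X in _ <= X](expR0 R) -(addNr (t * v)) expRD ler_wpM2r ?expR_ge0//.
have := expR_ge0 (t * v); move: (expR _) => E E0 h1.
have : (- v) * E <= 2 * (t * ((- v) * E)).
  by rewrite mulrA ler_peMl ?mulr_ge0//; lra.
lra.
Qed.

Lemma mul_expR_diff v (t : R) : 0 <= t -> t <= 1 ->
  (1 - t) * (v * expR (t * v)) <= expR v - expR (t * v).
Proof.
move=> t0 t1; rewrite lerBrDr.
rewrite (_ : _ + _ = expR (t * v) * (1 + (1 - t) * v)); last by ring.
rewrite [in leRHS](_ : v = t * v + (1 - t) * v); last by ring.
by rewrite expRD ler_pM2l ?expR_gt0// expR_ge1Dx.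
Qed.

Lemma mul_expR_near v (t : R) : 0 <= t -> t <= 1 ->
  v * expR v <= v * expR (t * v) + (1 - t) * (v ^+ 2 * expR `|v|).
Proof.
move=> t0 t1; have t1' : 0 <= 1 - t by rewrite subr_ge0.
have [v0|v0] := leP 0 v.
  have h : expR v * (1 + - ((1 - t) * v)) <= expR (t * v).
    rewrite (_ : t * v = v + - ((1 - t) * v)); last by ring.
    by rewrite expRD ler_pM2l ?expR_gt0// expR_ge1Dx.
  have := ler_wpM2l v0 h; rewrite ger0_norm//.
  rewrite (_ : v * (expR v * _) = v * expR v - (1 - t) * (v ^+ 2 * expR v)); last by ring.
  lra.
have h : expR (t * v) * (1 + (1 - t) * v) <= expR v.
  rewrite [in leRHS](_ : v = t * v + (1 - t) * v); last by ring.
  by rewrite expRD ler_pM2l ?expR_gt0// expR_ge1Dx.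
have nv0 : 0 <= - v by lra.
have := ler_wpM2l nv0 h.
rewrite (_ : - v * (expR (t * v) * _) = - (v * expR (t * v)) - (1 - t) * (v ^+ 2 * expR (t * v))); last by ring.
have : (1 - t) * (v ^+ 2 * expR (t * v)) <= (1 - t) * (v ^+ 2 * expR `|v|).
  rewrite ler_wpM2l// ler_wpM2l ?sqr_ge0// ler_expR.
  by rewrite ltr0_norm//; nra.
lra.
Qed.

End tail_bounds.

Section decaying_density.
Context {R : realType} {n : nat}.
Notation beta := (@borel_lebesgue R n).
Variable f : 'rV[R]_n -> R.
Implicit Types (h : 'rV[R]_n -> R) (g r x w : 'rV[R]_n) (c : R).
Hypothesis mf : measurable_fun setT f.
Hypothesis f0 : forall x, 0 <= f x.
Hypothesis fE : forall x, f (- x) = f x.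
Hypothesis fI : (\int[beta]_x (f x)%:E = 1)%E.
Variables (p b C1 : R).
Hypothesis p_ge1 : 1 <= p.
Hypothesis b_gt0 : 0 < b.
Hypothesis C1_ge0 : 0 <= C1.
Hypothesis f_decay : forall x, f x <= C1 * expR (- (b * enorm x `^ p)).

Notation dom := (dom f).
Notation lam := (lam f).
Notation ell := (ell f).

Lemma measurable_enorm_exp (k : nat) (G : R) :
  measurable_fun setT (fun x : 'rV[R]_n => enorm x ^+ k * expR (G * enorm x)).
Proof.
apply: measurable_funM; first by apply: measurable_funX; exact: measurable_enorm.
by apply: measurableT_comp => //; apply: measurable_funM => //; exact: measurable_enorm.
Qed.

Lemma wint_enorm_exp_lty (k : nat) (G : R) : 0 <= G -> (1 < p \/ G < b) ->
  (wint f (fun x => (enorm x ^+ k * expR (G * enorm x))%R) < +oo)%E.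
Proof.
move=> G0 pG; have [C [c [C0 c0 hC]]] := decay_tilt p_ge1 b_gt0 C1_ge0 G0 pG.
have c20 : 0 < c / 2 by rewrite divr_gt0.
have [K K0 hK] := poly_exp_bound k c20.
apply: (@exp_tail_integral_lty _ _ _ (K * C) (c / 2)) => //.
- by apply: measurable_funM => //; exact: measurable_enorm_exp.
- by move=> x; rewrite !mulr_ge0 ?expR_ge0 ?exprn_ge0 ?enorm_ge0.
- move=> x; have u0 := enorm_ge0 x; set u := enorm x in u0 *.
  apply: (@le_trans _ _ (K * C * expR (- (c / 2 * u)))); last first.
    rewrite ler_wpM2l ?mulr_ge0// ler_expR lerN2 ler_wpM2l ?(ltW c20)//.
    exact: normr_le_enorm.
  rewrite (_ : expR (- (c / 2 * u)) = expR (c / 2 * u) * expR (- (c * u))); last first.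
    by rewrite -expRD; congr expR; field.
  rewrite (_ : K * C * _ = (K * expR (c / 2 * u)) * (C * expR (- (c * u)))); last by ring.
  rewrite -mulrA; apply: ler_pM; rewrite ?exprn_ge0 ?mulr_ge0 ?expR_ge0//.
    exact: hK.
  by apply: le_trans (hC _ u0); rewrite mulrC ler_wpM2r ?expR_ge0.
Qed.

Lemma mgf_ball_bounded (G : R) : 0 <= G -> (1 < p \/ G < b) ->
  exists M, forall g, enorm g <= G -> dom g /\ lam g <= M.
Proof.
move=> G0 pG; have fin := wint_enorm_exp_lty 0 G0 pG.
set W := wint f _ in fin; have W0 : (0 <= W)%E.
  by apply: wint_ge0 => // x; rewrite mulr_ge0 ?expR_ge0.
exists (fine W) => g gG; apply: (dom_le f0).
rewrite fineK ?ge0_fin_numE//; apply: wint_le => //.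
- exact: measurable_expR_dot.
- exact: measurable_enorm_exp.
- move=> x; rewrite expr0 mul1r ler_expR; apply: le_trans (dot_le_enorm _ _) _.
  by rewrite ler_wpM2r// enorm_ge0.
Qed.

Lemma quad_fin g : quad f g \is a fin_num.
Proof.
rewrite ge0_fin_numE; last by apply: wint_ge0 => // x; exact: sqr_ge0.
apply: (@wint_le_mulr _ _ f mf f0 _ (fun x => enorm x ^+ 2 * expR (0 * enorm x)) (enorm g ^+ 2)).
- exact: measurable_dot2.
- exact: measurable_enorm_exp.
- by move=> x; exact: sqr_ge0.
- by move=> x; rewrite mulr_ge0 ?sqr_ge0 ?expR_ge0.
- exact: sqr_ge0.
- move=> x; rewrite mul0r expR0 mulr1 -exprMn -real_normK ?num_real//.
  by rewrite lerXn2r ?nnegrE ?mulr_ge0 ?enorm_ge0// normr_dot_le.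
- by apply: wint_enorm_exp_lty => //; right.
Qed.

Lemma lam_lower g : dom g -> 2 + fine (quad f g) <= 2 * lam g.
Proof.
move=> dg; have := mgf_lower mf f0 fE fI g.
by rewrite (domE f0 dg) -(fineK (quad_fin g)) -EFinD -EFinM lee_fin.
Qed.

(** [cosh_le3] at [g.X]: the cubic moment stays integrable after tilting by
    less than [b]. *)
Lemma lam_third_order : exists2 G, 0 < G & exists2 C, 0 <= C & forall g, enorm g <= G ->
  dom g /\ 2 * lam g <= 2 + fine (quad f g) + C * enorm g ^+ 3.
Proof.
exists (b / 2); first by rewrite divr_gt0.
have bb : 1 < p \/ b / 2 < b by right; have := b_gt0; lra.
have b20 : 0 <= b / 2 by rewrite divr_ge0// ltW.
have fin := wint_enorm_exp_lty 3 b20 bb.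
set W := wint f _ in fin; have W0 : (0 <= W)%E.
  by apply: wint_ge0 => // x; rewrite mulr_ge0 ?expR_ge0 ?exprn_ge0 ?enorm_ge0.
have [M hM] := mgf_ball_bounded b20 bb.
exists (fine W); first by rewrite fine_ge0.
move=> g gG; have [dg _] := hM g gG; split => //.
rewrite -lee_fin EFinM -(domE f0 dg) -(mgf_double mf f0 fE).
rewrite 2!EFinD EFinM (fineK (quad_fin g)) fineK ?ge0_fin_numE//.
rewrite -(wint_cst mf f0 fI (ler0n R 2)) muleC -wintZ//; last 3 first.
- exact: measurable_enorm_exp.
- by rewrite exprn_ge0// enorm_ge0.
- by move=> x; rewrite mulr_ge0 ?expR_ge0 ?exprn_ge0 ?enorm_ge0.
rewrite -wintD//; last 2 first.
- exact: measurable_dot2.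
- by move=> x; exact: sqr_ge0.
rewrite -wintD//; last 4 first.
- by apply: measurable_funD => //; exact: measurable_dot2.
- by apply: measurable_funM => //; exact: measurable_enorm_exp.
- by move=> x; rewrite addr_ge0 ?sqr_ge0.
- by move=> x; rewrite !mulr_ge0 ?expR_ge0 ?exprn_ge0 ?enorm_ge0.
have mN := @measurable_expN R n g.
apply: wint_le => //.
- by apply: measurable_funD => //; exact: measurable_expR_dot.
- apply: measurable_funD; first by apply: measurable_funD => //; exact: measurable_dot2.
  by apply: measurable_funM => //; exact: measurable_enorm_exp.
- move=> x; apply: le_trans (cosh_le3 _) _; rewrite lerD2l mulrA -exprMn.
  have h := normr_dot_le g x.
  apply: ler_pM; rewrite ?exprn_ge0 ?expR_ge0//.
    by rewrite lerXn2r ?nnegrE ?mulr_ge0 ?enorm_ge0.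
  by rewrite ler_expR; apply: le_trans h _; rewrite ler_wpM2r ?enorm_ge0.
Qed.

Lemma wint_le_comb (f' h1 h2 h3 h4 h5 : 'rV[R]_n -> R) (A B : R) :
  measurable_fun setT f' -> (forall x, 0 <= f' x) ->
  measurable_fun setT h1 -> measurable_fun setT h2 -> measurable_fun setT h3 ->
  measurable_fun setT h4 -> measurable_fun setT h5 ->
  (forall x, 0 <= h1 x) -> (forall x, 0 <= h2 x) -> (forall x, 0 <= h3 x) ->
  (forall x, 0 <= h4 x) -> (forall x, 0 <= h5 x) -> 0 <= A -> 0 <= B ->
  (forall x, h1 x + h2 x <= A * h3 x + B * (h4 x + h5 x)) ->
  (wint f' h1 + wint f' h2 <=
    A%:E * wint f' h3 + B%:E * (wint f' h4 + wint f' h5))%E.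
Proof.
move=> mf' f'0 m1 m2 m3 m4 m5 p1 p2 p3 p4 p5 A0 B0 H.
have m45 : measurable_fun setT (fun x => h4 x + h5 x) by exact: measurable_funD.
have p45 x : 0 <= h4 x + h5 x by rewrite addr_ge0.
rewrite -(wintD mf' f'0 m4 m5 p4 p5) -(wintZ mf' f'0 m45 B0 p45).
rewrite -(wintZ mf' f'0 m3 A0 p3) -(wintD mf' f'0 m1 m2 p1 p2).
have m3' : measurable_fun setT (fun x => A * h3 x) by exact: measurable_funM.
have m45' : measurable_fun setT (fun x => B * (h4 x + h5 x)) by exact: measurable_funM.
rewrite -(wintD mf' f'0 m3' m45' (fun x => mulr_ge0 A0 (p3 x)) (fun x => mulr_ge0 B0 (p45 x))).
apply: (wint_le mf' f'0) => //.
- exact: measurable_funD.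
- exact: measurable_funD.
- by move=> x; rewrite addr_ge0.
Qed.

(** Convexity of the domain covers the segment, and [cosh_le2] bounds the
    second difference by the tilted expectation of [u^2 exp (t |u|)], [u =
    w.X]; for [t <= h0 / 2] this is at most a constant times [exp (h0 |u|)],
    which is integrable by the assumption at the endpoints. *)
Lemma lam_second_difference g w (h0 : R) : 0 < h0 -> dom (g + h0 *: w) -> dom (g - h0 *: w) ->
  exists2 C, 0 <= C & forall t, 0 <= t -> t <= h0 / 2 ->
  [/\ dom (g + t *: w), dom (g - t *: w) &
      lam (g + t *: w) + lam (g - t *: w) <= 2 * lam g + C * t ^+ 2].
Proof.
move=> h00 dp dm.
have cvx (t : R) : 0 <= t -> t <= 1 -> dom (t *: (g + h0 *: w) + (1 - t) *: (g - h0 *: w)).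
  by move=> u0 u1; have [] := ell_convex mf f0 fE fI dp dm u0 u1.
have dg : dom (2^-1 *: (g + h0 *: w) + (1 - 2^-1) *: (g - h0 *: w)) by apply: cvx; lra.
rewrite (_ : _ *: _ + _ *: _ = g) in dg; last first.
  by apply/rowP => i; rewrite !mxE; lra.
(* [u^2 <= K expR (h0 |u| / 2)], from [y <= expR y] at [y = h0 |u| / 4] *)
pose K := 16 / h0 ^+ 2.
have K0 : 0 <= K by rewrite divr_ge0 ?sqr_ge0.
exists (K * (lam (g + h0 *: w) + lam (g - h0 *: w))).
  by rewrite mulr_ge0// addr_ge0// ltW// (lam_gt0 mf f0 fE fI).
move=> t t0 th.
have t1 : 0 <= 2^-1 - t / (2 * h0) /\ 0 <= t / (2 * h0) /\ t / (2 * h0) <= 4^-1.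
  have q : t / (2 * h0) <= 4^-1 by rewrite ler_pdivrMr ?mulr_gt0//; lra.
  by split; [lra|split => //; rewrite divr_ge0// mulr_ge0// ltW].
have dt1 : dom ((2^-1 + t / (2 * h0)) *: (g + h0 *: w) + (1 - (2^-1 + t / (2 * h0))) *: (g - h0 *: w)).
  by apply: cvx; case: t1 => ? [? ?]; lra.
have dt2 : dom ((2^-1 - t / (2 * h0)) *: (g + h0 *: w) + (1 - (2^-1 - t / (2 * h0))) *: (g - h0 *: w)).
  by apply: cvx; case: t1 => ? [? ?]; lra.
rewrite (_ : _ *: _ + _ *: _ = g + t *: w) in dt1; last first.
  by apply/rowP => i; rewrite !mxE; field; rewrite gt_eqF.
rewrite (_ : _ *: _ + _ *: _ = g - t *: w) in dt2; last first.
  by apply/rowP => i; rewrite !mxE; field; rewrite gt_eqF.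
split => //.
have E := domE f0.
have mE g' := @measurable_expR_dot R n g'.
have e0 g' x : 0 <= expR (dot g' x) by exact: expR_ge0.
have Kt0 : 0 <= K * t ^+ 2 by rewrite mulr_ge0// sqr_ge0.
suff key : (mgf f (g + t *: w) + mgf f (g - t *: w) <=
    2%:E * mgf f g + (K * t ^+ 2)%:E * (mgf f (g + h0 *: w) + mgf f (g - h0 *: w)))%E.
  move: key; rewrite (E _ dg) (E _ dt1) (E _ dt2) (E _ dp) (E _ dm).
  move: (lam _) (lam _) (lam _) (lam _) (lam _) => A1 A2 A3 A4 A5.
  change (((A5 + A4)%:E <= (2 * A3 + K * t ^+ 2 * (A2 + A1))%:E)%E ->
    A5 + A4 <= 2 * A3 + K * (A2 + A1) * t ^+ 2).
  by rewrite lee_fin (mulrAC K).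
apply: (wint_le_comb mf f0 (mE _) (mE _) (mE _) (mE _) (mE _) (e0 _) (e0 _) (e0 _) (e0 _) (e0 _)
  (ler0n R 2) Kt0).
move=> x; rewrite !dotDl !dotNl !dotZl.
set u := dot w x; rewrite !expRD -!mulrDr mulrCA [in leRHS]mulrC.
rewrite -mulrDr ler_pM2l ?expR_gt0//.
apply: le_trans (cosh_le2 _) _; rewrite lerD2l normrM (ger0_norm t0).
rewrite exprMn -mulrA.
have au := normr_ge0 u.
have h1 : h0 * `|u| / 2 / 2 <= expR (h0 * `|u| / 2 / 2).
  by have := expR_ge1Dx (h0 * `|u| / 2 / 2); lra.
have h2 : (h0 * `|u| / 2 / 2) ^+ 2 <= expR (h0 * `|u| / 2).
  rewrite (_ : expR (h0 * `|u| / 2) = expR (h0 * `|u| / 2 / 2) ^+ 2).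
    by rewrite lerXn2r ?nnegrE ?expR_ge0// !divr_ge0// mulr_ge0// ltW.
  by rewrite -expRM_natl; congr expR; field.
have h3 : u ^+ 2 <= K * expR (h0 * `|u| / 2).
  rewrite /K -real_normK ?num_real// mulrAC ler_pdivlMr ?exprn_gt0//.
  rewrite (_ : _ * h0 ^+ 2 = 16 * (h0 * `|u| / 2 / 2) ^+ 2); last by field.
  by rewrite ler_pM2l.
have h4 : expR (t * `|u|) <= expR (h0 * `|u| / 2).
  by rewrite ler_expR mulrAC ler_wpM2r.
have h5 : expR (h0 * `|u|) <= expR (h0 * u) + expR (- (h0 * u)).
  have [u0|u0] := leP 0 u; first by rewrite (ger0_norm u0) lerDl expR_ge0.
  by rewrite (ltr0_norm u0) mulrN lerDr expR_ge0.
apply: (@le_trans _ _ (t ^+ 2 * (K * expR (h0 * `|u| / 2) * expR (h0 * `|u| / 2)))).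
  by apply: ler_wpM2l; [exact: sqr_ge0|rewrite ler_pM// ?sqr_ge0 ?expR_ge0].
rewrite -(mulrA K (expR _)) -expRD (_ : h0 * `|u| / 2 + h0 * `|u| / 2 = h0 * `|u|); last by field.
rewrite mulrA (mulrC _ K); exact: ler_wpM2l.
Qed.

Hypothesis steep : forall th, enorm th = 1 ->
  wint f (fun x => enorm x * expR (b * dot x th)) = +oo%E.

(** Off the cone [enorm x / 2 <= dot x th] the integrand of the steepness
    condition is bounded by [enorm x * expR (b / 2 * enorm x)], which is
    integrable, so the divergence comes from the cone. *)
Lemma steep_infinite th h (K : R) : enorm th = 1 -> measurable_fun setT h ->
  (forall x, 0 <= h x) -> 0 <= K ->
  (forall x, enorm x / 2 <= dot x th -> enorm x * expR (b * dot x th) <= K * h x) ->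
  wint f h = +oo%E.
Proof.
move=> th1 mh h0 K0 H.
have [hfin|] := ltP (wint f h) +oo%E; last by rewrite leye_eq => /eqP.
have b20 : 0 <= b / 2 by rewrite divr_ge0// ltW.
have fin2 : (wint f (fun x => (enorm x ^+ 1 * expR (b / 2 * enorm x))%R) < +oo)%E.
  by apply: wint_enorm_exp_lty => //; right; have := b_gt0; lra.
have mK : measurable_fun setT (fun x => K * h x) by exact: measurable_funM.
suff : (wint f (fun x => (enorm x * expR (b * dot x th))%R) < +oo)%E by rewrite steep.
apply: (@le_lt_trans _ _ (wint f (fun x => (K * h x + enorm x ^+ 1 * expR (b / 2 * enorm x))%R))).
  apply: wint_le => //.
  - apply: measurable_funM; first exact: measurable_enorm.
    apply: measurableT_comp => //; apply: measurable_funM => //.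
    exact: measurable_dot.
  - by apply: measurable_funD => //; exact: measurable_enorm_exp.
  - by move=> x; rewrite mulr_ge0 ?enorm_ge0 ?expR_ge0.
  - move=> x; have [ux|/ltW ux] := leP (enorm x / 2) (dot x th).
      apply: le_trans (H x ux) _; rewrite lerDl mulr_ge0 ?expR_ge0//.
      by rewrite expr1 enorm_ge0.
    apply: (@le_trans _ _ (enorm x ^+ 1 * expR (b / 2 * enorm x))).
      rewrite expr1 ler_wpM2l ?enorm_ge0// ler_expR mulrAC -mulrA.
      by rewrite ler_wpM2l ?(ltW b_gt0).
    by rewrite lerDr mulr_ge0.
rewrite wintD//; last 3 first.
- exact: measurable_enorm_exp.
- by move=> x; rewrite mulr_ge0.
- by move=> x; rewrite mulr_ge0 ?expR_ge0 ?expr1 ?enorm_ge0.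
by rewrite lte_add_pinfty// wintZ// lte_mul_pinfty// wint_ge0.
Qed.

(** Tilting by more than [b] absorbs the linear factor of the steepness
    condition. *)
Lemma dom_le_b g : dom g -> enorm g <= b.
Proof.
move=> dg; rewrite leNgt; apply/negP => bg.
have N0 : 0 < enorm g by exact: lt_trans bg.
pose th := (enorm g)^-1 *: g.
have th1 : enorm th = 1.
  by rewrite enormZ gtr0_norm ?invr_gt0// mulVf// gt_eqF.
have gth x : dot g x = enorm g * dot x th.
  by rewrite dotZr mulrA mulfV ?mul1r ?gt_eqF// dotC.
have bg0 : 0 < enorm g - b by rewrite subr_gt0.
suff : mgf f g = +oo%E by move=> h; move: (dg : (mgf f g < +oo)%E); rewrite h ltxx.
apply: (@steep_infinite th _ (2 / (enorm g - b))) => //.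
- exact: measurable_expR_dot.
- by rewrite divr_ge0// ltW.
- move=> x ux; rewrite gth; set u := dot x th in ux *.
  have u0 : 0 <= u by apply: le_trans ux; rewrite divr_ge0// enorm_ge0.
  rewrite (_ : enorm g * u = (enorm g - b) * u + b * u); last by ring.
  rewrite expRD mulrA ler_wpM2r ?expR_ge0//.
  apply: (@le_trans _ _ (2 * u)); first by lra.
  rewrite -mulrA ler_pM2l// ler_pdivlMl//.
  by have := expR_ge1Dx ((enorm g - b) * u); lra.
Qed.

(** On the sphere of radius [b] the derivative of [Lambda] along the ray is
    infinite at [g] by steepness. Maximality however bounds the difference
    quotient [(Lambda g - Lambda (t g)) / (1 - t)] by [g.r], and with it the
    derivative at [t]; letting [t] approach one on a ball where the
    derivative is already large gives the contradiction. *)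
Lemma is_maxL_lt_b r g : is_maxL dom lam r g -> enorm g < b.
Proof.
move=> [dg gmax]; rewrite lt_neqAle dom_le_b// andbT; apply/eqP => gb.
pose th := b^-1 *: g.
have th1 : enorm th = 1.
  by rewrite enormZ gtr0_norm ?invr_gt0// gb mulVf// gt_eqF.
have gth x : dot g x = b * dot x th.
  by rewrite dotZr mulrA mulfV ?mul1r ?gt_eqF// dotC.
(* adding two makes the integrand of the derivative nonnegative for [t >=
   1/2] *)
have mYt (t : R) : measurable_fun setT (fun x => dot g x * expR (t * dot g x) + 2).
  apply: measurable_funD => //; apply: measurable_funM; first exact: measurable_dotl.
  by apply: measurableT_comp => //; apply: measurable_funM => //; exact: measurable_dotl.
have Y0 (t : R) x : 2^-1 <= t -> 0 <= dot g x * expR (t * dot g x) + 2.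
  by move=> t2; have := mul_expR_ge (dot g x) t2; lra.
have inf : wint f (fun x => dot g x * expR (1 * dot g x) + 2) = +oo%E.
  apply: (@steep_infinite th _ (2 / b)) => //.
  - by move=> x; apply: Y0; lra.
  - by rewrite divr_ge0// ltW.
  - move=> x ux; rewrite mul1r gth; set u := dot x th in ux *.
    have u0 : 0 <= u by apply: le_trans ux; rewrite divr_ge0// enorm_ge0.
    apply: (@le_trans _ _ (2 * u * expR (b * u))).
      by rewrite ler_wpM2r ?expR_ge0//; lra.
    rewrite mulrDr -!mulrA (mulrCA b^-1) mulVKf ?gt_eqF//.
    by rewrite lerDl mulr_ge0// mulr_ge0// invr_ge0 ltW.
have half1 : (2^-1 : R) <= 1 by lra.
have lt5 : ((dot g r + 5)%:E < wint f (fun x => dot g x * expR (1 * dot g x) + 2)%R)%E.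
  by rewrite inf ltry.
have [k] := wint_trunc mf f0 (mYt 1) (fun x => Y0 1 x half1) lt5.
pose B := (b * (n%:R * k%:R)) ^+ 2 * expR (b * (n%:R * k%:R)).
have B0 : 0 <= B by rewrite mulr_ge0 ?sqr_ge0 ?expR_ge0.
(* on the ball of radius [k] the derivatives at [1] and at [1 - s] differ by
   at most one *)
pose s := (2 * (B + 1))^-1.
have s0 : 0 < s by rewrite invr_gt0 mulr_gt0// ltr_wpDl.
have s2 : s <= 2^-1 by rewrite lef_pV2 ?posrE ?mulr_gt0 ?ltr_wpDl//; lra.
have sB : s * B <= 1.
  rewrite /s mulrC ler_pdivrMr ?mulr_gt0 ?ltr_wpDl//; lra.
pose t := 1 - s.
have t2 : 2^-1 <= t by rewrite /t; lra.
have t1 : t <= 1 by rewrite /t; lra.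
have t0 : 0 <= t by lra.
have [dt _] := ell_convex mf f0 fE fI dg (dom0 mf f0 fI) t0 t1.
rewrite scaler0 addr0 in dt.
have up : (wint f (fun x => (dot g x * expR (t * dot g x) + 2)%R) <= (dot g r + 2)%:E)%E.
  have s1 : (s%:E * wint f (fun x => (dot g x * expR (t * dot g x) + 2)%R) + mgf f (t *: g)
     <= mgf f g + (2 * s)%:E)%E.
    rewrite -wintZ//; [|exact: ltW|by move=> x; exact: Y0].
    rewrite -(wint_cst mf f0 fI (c := 2 * s)); last by rewrite mulr_ge0// ltW.
    rewrite -!wintD//; last 5 first.
    - exact: measurable_expR_dot.
    - by move=> _; rewrite mulr_ge0// ltW.
    - by apply: measurable_funM.
    - exact: measurable_expR_dot.
    - by move=> x; rewrite mulr_ge0 ?Y0// ltW.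
    apply: wint_le => //.
    - apply: measurable_funD; last exact: measurable_expR_dot.
      exact: measurable_funM.
    - by apply: measurable_funD => //; exact: measurable_expR_dot.
    - by move=> x; rewrite addr_ge0 ?expR_ge0// mulr_ge0 ?Y0// ltW.
    - move=> x; rewrite dotZl.
      have := mul_expR_diff (dot g x) t0 t1.
      rewrite (_ : 1 - t = s); last by rewrite /t; ring.
      lra.
  have := gmax _ dt; rewrite dotZl => gm.
  move: s1; rewrite !(domE f0)//.
  have := wint_ge0 f0 (fun x => Y0 t x t2).
  case: (wint f _) => [W| |]// W0.
    rewrite -EFinM -!EFinD !lee_fin => h.
    have : s * W <= s * (dot g r + 2).
      by move: gm h; rewrite /t; move: (lam _) (lam g) => A C; lra.
    by rewrite ler_pM2l.
  by rewrite gt0_muley ?lte_fin.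
apply/negP; rewrite -leNgt.
apply: (@le_trans _ _ (wint f (fun x => ((dot g x * expR (t * dot g x) + 2) + 1)%R))).
  apply: wint_le => //.
  - exact: measurable_trunc.
  - exact: measurable_funD.
  - by move=> x; rewrite mulr_ge0// Y0//; lra.
  - move=> x; rewrite indicE; case: (boolP (x \in _)) => [|_]; last first.
      by rewrite mul0r addr_ge0// Y0.
    rewrite inE /cball/= sub0r normrN mul1r => xk.
    have gx : `|dot g x| <= b * (n%:R * k%:R).
      apply: le_trans (normr_dot_le _ _) _; rewrite gb ler_wpM2l ?(ltW b_gt0)//.
      by apply: le_trans (enorm_le_normr _) _; rewrite ler_wpM2l.
    have := mul_expR_near (dot g x) t0 t1.
    rewrite (_ : 1 - t = s); last by rewrite /t; ring.
    have : s * (dot g x ^+ 2 * expR `|dot g x|) <= s * B.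
      rewrite ler_wpM2l ?(ltW s0)// /B ler_pM ?sqr_ge0 ?expR_ge0 ?ler_expR//.
      by rewrite -real_normK ?num_real// lerXn2r ?nnegrE ?mulr_ge0// ltW.
    rewrite mul1r; lra.
rewrite wintD//; last by move=> x; exact: Y0.
rewrite (wint_cst mf f0 fI ler01).
apply: le_trans (leeD2r _ up) _; rewrite -EFinD lee_fin; lra.
Qed.

End decaying_density.

(** * The rate at the origin, convexity and linear bounds *)

Lemma asympP (R : realType) (T : Type) (F : set_system T) (u w : T -> R) :
  Filter F ->
  (forall eps, 0 < eps -> \forall x \near F, 0 < w x /\ `|u x - w x| <= eps * w x) ->
  asymp F u w.
Proof.
move=> FF H; exists (fun x => u x / w x - 1).
  apply/cvgr0Pnorm_le => eps eps0; near=> x.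
  have [w0 uw] : 0 < w x /\ `|u x - w x| <= eps * w x by near: x; exact: H.
  rewrite -[X in `|_ - X|](mulfV (lt0r_neq0 w0)) -mulrBl normrM normfV (gtr0_norm w0).
  by rewrite ler_pdivrMr.
near=> x; have [w0 _] : 0 < w x /\ `|u x - w x| <= 1 * w x by near: x; exact: H.
by rewrite addrCA subrr addr0 mulrC divfK// gt_eqF.
Unshelve. all: by end_near. Qed.

Section duality_instance.
Context {R : realType} {n : nat}.
Notation beta := (@borel_lebesgue R n).
Notation lamb := (@lebesgue_rV R n).
Variables a f : 'rV[R]_n -> R.
Implicit Types (h : 'rV[R]_n -> R) (g r x w : 'rV[R]_n) (c : R).
Hypothesis mf : measurable_fun setT f.
Hypothesis f0 : forall x, 0 <= f x.
Hypothesis fE : forall x, f (- x) = f x.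
Hypothesis fI : (\int[beta]_x (f x)%:E = 1)%E.
Hypothesis a0 : forall x, 0 <= a x.
Hypothesis transfer : forall h, measurable_fun setT h -> (forall x, 0 <= h x) ->
  (\int[lamb]_x (h x * a x)%:E = \int[beta]_x (h x * f x)%:E)%E.

Notation dom := (dom f).
Notation lam := (lam f).
Notation ell := (ell f).

Lemma Lambda_mgf : Lambda a = mgf f.
Proof.
apply/funext => g; apply: transfer; first exact: measurable_expR_dot.
by move=> x; exact: expR_ge0.
Qed.

Lemma Phi_dual r : exists2 g, is_maxL dom lam r g & Phi a r = dot g r - lam g + 1.
Proof.
have [sig s0 sg] := lam_grow mf f0 fE fI.
have domE' g : dom g -> Lambda a g = (lam g)%:E by rewrite Lambda_mgf; exact: domE.
have ndomE' g : ~ dom g -> Lambda a g = +oo%E by rewrite Lambda_mgf; exact: not_dom.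
have lscL : lsc (Lambda a) by rewrite Lambda_mgf; exact: mgf_lsc.
have [g [dg E H]] := Phi_legendre domE' ndomE' (expR_ell mf f0 fE fI) (dom0 mf f0 fI)
  (lam0 mf f0 fI) lscL (ell_convex mf f0 fE fI) (ell_strict mf f0 fE fI) s0 sg
  (lam_ge1 mf f0 fE fI) r.
exists g; last exact: E.
split; first exact: dg.
move=> g' dg'.
by have := H g' dg'; rewrite E lerD2r.
Qed.

Lemma Phi_ge r g : dom g -> dot g r - lam g + 1 <= Phi a r.
Proof. by move=> dg; have [g' [_ H] ->] := Phi_dual r; rewrite lerD2r; exact: H. Qed.

Lemma Phi_zero : Phi a 0 = 0.
Proof.
apply/eqP; rewrite eq_le; apply/andP; split.
  have [g [dg _] ->] := Phi_dual 0; rewrite dot0r.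
  by have := lam_ge1 mf f0 fE fI dg; lra.
have := Phi_ge 0 (dom0 mf f0 fI); rewrite dot0r (lam0 mf f0 fI); lra.
Qed.

Lemma Phi_convex : convex_function [set: 'rV[R]_n] (Phi a).
Proof.
move=> t x y _ _.
have [g [dg _] ->] := Phi_dual (conv t x y).
have -> : dot g (conv t x y) = t%:inum * dot g x + (1 - t%:inum) * dot g y.
  by rewrite -!dotZr -dotDr.
have hx := Phi_ge x dg; have hy := Phi_ge y dg.
rewrite convRE.
have [t0 t1] : 0 <= t%:inum /\ t%:inum <= 1 :> R by split; [exact: ge0|exact: le1].
move: (t%:inum) t0 t1 => s s0 s1.
have := ler_wpM2l s0 hx; have := @ler_wpM2l _ (1 - s) ltac:(by rewrite subr_ge0) _ _ hy.
have -> : unstable.onem s = 1 - s by [].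
lra.
Qed.

(** [transfer] concerns nonnegative weights, so the mixed moment is split
    into its positive and negative parts. *)
Lemma covariance_transfer i j :
  covariance_mx a i j = fine (\int[beta]_x (x ord0 i * x ord0 j * f x)%:E)%E.
Proof.
rewrite mxE /Rintegral integralE [in RHS]integralE.
pose k (x : 'rV[R]_n) := x ord0 i * x ord0 j.
have mk : measurable_fun setT k.
  by apply: measurable_funM; exact: measurable_coord.
have posE (u : 'rV[R]_n -> R) : (forall x, 0 <= u x) ->
    (fun x : 'rV[R]_n => (x ord0 i * x ord0 j * u x)%:E)^\+%E = (fun x => (Num.max (k x) 0 * u x)%:E).
  by move=> u0; apply/funext => x; rewrite funeposE -EFin_max maxr_pMl// mul0r.
have negE (u : 'rV[R]_n -> R) : (forall x, 0 <= u x) ->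
    (fun x : 'rV[R]_n => (x ord0 i * x ord0 j * u x)%:E)^\-%E = (fun x => (Num.max (- k x) 0 * u x)%:E).
  by move=> u0; apply/funext => x; rewrite funenegE -EFinN -EFin_max maxr_pMl// mul0r mulNr.
rewrite !posE// !negE//; congr (fine (_ - _)%E); apply: transfer.
- exact: measurable_maxr.
- by move=> x; rewrite le_max lexx orbT.
- by apply: measurable_maxr => //; exact: measurableT_comp.
- by move=> x; rewrite le_max lexx orbT.
Qed.

Lemma covariance_sym : (covariance_mx a)^T = covariance_mx a.
Proof.
apply/matrixP => i j; rewrite mxE !covariance_transfer; congr fine.
by apply: eq_integral => x _; rewrite (mulrC (x ord0 i)).
Qed.

Section finite_second_moment.
Hypothesis mom2 : (wint f (fun x => (enorm x ^+ 2)%R) < +oo)%E.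

Lemma quad_covariance g : quad f g = (dot (g *m covariance_mx a) g)%:E.
Proof.
pose c i j (x : 'rV[R]_n) := (x ord0 i * x ord0 j * f x)%:E.
have mc i j : measurable_fun setT (c i j).
  apply: wint_measurable => //; apply: measurable_funM; exact: measurable_coord.
have ic i j : beta.-integrable setT (c i j).
  apply/integrableP; split => //; apply: le_lt_trans mom2.
  apply: ge0_le_integral => //.
  - exact: measurableT_comp (mc i j).
  - apply: wint_measurable => //; apply: measurable_funX; exact: measurable_enorm.
  - move=> x _; rewrite /c abse_EFin lee_fin !normrM (ger0_norm (f0 x)) ler_wpM2r//.
    rewrite expr2; have H k : `|x ord0 k| <= enorm x.
      exact: le_trans (ler_coord_norm _ _) (normr_le_enorm _).
    by rewrite ler_pM.
pose G i j x := ((g ord0 i * g ord0 j)%:E * c i j x)%E.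
have iG i j : beta.-integrable setT (G i j) by exact: integrableZl.
have -> : quad f g = (\int[beta]_x (\sum_(i < n) \sum_(j < n) G i j x))%E.
  apply: eq_integral => x _.
  rewrite expr2 /dot big_distrlr/= mulr_suml -sumEFin; apply: eq_bigr => i _.
  rewrite mulr_suml -sumEFin; apply: eq_bigr => j _.
  by rewrite /G /c -EFinM; congr EFin; ring.
rewrite integral_sum//; last by move=> i; exact: integrable_sum.
rewrite /dot -sumEFin [RHS](eq_bigr (fun j => \sum_(i < n) (g ord0 i * covariance_mx a i j * g ord0 j)%:E)%E); last first.
  by move=> j _; rewrite sumEFin mxE mulr_suml.
rewrite exchange_big/=; apply: eq_bigr => i _.
rewrite integral_sum//; apply: eq_bigr => j _.
rewrite integralZl// covariance_transfer.
have F := integrable_fin_num measurableT (ic i j).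
by rewrite -{1}(fineK F) -EFinM mulrAC.
Qed.

Lemma covariance_unit : covariance_mx a \in unitmx.
Proof.
rewrite -row_free_unit; apply: inj_row_free => w w0; apply/eqP; apply: contraT => wn.
by have := quad_gt0 mf f0 fI wn; rewrite quad_covariance w0 dot0l ltxx.
Qed.

Lemma dot_covariance_sym g w :
  dot (g *m covariance_mx a) w = dot (w *m covariance_mx a) g.
Proof.
have E (u u' : 'rV[R]_n) : dot u u' = (u *m u'^T) ord0 ord0.
  by rewrite mxE; apply: eq_bigr => i _; rewrite mxE.
by rewrite dotC !E trmx_mul covariance_sym mulmxA.
Qed.

Lemma quadZ g c : quad f (c *: g) = ((c ^+ 2)%:E * quad f g)%E.
Proof.
rewrite !quad_covariance -EFinM; congr EFin.
by rewrite -scalemxAl dotZl dotZr expr2 mulrA.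
Qed.

(** The maximizer of [g.r] minus half the covariance form. *)
Definition gauss_dual r : 'rV[R]_n := r *m (invmx (covariance_mx a))^T.

Lemma gauss_dualK r : gauss_dual r *m covariance_mx a = r.
Proof. by rewrite /gauss_dual trmx_inv covariance_sym mulmxKV// covariance_unit. Qed.

Lemma quad_gauss_dual r : fine (quad f (gauss_dual r)) = dot (gauss_dual r) r.
Proof. by rewrite quad_covariance gauss_dualK dotC. Qed.

(** Completing the square: the form is nonnegative at [g - gauss_dual r]. *)
Lemma dot_le_gauss g r :
  dot g r - 2^-1 * fine (quad f g) <= 2^-1 * dot (gauss_dual r) r.
Proof.
have : 0 <= fine (quad f (g - gauss_dual r)).
  by apply: fine_ge0; apply: wint_ge0 => // x; exact: sqr_ge0.
rewrite !quad_covariance/= mulmxBl dotBl !dotBr gauss_dualK.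
rewrite (dot_covariance_sym g (gauss_dual r)) gauss_dualK (dotC r g) (dotC r (gauss_dual r)).
lra.
Qed.

Section expansion.
Variables (G C : R).
Hypothesis G_gt0 : 0 < G.
Hypothesis C_ge0 : 0 <= C.
Hypothesis third : forall g, enorm g <= G ->
  dom g /\ 2 * lam g <= 2 + fine (quad f g) + C * enorm g ^+ 3.
Hypothesis lower : forall g, dom g -> 2 + fine (quad f g) <= 2 * lam g.

Lemma Phi_le_gauss r : Phi a r <= 2^-1 * dot (gauss_dual r) r.
Proof.
have [g [dg _] ->] := Phi_dual r.
have := lower dg; have := dot_le_gauss g r.
move: (dot g r) (fine _) (lam g) (dot _ r) => A B D E; lra.
Qed.

Lemma Phi_ge_gauss r : enorm (gauss_dual r) <= G ->
  2^-1 * dot (gauss_dual r) r - C * enorm (gauss_dual r) ^+ 3 <= Phi a r.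
Proof.
move=> /[dup] hG /third [dg]; have := Phi_ge r dg; rewrite quad_gauss_dual.
have : 0 <= C * enorm (gauss_dual r) ^+ 3 by rewrite mulr_ge0// exprn_ge0// enorm_ge0.
move: (dot _ r) (lam _) (C * _) (Phi a r) => A B D E; lra.
Qed.

Lemma gauss_dual_bounds : exists2 K, 0 < K &
  exists2 s, 0 < s & forall r, enorm (gauss_dual r) <= K * enorm r /\
    s * enorm (gauss_dual r) ^+ 2 <= dot (gauss_dual r) r.
Proof.
have [sig s0 hs] := quad_coercive mf f0 fI.
pose s := sig / (n%:R ^+ 2 + 1).
have n1 : 0 < n%:R ^+ 2 + 1 :> R by rewrite ltr_wpDl// sqr_ge0.
have s1 : 0 < s by rewrite divr_gt0.
have H r : s * enorm (gauss_dual r) ^+ 2 <= dot (gauss_dual r) r.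
  rewrite -quad_gauss_dual.
  have h := hs (gauss_dual r); rewrite quad_covariance lee_fin in h.
  rewrite quad_covariance/=; apply: le_trans h; rewrite /s mulrAC ler_pdivrMr// -mulrA.
  rewrite ler_pM2l//; have e1 := enorm_le_normr (gauss_dual r).
  apply: (@le_trans _ _ ((n%:R * `|gauss_dual r|) ^+ 2)).
    by rewrite lerXn2r ?nnegrE ?mulr_ge0 ?enorm_ge0.
  by rewrite exprMn mulrC ler_wpM2l ?sqr_ge0// lerDl.
exists s^-1; first by rewrite invr_gt0.
exists s => // r; split => //.
have := H r; have := dot_le_enorm (gauss_dual r) r.
have := enorm_ge0 (gauss_dual r); rewrite le_eqVlt => /orP[/eqP <-|e0] h1 h2.
  by rewrite mulr_ge0 ?enorm_ge0// invr_ge0 ltW.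
rewrite ler_pdivlMl// -(ler_pM2r e0) -mulrA -expr2 [leRHS]mulrC.
exact: le_trans h2 h1.
Qed.

(** The dual vector of [r] is of the order of [r] and the quadratic form at
    it of the order of its square, so the cubic error in [Phi_ge_gauss] is
    of lower order. *)
Lemma Phi_gauss_asymp : asymp (0 : 'rV[R]_n)^' (Phi a)
  (fun r => 2^-1 * dot (r *m (invmx (covariance_mx a))^T) r).
Proof.
have [K K0 [s s0 H]] := gauss_dual_bounds.
apply: asympP => eps eps0.
pose del := Num.min (G / K) (s * eps / (2 * (C + 1) * K)).
have C1 : 0 < C + 1 by rewrite ltr_wpDl.
have del0 : 0 < del by rewrite lt_min !divr_gt0// !mulr_gt0.
have n1 : 0 < n%:R + 1 :> R by rewrite ltr_wpDl.
near=> r; rewrite -/(gauss_dual r).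
have rn : r != 0 by near: r; exact: nbhs_dnbhs_neq.
have [hK hs] := H r.
have gn : gauss_dual r != 0.
  by apply: contra_neq rn => E; rewrite -(gauss_dualK r) E mul0mx.
have g0 : 0 < enorm (gauss_dual r) by rewrite enorm_gt0.
have rd : enorm r < del.
  apply: le_lt_trans (enorm_le_normr _) _.
  apply: (@le_lt_trans _ _ ((n%:R + 1) * `|r|)); first by rewrite ler_wpM2r// lerDl.
  rewrite -ltr_pdivlMl//; near: r.
  apply/nbhs_dnbhs/nbhs_ballP; exists ((n%:R + 1)^-1 * del) => /=; first by rewrite mulr_gt0// invr_gt0.
  by move=> y; rewrite -ball_normE/= sub0r normrN.
move: rd; rewrite lt_min => /andP[rd1 rd2].
have gG : enorm (gauss_dual r) <= G.
  by apply: le_trans hK _; rewrite mulrC -ler_pdivlMr// ltW.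
have q0 : 0 < dot (gauss_dual r) r.
  by apply: lt_le_trans hs; rewrite mulr_gt0// exprn_gt0.
split; first by rewrite mulr_gt0.
have h1 := Phi_le_gauss r; have h2 := Phi_ge_gauss gG.
have h3 : C * enorm (gauss_dual r) ^+ 3 <= eps * (2^-1 * dot (gauss_dual r) r).
  apply: (@le_trans _ _ (eps * (2^-1 * (s * enorm (gauss_dual r) ^+ 2)))); last first.
    by rewrite ler_pM2l// ler_pM2l.
  have h4 : C * enorm (gauss_dual r) <= eps * (2^-1 * s).
    apply: (@le_trans _ _ ((C + 1) * (K * enorm r))).
      by apply: ler_pM; rewrite ?enorm_ge0// lerDl.
    have := ltW rd2; rewrite ler_pdivlMr ?mulr_gt0//.
    by move: (enorm r) => u; lra.
  have := ler_wpM2r (sqr_ge0 (enorm (gauss_dual r))) h4.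
  by congr (_ <= _); ring.
have h5 : 0 <= eps * (2^-1 * dot (gauss_dual r) r) by rewrite !mulr_ge0// ltW.
rewrite ler_norml; move: h1 h2 h3 h5.
move: (dot (gauss_dual r) r) (Phi a r) (enorm (gauss_dual r) ^+ 3) => A B D *.
by apply/andP; split; lra.
Unshelve. all: by end_near. Qed.

(** A small multiple of [r] itself is a good enough test point: the gain [e
    |r|^2] is linear in [e] and the loss quadratic. *)
Lemma Phi_gt0 r : r != 0 -> 0 < Phi a r.
Proof.
move=> rn; have r0 : 0 < enorm r by rewrite enorm_gt0.
have q0 : 0 <= fine (quad f r) by apply: fine_ge0; apply: wint_ge0 => // x; exact: sqr_ge0.
pose D := fine (quad f r) + C * enorm r ^+ 3 + 1.
have D0 : 0 < D by rewrite ltr_wpDl// addr_ge0// mulr_ge0// exprn_ge0// ltW.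
pose e := Num.min 1 (Num.min (G / enorm r) (enorm r ^+ 2 / D)).
have e0 : 0 < e by rewrite !lt_min ltr01 !divr_gt0// exprn_gt0.
have [e1 e2 e3] : [/\ e <= 1, e <= G / enorm r & e <= enorm r ^+ 2 / D].
  by split; rewrite /e !ge_min lexx ?orbT.
have hG : enorm (e *: r) <= G by rewrite enormZ gtr0_norm// -ler_pdivlMr.
have [dg hl] := third hG.
have := Phi_ge r dg; apply: lt_le_trans.
move: hl; rewrite quadZ quad_covariance -EFinM/= -[dot (_ *m _) _]/(fine (dot (r *m covariance_mx a) r)%:E).
rewrite -quad_covariance dotZl -sqr_enorm enormZ gtr0_norm// exprMn.
have h4 : e * D <= enorm r ^+ 2 by rewrite -ler_pdivlMr.
have h5 : e ^+ 2 * fine (quad f r) + C * (e ^+ 3 * enorm r ^+ 3) + e ^+ 2 <= e ^+ 2 * D.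
  rewrite /D !mulrDr mulr1 lerD2r lerD2l mulrCA ler_wpM2r//.
    by rewrite mulr_ge0// exprn_ge0// ltW.
  by rewrite exprS ler_piMl// ?sqr_ge0.
have h6 : e ^+ 2 * D <= e * enorm r ^+ 2 by rewrite expr2 -mulrA ler_pM2l.
have h7 : 0 < e ^+ 2 by rewrite exprn_gt0.
have h8 : 0 < e * enorm r ^+ 2 by rewrite mulr_gt0// exprn_gt0.
move: h5 h6 h7 h8; move: (e ^+ 2 * D) (e * enorm r ^+ 2) (C * _) (lam _) (e ^+ 2 * _) => A1 A2 A3 A4 A5.
lra.
Qed.

End expansion.

End finite_second_moment.

(** Tested at the multiple of [r] of norm [G]. *)
Lemma Phi_ge_linear (G M : R) : 0 <= G ->
  (forall g, enorm g <= G -> dom g /\ lam g <= M) ->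
  forall r, G * enorm r - M <= Phi a r.
Proof.
move=> G0 H r.
have [->|rn] := eqVneq r 0.
  have := H 0; rewrite enorm0 => /(_ G0) [_]; rewrite Phi_zero mulr0 (lam0 mf f0 fI).
  lra.
have r0 : 0 < enorm r by rewrite enorm_gt0.
pose g := (G / enorm r) *: r.
have gG : enorm g <= G by rewrite enormZ ger0_norm ?divr_ge0 ?(ltW r0)// divfK// gt_eqF.
have [dg gM] := H _ gG.
have := Phi_ge r dg; have -> : dot g r = G * enorm r.
  by rewrite dotZl -sqr_enorm expr2 mulrA divfK// gt_eqF.
lra.
Qed.

Lemma Phi_le_radius (b : R) : (forall g, dom g -> enorm g <= b) ->
  forall r, Phi a r <= b * enorm r.
Proof.
move=> H r; have [g [dg _] ->] := Phi_dual r.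
have h1 := dot_le_enorm g r; have h2 := lam_ge1 mf f0 fE fI dg.
have : enorm g * enorm r <= b * enorm r by rewrite ler_wpM2r ?enorm_ge0// H.
lra.
Qed.

End duality_instance.

(** * The rate at infinity *)

Lemma le_expR_scaled (R : realType) (k t : R) : 0 < k -> 2 / k ^+ 2 < t -> t <= expR (k * t).
Proof.
move=> k0 h; have k2 : 0 < k ^+ 2 by rewrite exprn_gt0.
have t0 : 0 < t by apply: le_lt_trans h; rewrite divr_ge0// ltW.
have kt0 : 0 <= k * t by rewrite mulr_ge0// ltW.
apply: le_trans (expR_ge1Dx2 kt0).
have h2 : 2 < t * k ^+ 2 by rewrite -ltr_pdivrMr.
have h3 : 2 * t <= (k * t) ^+ 2.
  by have := ler_wpM2r (ltW t0) (ltW h2); congr (_ <= _); ring.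
lra.
Qed.

Section far_field.
Context {R : realType} {n : nat}.
Notation beta := (@borel_lebesgue R n).
Variables a f : 'rV[R]_n -> R.
Implicit Types (h : 'rV[R]_n -> R) (g r x w : 'rV[R]_n) (c : R).
Hypothesis mf : measurable_fun setT f.
Hypothesis f0 : forall x, 0 <= f x.
Hypothesis fE : forall x, f (- x) = f x.
Hypothesis fI : (\int[beta]_x (f x)%:E = 1)%E.

Notation dom := (dom f).
Notation lam := (lam f).

Lemma near_infty (M : R) : \forall r \near @rV_infty R n, M < enorm r.
Proof. by exists M. Qed.

Lemma near_infty_ln (M : R) : \forall r \near @rV_infty R n, 1 < enorm r /\ M < ln (enorm r).
Proof.
exists (Num.max 1 (expR M)) => // r /=; rewrite gt_max => /andP[r1 rM].
by split => //; rewrite -ltr_expR lnK// posrE (lt_trans ltr01).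
Qed.

Section phi_duality.
Hypothesis Phi_dual : forall r, exists2 g, is_maxL dom lam r g & Phi a r = dot g r - lam g + 1.
Hypothesis Phi_ge : forall r g, dom g -> dot g r - lam g + 1 <= Phi a r.

Lemma Phi_ge_radial r (s : R) : r != 0 -> 0 <= s -> dom ((s / enorm r) *: r) ->
  s * enorm r - lam ((s / enorm r) *: r) <= Phi a r.
Proof.
move=> rn s0 dg; have r0 : 0 < enorm r by rewrite enorm_gt0.
have := Phi_ge r dg; rewrite dotZl -sqr_enorm expr2 mulrA divfK ?gt_eqF//.
lra.
Qed.

Lemma enorm_radial r (s : R) : r != 0 -> 0 <= s -> enorm ((s / enorm r) *: r) = s.
Proof.
move=> rn s0; have r0 : 0 < enorm r by rewrite enorm_gt0.
by rewrite enormZ ger0_norm ?divr_ge0 ?(ltW r0)// divfK// gt_eqF.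
Qed.

(** Inverting [u |-> c u^q] with the conjugate exponent [q = p / (p - 1)]
    turns the constant [c] of the growth condition into that of the
    conclusion. *)
Lemma superlinear_const (p b : R) : 1 < p -> 0 < b ->
  ((p - 1) / p * (b * p) `^ (- (p - 1)^-1)) `^ (- (p / (p - 1))^-1) =
  p / (p - 1) * (b * (p - 1)) `^ p^-1.
Proof.
move=> p1 b0; have p0 : 0 < p by lra.
have p10 : 0 < p - 1 by lra.
have c0 : 0 < (p - 1) / p by rewrite divr_gt0.
have bp0 : 0 < b * p by rewrite mulr_gt0.
have pn : p != 0 by rewrite gt_eqF.
have p1n : p - 1 != 0 by rewrite gt_eqF.
rewrite powRM ?(ltW c0) ?powR_ge0// -powRrM.
have -> : - (p - 1)^-1 * - (p / (p - 1))^-1 = p^-1 by field; rewrite pn p1n.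
have -> : - (p / (p - 1))^-1 = - 1 + p^-1 by field; rewrite pn p1n.
rewrite powRD; last by rewrite (gt_eqF c0) implybT.
rewrite (powR_inv1 (ltW c0)) -mulrA -powRM ?(ltW c0) ?(ltW bp0)// invf_div.
by congr (_ * _ `^ _); field.
Qed.

Section superlinear.
Variables (q c : R).
Hypothesis q_gt1 : 1 < q.
Hypothesis c_gt0 : 0 < c.
Hypothesis domT : forall g, dom g.
Hypothesis lamE : forall del, 0 < del -> exists2 S, 1 <= S & forall g, S < enorm g ->
  expR (c * enorm g `^ q * (1 - del)) <= lam g <= expR (c * enorm g `^ q * (1 + del)).

Let q0 : 0 < q. Proof. exact: lt_trans q_gt1. Qed.
Let qn : q != 0. Proof. by rewrite gt_eqF. Qed.

Lemma powR_qK (z : R) : 0 <= z -> (z `^ q^-1) `^ q = z.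
Proof. by move=> z0; rewrite -powRrM mulVf// powRr1. Qed.

Lemma lt_powR_q (z w : R) : 0 <= z -> 0 <= w -> (z < w `^ q^-1) = (z `^ q < w).
Proof.
move=> z0 w0; rewrite -{2}(powR_qK w0); apply/idP/idP => h.
  by apply: gt0_ltr_powR => //; rewrite nnegrE ?powR_ge0.
rewrite ltNge; apply: contraTN h => h; rewrite -leNgt.
by apply: ge0_ler_powR => //; rewrite ?nnegrE ?powR_ge0// ltW.
Qed.

Let T (u : R) := c `^ (- q^-1) * u * ln u `^ q^-1.

(** Tested at norm [s] with [c (1 + del) s^q = ln |r|], which makes [lam] at
    most [|r|], of lower order than [s |r|]. *)
Lemma Phi_super_lower eps : 0 < eps -> \forall r \near rV_infty,
  (1 - eps) * T (enorm r) <= Phi a r.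
Proof.
move=> eps0; pose del := eps / 2; have del0 : 0 < del by rewrite divr_gt0.
have [S S1 HS] := lamE del0.
pose K := c `^ (- q^-1); have K0 : 0 < K by rewrite powR_gt0.
have cd : 0 < c * (1 + del) by rewrite mulr_gt0// addr_gt0.
near=> r.
have [u1 lu1] : 1 < enorm r /\ S `^ q * (c * (1 + del)) < ln (enorm r).
  by near: r; exact: near_infty_ln.
have [_ lu2] : 1 < enorm r /\ (2 / eps / K) `^ q < ln (enorm r).
  by near: r; exact: near_infty_ln.
set u := enorm r in u1 lu1 lu2 *.
have u0 : 0 < u by apply: lt_trans u1.
have rn : r != 0 by rewrite -enorm_gt0.
have l0 : 0 <= ln u by rewrite ln_ge0// ltW.
have z0 : 0 <= ln u / (c * (1 + del)) by rewrite divr_ge0// ltW.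
pose s := (ln u / (c * (1 + del))) `^ q^-1.
have s0 : 0 <= s by exact: powR_ge0.
have Ss : S < s by rewrite lt_powR_q// ?(le_trans ler01)// ltr_pdivlMr.
have := Phi_ge_radial rn s0 (domT _).
have := HS ((s / u) *: r); rewrite (enorm_radial rn s0) => /(_ Ss) /andP[_].
rewrite [X in expR X](_ : _ = ln u); last first.
  by rewrite powR_qK// mulrAC mulrC divfK// gt_eqF.
rewrite lnK ?posrE// -/u.
have sE : s = K * ln u `^ q^-1 * (1 + del) `^ (- q^-1).
  rewrite /s powRM ?invr_ge0 ?(ltW cd)// -(powR_inv1 (ltW cd)) -powRrM mulN1r.
  rewrite powRM ?(ltW c_gt0)//; last by rewrite addr_ge0// ltW.
  by rewrite /K; ring.
have d1 : 1 - del <= (1 + del) `^ (- q^-1).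
  apply: (@le_trans _ _ (1 + del)^-1).
    by rewrite -[leRHS]mul1r ler_pdivlMr ?addr_gt0//; nra.
  rewrite powRN lef_pV2 ?posrE ?powR_gt0 ?addr_gt0//.
  by apply: ler1_powR; [lra|rewrite invf_le1// ltW].
have h2 : 2 / eps < K * ln u `^ q^-1.
  rewrite -ltr_pdivrMl// mulrC lt_powR_q//.
  by rewrite !divr_ge0// ltW.
have h3 : K * ln u `^ q^-1 * (1 - del) <= s.
  by rewrite sE ler_wpM2l// mulr_ge0 ?powR_ge0// ltW.
have h4 : 1 < eps / 2 * (K * ln u `^ q^-1).
  by rewrite -ltr_pdivrMl ?divr_gt0// mulr1 invf_div.
rewrite /T -/K mulrAC; move: h3 h4; rewrite /del.
move: (K * ln u `^ _) => W h3 h4 h5 h6.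
have h7 : (W * (1 - eps / 2)) * u <= s * u by rewrite ler_pM2r.
have h8 : 1 * u <= eps / 2 * W * u by rewrite ler_pM2r// ltW.
lra.
Unshelve. all: by end_near. Qed.

(** Let [s] solve [c (1 - del) s^q = (1 + del) ln |r|]. A maximizer of norm
    at most [s] gives at most [s |r|]. For a larger norm [t] the value is at
    most one: [lam] is then at least [|r|] times an exponential of [t^q],
    which exceeds [t |r|]. *)
Lemma Phi_super_upper eps : 0 < eps -> \forall r \near rV_infty,
  Phi a r <= (1 + eps) * T (enorm r).
Proof.
(* chosen so that [(1 + del) / (1 - del) = 1 + eps] *)
move=> eps0; pose del := eps / (2 + eps).
have e2 : 0 < 2 + eps by rewrite addr_gt0.
have del0 : 0 < del by rewrite divr_gt0.
have del1 : 0 < 1 - del.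
  by rewrite subr_gt0 ltr_pdivrMr//; lra.
have del2 : 0 < 1 + del by rewrite addr_gt0.
have delE : (1 + del) / (1 - del) <= 1 + eps.
  rewrite ler_pdivrMr//.
  have : del * (2 + eps) = eps by rewrite divfK// gt_eqF.
  lra.
have [S S1 HS] := lamE del0.
have S0 : 0 <= S by apply: le_trans S1.
pose K := c `^ (- q^-1); have K0 : 0 < K by rewrite powR_gt0.
pose k2 := c * (1 - del) * (del / (1 + del)).
have k20 : 0 < k2 by rewrite !mulr_gt0// invr_gt0.
pose S2 := Num.max S (2 / k2 ^+ 2).
have S20 : 0 <= S2 by rewrite le_max S0.
have cd : 0 < c * (1 - del) by rewrite mulr_gt0.
near=> r.
have [u1 lu1] : 1 < enorm r /\ S2 `^ q * (c * (1 - del)) < ln (enorm r).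
  by near: r; exact: near_infty_ln.
set u := enorm r in u1 lu1 *.
have u0 : 0 < u by apply: lt_trans u1.
have l0 : 0 <= ln u by rewrite ln_ge0// ltW.
have z0 : 0 <= (1 + del) * ln u / (c * (1 - del)).
  by rewrite divr_ge0 ?(ltW cd)// mulr_ge0// ltW.
pose s := ((1 + del) * ln u / (c * (1 - del))) `^ q^-1.
have s0 : 0 <= s by exact: powR_ge0.
have Ss : S2 < s.
  rewrite lt_powR_q// ltr_pdivlMr//; apply: lt_le_trans lu1 _.
  by rewrite ler_peMl//; lra.
have S2s : 1 <= s.
  by apply: le_trans S1 _; apply: le_trans (ltW Ss); rewrite le_max lexx.
have sT : s * u <= (1 + eps) * T u.
  have -> : s = K * ln u `^ q^-1 * ((1 + del) / (1 - del)) `^ q^-1.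
    rewrite /s (_ : _ / _ = c^-1 * (ln u * ((1 + del) / (1 - del)))); last first.
      by field; rewrite !gt_eqF.
    rewrite powRM ?invr_ge0 ?(ltW c_gt0)//; last first.
      by rewrite mulr_ge0// divr_ge0// ltW.
    rewrite -(powR_inv1 (ltW c_gt0)) -powRrM mulN1r powRM//; last first.
      by rewrite divr_ge0// ltW.
    by rewrite mulrA.
  have h : ((1 + del) / (1 - del)) `^ q^-1 <= 1 + eps.
    apply: le_trans delE; apply: ler1_powR.
      by rewrite ler_pdivlMr//; lra.
    by rewrite invf_le1// ltW.
  have W0 : 0 <= K * ln u `^ q^-1 * u by rewrite !mulr_ge0 ?powR_ge0// ltW.
  have := ler_wpM2l W0 h; rewrite /T -/K.
  by congr (_ <= _); ring.
have [g _ ->] := Phi_dual r.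
have gr := dot_le_enorm g r; rewrite -/u in gr.
have lg1 := lam_ge1 mf f0 fE fI (domT g).
have [gs|gs] := leP (enorm g) s.
  have : enorm g * u <= s * u by rewrite ler_pM2r.
  lra.
apply: le_trans sT; have su : 1 <= s * u by rewrite -[leLHS]mulr1 ler_pM// ltW.
suff : enorm g * u <= lam g by lra.
set t := enorm g in gs gr *.
have t0 : 0 < t by apply: le_lt_trans gs.
have t1 : 1 <= t by apply: le_trans S2s (ltW gs).
have tS : S < t.
  by apply: le_lt_trans (lt_trans Ss gs); rewrite le_max lexx.
have tk : 2 / k2 ^+ 2 < t.
  by apply: le_lt_trans (lt_trans Ss gs); rewrite le_max lexx orbT.
have /andP[hl _] := HS g tS; apply: le_trans hl; rewrite -/t.
pose y := c * (1 - del) * t `^ q.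
have y1 : ln u <= y / (1 + del).
  have : s `^ q <= t `^ q.
    by apply: ge0_ler_powR; rewrite ?nnegrE ?(ltW q0) ?(ltW t0) ?(ltW gs).
  rewrite powR_qK// ler_pdivrMr// => h.
  by rewrite ler_pdivlMr// mulrC /y [leRHS]mulrC.
have y2 : k2 * t <= y * (del / (1 + del)).
  rewrite (_ : y * _ = k2 * t `^ q); last by rewrite /y /k2; ring.
  by rewrite ler_pM2l// le1r_powR// ltW.
rewrite (_ : c * _ * _ = y / (1 + del) + y * (del / (1 + del))); last first.
  by rewrite /y; field; rewrite gt_eqF.
rewrite expRD mulrC ler_pM// ?(ltW u0) ?(ltW t0)//.
  by rewrite -[leLHS]lnK ?posrE// ler_expR.
apply: (@le_trans _ _ (expR (k2 * t))); last by rewrite ler_expR.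
exact: le_expR_scaled.
Unshelve. all: by end_near. Qed.

Lemma Phi_super_asymp : asymp rV_infty (Phi a)
  (fun r => c `^ (- q^-1) * enorm r * ln (enorm r) `^ q^-1).
Proof.
apply: asympP => eps eps0; near=> r.
have [u1 l1] : 1 < enorm r /\ 0 < ln (enorm r) by near: r; exact: near_infty_ln.
have u0 : 0 < enorm r by apply: lt_trans u1.
have T0 : 0 < T (enorm r) by rewrite !mulr_gt0// powR_gt0.
split => //; rewrite -/(T (enorm r)).
have h1 : (1 - eps) * T (enorm r) <= Phi a r by near: r; exact: Phi_super_lower.
have h2 : Phi a r <= (1 + eps) * T (enorm r) by near: r; exact: Phi_super_upper.
by move: (T _) T0 h1 h2 => W *; rewrite ler_norml; apply/andP; split; lra.
Unshelve. all: by end_near. Qed.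

End superlinear.

Section bounded_support.
Variable m : R.
Hypothesis m_gt0 : 0 < m.
Hypothesis f_supp : forall x, m <= enorm x -> f x = 0.

(** As [f] vanishes on the sphere of radius [m], its mass is exhausted by
    smaller balls. *)
Lemma mass_near_boundary (eta : R) : 0 < eta -> exists2 del, 0 < del &
  (wint f (\1_[set x : 'rV[R]_n | (m - del < enorm x)%R]) <= eta%:E)%E.
Proof.
move=> eta0.
pose A (k : nat) := [set x : 'rV[R]_n | enorm x <= m - k.+1%:R^-1].
have mA k : measurable (A k).
  rewrite -[X in measurable X]setTI.
  have -> : setT `&` A k = setT `&` (@enorm R n) @^-1` `]-oo, m - k.+1%:R^-1].
    by apply/seteqP; split => x /=; rewrite in_itv.
  exact: measurable_enorm.
have mB k : measurable_fun setT (\1_(A k) : 'rV[R]_n -> R) by exact: measurable_indic.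
have mC k : measurable_fun setT (\1_(~` A k) : 'rV[R]_n -> R).
  by apply: measurable_indic; exact: measurableC.
have [k hk] : exists k, ((1 - eta)%:E < wint f (\1_(A k)))%E.
  apply: contrapT => /forallNP H.
  pose u (k : nat) x := (\1_(A k) x * f x)%:E.
  have mu_ (k : nat) : measurable_fun setT (u k) by exact: wint_measurable.
  have u0 (k : nat) x : setT x -> (0 <= u k x)%E by move=> _; rewrite lee_fin mulr_ge0.
  have nd x : setT x -> {homo u ^~ x : i j / (i <= j)%N >-> (i <= j)%E}.
    move=> _ i j ij; rewrite lee_fin ler_wpM2r// !indicE ler_nat.
    case: (boolP (x \in A i)) => //; rewrite inE /A/= => xi.
    rewrite mem_set//=; apply: le_trans xi _.
    by rewrite lerD2l lerN2 lef_pV2 ?posrE// ler_nat.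
  have cv := @cvg_monotone_convergence _ _ _ beta setT measurableT u mu_ u0 nd.
  have E : (\int[beta]_x limn (u ^~ x) = 1)%E.
    rewrite -fI; apply: eq_integral => x _; apply/cvg_lim => //.
    have [mx|mx] := leP m (enorm x).
      rewrite f_supp//; apply: (@cvg_near_cst); apply: nearW => k.
      by rewrite /u f_supp// mulr0.
    have mx0 : 0 < m - enorm x by rewrite subr_gt0.
    apply: (@cvg_near_cst).
    exists (Num.truncn (m - enorm x)^-1).+1 => // k /= xk.
    rewrite /u indicE mem_set ?mul1r//= /A/=.
    have : k.+1%:R^-1 <= m - enorm x.
      rewrite -[leRHS]invrK lef_pV2 ?posrE ?invr_gt0//.
      by apply: le_trans (ltW (truncnS_gt _)) _; rewrite ler_nat ltnW.
    by rewrite lerBrDr addrC -lerBrDr.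
  move: cv; rewrite E => cv.
  have : (1 <= (1 - eta)%:E)%E.
    have /cvg_lim <- := cv => //.
    apply: lime_le; first by apply/cvg_ex; exists 1%E.
    by apply: nearW => k; rewrite leNgt; apply/negP; exact: H.
  by rewrite lee_fin; lra.
exists k.+1%:R^-1; first by rewrite invr_gt0.
have i0 (B : set 'rV[R]_n) x : 0 <= \1_B x :> R by rewrite indicE.
have : (wint f (\1_(A k)) + wint f (\1_(~` A k)) = 1)%E.
  rewrite -(wintD mf f0 (mB k) (mC k) (i0 _) (i0 _)) -(wint_cst mf f0 fI ler01).
  apply: eq_wint => x; rewrite !indicE in_setC.
  by case: (x \in A k); rewrite ?addr0 ?add0r.
have -> : [set x : 'rV[R]_n | (m - k.+1%:R^-1 < enorm x)%R] = ~` A k.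
  by apply/seteqP; split => x; rewrite /A/=; [rewrite ltNge => /negP|move=> /negP; rewrite -ltNge].
move: hk; have := wint_ge0 f0 (i0 (A k)); have := wint_ge0 f0 (i0 (~` A k)).
case: (wint f _) => [w2| |]//; case: (wint f _) => [w1| |]//.
rewrite lte_fin -EFinD => _ _ h1 [] h2; rewrite lee_fin.
lra.
Qed.

Lemma lam_support_le (del eta : R) : 0 < del -> 0 <= eta ->
  (wint f (\1_[set x : 'rV[R]_n | (m - del < enorm x)%R]) <= eta%:E)%E ->
  forall g, dom g /\ lam g <= expR ((m - del) * enorm g) + expR (m * enorm g) * eta.
Proof.
move=> del0 eta0 H g; apply: dom_le => //.
set B := [set x | _] in H.
have mB : measurable B.
  rewrite -[X in measurable X]setTI.
  have -> : setT `&` B = setT `&` (@enorm R n) @^-1` `]m - del, +oo[.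
    by apply/seteqP; split => x /=; rewrite in_itv/= andbT.
  exact: measurable_enorm.
have i0 x : 0 <= \1_B x :> R by rewrite indicE.
have mi : measurable_fun setT (\1_B : 'rV[R]_n -> R) by exact: measurable_indic.
have e0 := expR_ge0 (m * enorm g).
apply: (@le_trans _ _ (wint f (fun x => (expR ((m - del) * enorm g) + expR (m * enorm g) * \1_B x)%R))).
  have mk : measurable_fun setT (fun x : 'rV[R]_n =>
      expR ((m - del) * enorm g) + expR (m * enorm g) * \1_B x).
    by apply: measurable_funD => //; exact: measurable_funM.
  apply: ge0_le_integral => //.
  - by move=> x _; rewrite lee_fin mulr_ge0// expR_ge0.
  - by apply: wint_measurable => //; exact: measurable_expR_dot.
  - exact: wint_measurable.
  - move=> x _; rewrite lee_fin.
    have [mx|mx] := leP m (enorm x); first by rewrite f_supp// !mulr0.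
    rewrite ler_wpM2r//; have gx := dot_le_enorm g x.
    have := enorm_ge0 g; move: gx; move: (enorm g) => G gx G0.
    rewrite indicE; case: (boolP (x \in B)).
      move=> _; rewrite mulr1; apply: (@le_trans _ _ (expR (m * G))).
        rewrite ler_expR; apply: le_trans gx _; rewrite mulrC ler_wpM2r// ltW//.
      by rewrite lerDr expR_ge0.
    rewrite notin_setE /B/= => /negP; rewrite -leNgt => xm.
    rewrite mulr0 addr0 ler_expR; apply: le_trans gx _.
    by rewrite mulrC ler_wpM2r.
have mk : measurable_fun setT (fun x : 'rV[R]_n => expR (m * enorm g) * \1_B x).
  exact: measurable_funM.
rewrite (wintD mf f0 (measurable_cst _) mk (fun=> expR_ge0 _) (fun x => mulr_ge0 e0 (i0 x))).
rewrite (wint_cst mf f0 fI (expR_ge0 _)) wintZ// EFinD EFinM.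
by rewrite leeD2l// lee_wpmul2l.
Qed.

(** Tested at norm [s] with [m s = ln (2 |r|)]. The mass away from the
    boundary contributes a lower power of [|r|] to [lam], and the remaining
    mass [eta] at most [2 |r| eta]; together they are covered by the gain
    [|r| ln 2 / m] that the factor two provides. *)
Lemma Phi_ge_support : \forall r \near rV_infty,
  m^-1 * enorm r * ln (enorm r) <= Phi a r.
Proof.
have ln2 : 0 < ln (2 : R) by rewrite ln_gt0// ltr1n.
pose eta := ln 2 / (4 * m).
have eta0 : 0 < eta by rewrite divr_gt0// mulr_gt0.
have [del del0 H] := mass_near_boundary eta0.
have L := lam_support_le del0 (ltW eta0) H.
near=> r.
have [u1 l1] : 1 < enorm r /\ m / (del * eta) < ln (enorm r).
  by near: r; exact: near_infty_ln.
set u := enorm r in u1 l1 *.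
have u0 : 0 < u by apply: lt_trans u1.
have rn : r != 0 by rewrite -enorm_gt0.
pose s := (ln 2 + ln u) / m.
have lu0 : 0 < ln u by rewrite ln_gt0.
have s0 : 0 < s by rewrite divr_gt0// addr_gt0.
have ms : m * s = ln (2 * u).
  by rewrite lnM ?posrE// /s mulrC divfK// gt_eqF.
have [dg lg] := L ((s / u) *: r).
have := Phi_ge_radial rn (ltW s0) dg; apply: le_trans; rewrite -/u.
move: lg; rewrite (enorm_radial rn (ltW s0)) mulrBl expRB ms lnK ?posrE ?mulr_gt0//.
have ds : 1 / eta <= expR (del * s).
  apply: (@le_trans _ _ (del * s)); last first.
    by have := expR_ge1Dx (del * s); lra.
  have h1 : m < ln u * (del * eta) by rewrite -ltr_pdivrMr// mulr_gt0.
  have h2 : 0 < ln 2 * (del * eta) := mulr_gt0 ln2 (mulr_gt0 del0 eta0).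
  rewrite ler_pdivrMr// (_ : del * s * eta = (ln 2 * (del * eta) + ln u * (del * eta)) / m).
    by rewrite ler_pdivlMr//; lra.
  by rewrite /s; ring.
have h3 : 2 * u / expR (del * s) <= 2 * u * eta.
  rewrite ler_wpM2l ?mulr_ge0 ?(ltW u0)//.
  by rewrite -[leRHS]invrK lef_pV2 ?posrE ?expR_gt0 ?invr_gt0// -[leLHS]mul1r.
have h4 : 2 * u * eta * 2 = u * (ln 2 / m).
  by rewrite /eta; field; rewrite gt_eqF.
have h5 : s * u = m^-1 * u * ln u + u * (ln 2 / m).
  by rewrite /s; field; rewrite gt_eqF.
move: h3 h4 h5; move: (lam _) (_ / expR _) (s * u) => A B D.
lra.
Unshelve. all: by end_near. Qed.

End bounded_support.

End phi_duality.

End far_field.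

(** * Upper bound for the compound Poisson series *)

Section exponential_series.
Context {R : realType}.

Lemma exp_partial_le (y : R) (N : nat) : 0 <= y ->
  \sum_(0 <= k < N) y ^+ k / k`!%:R <= expR y.
Proof.
move=> y0; rewrite /expR.
have := @nondecreasing_cvgn_le R (series (exp_coeff y)) _ (is_cvg_series_exp_coeff y) N.
rewrite /series/=; apply.
apply/nondecreasing_seqP => k; rewrite /series/= big_nat_recr//= lerDl.
exact: exp_coeff_ge0.
Qed.

(** Comparison with the exponential series gives convergence, without which
    the sum would be meaningless, and the upper bound; every single term is
    a lower bound by nonnegativity. *)
Lemma series1_between (u : nat -> R) (B y : R) :
  0 <= B -> 0 <= y ->
  (forall k, (1 <= k)%N -> 0 <= u k <= B * (y ^+ k / k`!%:R)) ->
  \big[+%R/0]_(1 <= k <oo) u k <= B * expR y /\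
  forall N, (1 <= N)%N -> u N <= \big[+%R/0]_(1 <= k <oo) u k.
Proof.
move=> B0 y0 H.
pose S (N : nat) := \sum_(1 <= k < N) u k.
have ndS : nondecreasing_seq S.
  apply/nondecreasing_seqP => -[|k]; first by rewrite /S !big_geq.
  by rewrite /S [leRHS]big_nat_recr//= lerDl; have /andP[] := H k.+1 isT.
have ubS N : S N <= B * expR y.
  apply: (@le_trans _ _ (B * \sum_(0 <= k < N) y ^+ k / k`!%:R)); last first.
    by rewrite ler_wpM2l// exp_partial_le.
  case: N => [|N]; first by rewrite /S !big_geq// mulr0.
  rewrite big_nat_recl//= expr0 fact0 divr1 mulrDr mulr1.
  apply: (@le_trans _ _ (B * \sum_(0 <= k < N) y ^+ k.+1 / k.+1`!%:R)); last by rewrite lerDr.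
  rewrite /S big_add1/= mulr_sumr; apply: ler_sum => k _.
  by have /andP[] := H k.+1 isT.
have cvS : cvgn S.
  apply: nondecreasing_is_cvgn => //; exists (B * expR y) => _ [N _ <-]; exact: ubS.
split; first by apply: limr_le => //; apply: nearW.
move=> N N1; apply: le_trans (nondecreasing_cvgn_le ndS cvS N.+1).
rewrite /S big_nat_recr//= lerDr big_nat; apply: sumr_ge0 => k /andP[k1 _].
by have /andP[] := H k k1.
Qed.

End exponential_series.

Section convolution_upper.
Context {R : realType} {n : nat}.
Notation beta := (@borel_lebesgue R n).
Variable f : 'rV[R]_n -> R.
Implicit Types (h : 'rV[R]_n -> R) (g r x w : 'rV[R]_n) (c M : R).
Hypothesis mf : measurable_fun setT f.
Hypothesis f0 : forall x, 0 <= f x.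
Hypothesis fI : (\int[beta]_x (f x)%:E = 1)%E.

Notation dom := (dom f).
Notation lam := (lam f).
Notation T := (bconv f).

Lemma measurable_refl h x : measurable_fun setT h -> measurable_fun setT (fun z : 'rV[R]_n => h (x - z)%R).
Proof. by move=> mh; exact: (measurableT_comp mh (measurable_subl x)). Qed.

Lemma bconv_wint h x : measurable_fun setT h -> (forall x, 0 <= h x) ->
  T h x = fine (wint f (fun z : 'rV[R]_n => h (x - z)%R)).
Proof.
move=> mh h0; congr fine.
pose G z := (h (x - z) * f z)%:E.
have mG : measurable_fun setT G by apply: wint_measurable => //; exact: measurable_refl.
have G0 z : (0 <= G z)%E by rewrite lee_fin mulr_ge0.
rewrite -[RHS](integral_subl x mG G0); apply: eq_integral => y _.
by rewrite /G subKr mulrC.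
Qed.

Lemma wint_refl_le h M x : measurable_fun setT h -> (forall x, 0 <= h x) ->
  (forall x, h x <= M) -> (wint f (fun z : 'rV[R]_n => h (x - z)%R) <= M%:E)%E.
Proof.
move=> mh h0 hM; have M0 : 0 <= M by exact: le_trans (h0 0) (hM 0).
rewrite -(wint_cst mf f0 fI M0); apply: wint_le => //.
exact: measurable_refl.
Qed.

Lemma wint_refl_fin h M x : measurable_fun setT h -> (forall x, 0 <= h x) ->
  (forall x, h x <= M) -> wint f (fun z : 'rV[R]_n => h (x - z)%R) = (T h x)%:E.
Proof.
move=> mh h0 hM; rewrite bconv_wint// fineK// ge0_fin_numE; last by apply: wint_ge0.
by apply: le_lt_trans (wint_refl_le x mh h0 hM) _; rewrite ltry.
Qed.

Lemma bconv_le_cst h M x : measurable_fun setT h -> (forall x, 0 <= h x) ->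
  (forall x, h x <= M) -> T h x <= M.
Proof.
move=> mh h0 hM; rewrite -lee_fin -(wint_refl_fin x mh h0 hM); exact: wint_refl_le.
Qed.

(** The eigenfunction property of the exponentials. *)
Lemma wint_exp_refl g x :
  wint f (fun z : 'rV[R]_n => expR (- dot g (x - z)%R)%R) = ((expR (- dot g x))%:E * mgf f g)%E.
Proof.
rewrite -(wintZ mf f0 (measurable_expR_dot g) (expR_ge0 _) (fun x => expR_ge0 _)).
by apply: eq_wint => z; rewrite dotBr opprB addrC expRD.
Qed.

Lemma bconv_le_exp h M g x : measurable_fun setT h -> (forall x, 0 <= h x) ->
  0 <= M -> dom g -> (forall x, h x <= M * expR (- dot g x)) ->
  T h x <= M * lam g * expR (- dot g x).
Proof.
move=> mh h0 M0 dg hM; rewrite bconv_wint//.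
have mE : measurable_fun setT (fun z : 'rV[R]_n => expR (- dot g (x - z)%R)%R).
  exact: (measurable_refl x (measurable_expN g)).
have e0 z : 0 <= expR (- dot g (x - z)) by exact: expR_ge0.
have : (wint f (fun z : 'rV[R]_n => h (x - z)%R) <= (M * lam g * expR (- dot g x))%:E)%E.
  apply: (@le_trans _ _ (wint f (fun z : 'rV[R]_n => (M * expR (- dot g (x - z)))%R))).
    apply: wint_le => //; first exact: measurable_refl.
    by apply: measurable_funM.
  rewrite wintZ// wint_exp_refl (domE f0 dg) -!EFinM lee_fin.
  by rewrite le_eqVlt; apply/orP; left; apply/eqP; ring.
have : (0 <= wint f (fun z : 'rV[R]_n => h (x - z)%R))%E by exact: wint_ge0.
by case: (wint f _) => [z| |]//= _; rewrite lee_fin.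
Qed.

Lemma iter_bconv_ok k : measurable_fun setT (iter k T f) /\ forall x, 0 <= iter k T f x.
Proof.
elim: k => [|k [mk k0]]; first by split.
by split; [exact: measurable_bconv|move=> x; exact: bconv_ge0].
Qed.

Lemma iter_bconv_le_cst k C x : (forall x, f x <= C) -> iter k T f x <= C.
Proof.
move=> fC; elim: k x => [|k ih] x //=.
by have [mk k0] := iter_bconv_ok k; exact: bconv_le_cst.
Qed.

Lemma iter_bconv_le_exp k M g x : dom g -> 0 <= M -> 0 <= lam g ->
  (forall x, f x <= M * expR (- dot g x)) ->
  iter k T f x <= M * lam g ^+ k * expR (- dot g x).
Proof.
move=> dg M0 l0 fM; elim: k x => [|k ih] x; first by rewrite expr0 mulr1.
have [mk k0] := iter_bconv_ok k.
rewrite exprSr mulrA; apply: bconv_le_exp => //.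
by rewrite mulr_ge0// exprn_ge0.
Qed.

End convolution_upper.

Section compound_upper.
Context {R : realType} {n : nat}.
Variables a f : 'rV[R]_n -> R.
Implicit Types (x g : 'rV[R]_n) (t M : R).
Hypothesis mf : measurable_fun setT f.
Hypothesis f0 : forall x, 0 <= f x.
Hypothesis fE : forall x, f (- x) = f x.
Hypothesis fI : (\int[@borel_lebesgue R n]_x (f x)%:E = 1)%E.
Hypothesis fa : forall x, 0 <= f x <= a x.
Hypothesis powE : forall k, conv_pow a k.+2 = iter k.+1 (bconv f) f.

Lemma conv_pow_ge0 k x : 0 <= conv_pow a k x.
Proof.
case: k => [|[|k]]; try by have /andP[/le_trans] := fa x; apply.
by rewrite powE; have [_] := iter_bconv_ok mf f0 k.+1; apply.
Qed.

(** The exponential bound on [a] gains a factor [lam g] with each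
    convolution, so the series is dominated by the exponential series at
    [lam g * t]. *)
Lemma v_between x t M g : 0 <= t -> 0 <= M -> dom f g ->
  (forall x, a x <= M * expR (- dot g x)) ->
  v a x t <= M * expR (- (dot g x - lam f g * t + t)) /\
  forall N, (1 <= N)%N -> expR (- t) * (t ^+ N * conv_pow a N x / N`!%:R) <= v a x t.
Proof.
move=> t0 M0 dg aM; have l1 := lam_ge1 mf f0 fE fI dg.
have l0 : 0 <= lam f g by apply: le_trans l1.
have B0 : 0 <= M * expR (- dot g x) by rewrite mulr_ge0 ?expR_ge0.
have fM y : f y <= M * expR (- dot g y) by have /andP[_] := fa y; move/le_trans; apply.
have cM k : (1 <= k)%N -> conv_pow a k x <= M * expR (- dot g x) * lam f g ^+ k.
  case: k => [//|[|k]] _.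
    (* the first power lacks a convolution; [1 <= lam g] compensates *)
    by apply: le_trans (aM x) _; rewrite expr1 ler_peMr.
  have h := iter_bconv_le_exp mf f0 k.+1 x dg M0 l0 fM.
  rewrite powE; apply: le_trans h _.
  by rewrite mulrAC ler_wpM2l// [leRHS]exprS ler_peMl// exprn_ge0.
have H k : (1 <= k)%N -> 0 <= t ^+ k * conv_pow a k x / k`!%:R <=
    M * expR (- dot g x) * ((lam f g * t) ^+ k / k`!%:R).
  move=> k1; rewrite !mulr_ge0 ?exprn_ge0 ?conv_pow_ge0//= mulrA.
  rewrite ler_wpM2r// exprMn mulrA mulrC ler_wpM2r ?exprn_ge0//; exact: cM.
have [h1 h2] := series1_between B0 (mulr_ge0 l0 t0) H.
split; last first.
  by move=> N N1; rewrite /v ler_wpM2l ?expR_ge0//; exact: h2.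
rewrite /v; apply: le_trans (ler_wpM2l (expR_ge0 _) h1) _.
rewrite (_ : - (dot g x - lam f g * t + t) = - t + - dot g x + lam f g * t); last by ring.
by rewrite !expRD le_eqVlt; apply/orP; left; apply/eqP; ring.
Qed.

End compound_upper.

(** * Lower bound for the convolution powers *)

Section convolution_lower.
Context {R : realType} {n : nat}.
Notation beta := (@borel_lebesgue R n).
Variable f : 'rV[R]_n -> R.
Implicit Types (h : 'rV[R]_n -> R) (g r x w : 'rV[R]_n) (c M : R).
Hypothesis mf : measurable_fun setT f.
Hypothesis f0 : forall x, 0 <= f x.
Hypothesis fE : forall x, f (- x) = f x.
Hypothesis fI : (\int[beta]_x (f x)%:E = 1)%E.
Variable C : R.
Hypothesis fC : forall x, f x <= C.

Notation dom := (dom f).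
Notation lam := (lam f).
Notation T := (bconv f).

Let C0 : 0 <= C. Proof. exact: le_trans (f0 0) (fC 0). Qed.

Lemma bconvE h M x : measurable_fun setT h -> (forall x, 0 <= h x) ->
  (forall x, h x <= M) ->
  (T h x)%:E = (\int[beta]_y (f (x - y)%R * h y)%:E)%E.
Proof.
move=> mh h0 hM; rewrite /bconv fineK// ge0_fin_numE; last first.
  by apply: integral_ge0 => y _; rewrite lee_fin mulr_ge0.
have := wint_refl_le mf f0 fI x mh h0 hM => H.
apply: (@le_lt_trans _ _ M%:E); last by rewrite ltry.
apply: le_trans H.
pose G (z : 'rV[R]_n) := (h (x - z) * f z)%:E.
have mG : measurable_fun setT G by apply: wint_measurable => //; exact: measurable_refl.
have G0 z : (0 <= G z)%E by rewrite lee_fin mulr_ge0.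
rewrite -[leRHS](integral_subl x mG G0) le_eqVlt; apply/orP; left; apply/eqP.
by apply: eq_integral => y _; rewrite /G subKr mulrC.
Qed.

(** Tonelli, followed by a reflection in the inner variable. *)
Lemma bconvA h M x : measurable_fun setT h -> (forall x, 0 <= h x) ->
  (forall x, h x <= M) ->
  (T (T h) x)%:E = (\int[beta]_y (T f (x - y)%R * h y)%:E)%E.
Proof.
move=> mh h0 hM.
have mTh : measurable_fun setT (T h) by exact: measurable_bconv.
have Th0 y : 0 <= T h y by exact: bconv_ge0.
have ThM y : T h y <= M by exact: (bconv_le_cst mf f0 fI).
rewrite (bconvE x mTh Th0 ThM).
pose F (z : 'rV[R]_n * 'rV[R]_n) := (f (x - z.1) * (f (z.1 - z.2) * h z.2))%:E.
have mF : measurable_fun setT F.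
  apply/measurable_EFinP; apply: measurable_funM.
    exact: (measurableT_comp (measurableT_comp mf (measurable_subl x)) measurable_fst).
  apply: measurable_funM.
    exact: measurableT_comp mf measurable_sub2.
  exact: (measurableT_comp mh measurable_snd).
have F0 z : (0 <= F z)%E by rewrite lee_fin !mulr_ge0.
transitivity (\int[beta]_y \int[beta]_z F (y, z))%E.
  apply: eq_integral => y _; rewrite EFinM (bconvE y mh h0 hM) -ge0_integralZl//.
  - apply/measurable_EFinP; apply: measurable_funM => //.
    exact: measurable_refl.
  - by move=> z _; rewrite lee_fin mulr_ge0.
  - by rewrite lee_fin.
rewrite (fubini_tonelli _ mF F0); apply: eq_integral => z _ /=.
rewrite [RHS]EFinM (bconvE (x - z) mf f0 fC) muleC -ge0_integralZl//; last 3 first.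
- by apply/measurable_EFinP; apply: measurable_funM => //; exact: measurable_refl.
- by move=> y _; rewrite lee_fin mulr_ge0.
- by rewrite lee_fin.
pose G y := F (y, z).
have mG : measurable_fun setT G.
  by apply: (measurableT_comp mF); exact: measurable_pair2.
have G0 y : (0 <= G y)%E by exact: F0.
rewrite -[LHS](integral_subl x mG G0); apply: eq_integral => y _.
rewrite /G /F/= subKr -EFinM; congr EFin.
have -> : x - y - z = x - z - y by rewrite addrAC.
by ring.
Qed.

Lemma superlevel_mass : exists2 del : R, 0 < del & exists K : R,
  (0 < beta ([set x : 'rV[R]_n | (del <= f x)%R] `&` cball 0 K))%E.
Proof.
pose A (k : nat) := [set x | k.+1%:R^-1 <= f x] `&` cball 0 k%:R.
have mA k : measurable (A k).
  apply: measurableI; last exact: measurable_cball.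
  rewrite -[X in measurable X]setTI.
  have -> : setT `&` [set x | k.+1%:R^-1 <= f x] = setT `&` f @^-1` `[k.+1%:R^-1, +oo[.
    by apply/seteqP; split => x /=; rewrite in_itv/= andbT.
  exact: mf.
apply: contrapT => H.
have A0 k : beta (A k) = 0%E.
  apply/eqP; rewrite eq_le measure_ge0 andbT leNgt; apply/negP => h; apply: H.
  by exists k.+1%:R^-1; [rewrite invr_gt0|exists k%:R].
have U0 : beta (\bigcup_k A k) = 0%E.
  apply/eqP; rewrite eq_le measure_ge0 andbT.
  have mU : measurable (\bigcup_k A k) by exact: bigcupT_measurable.
  have := @measure_sigma_subadditive _ _ _ beta _ _ mA mU (@subset_refl _ _).
  by rewrite eseries0// => k _ _; exact: A0.
have : (\int[beta]_x (f x)%:E = 0)%E.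
  have mU : measurable (\bigcup_k A k) by exact: bigcupT_measurable.
  rewrite -(setvU (\bigcup_k A k)) ge0_integral_setU//=; last 4 first.
  - exact: measurableC.
  - by rewrite setvU; apply/measurable_EFinP.
  - by move=> x _; rewrite lee_fin.
  - by apply/disj_setPRL; rewrite setCK.
  rewrite [X in (_ + X)%E]null_set_integral//; last first.
    by apply/measurable_EFinP; exact: measurable_funTS.
  rewrite adde0; apply: integral0_eq => x xU.
  have [->//|fx] := eqVneq (f x) 0.
  have fx0 : 0 < f x by rewrite lt_neqAle eq_sym fx f0.
  case: xU; exists (maxn (Num.truncn (f x)^-1).+1 (Num.truncn `|x|).+1) => //.
  split; rewrite /=.
    rewrite -[leRHS]invrK lef_pV2 ?posrE ?invr_gt0//.
    apply: le_trans (ltW (truncnS_gt _)) _; rewrite ler_nat.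
    by apply: leq_trans (leqnSn _); rewrite leq_maxl.
  rewrite /cball/= sub0r normrN; apply: le_trans (ltW (truncnS_gt _)) _.
  by rewrite ler_nat leq_maxr.
by rewrite fI => /eqP; rewrite onee_eq0.
Qed.

(** Some superlevel set of [f] has positive measure inside a ball and is
    symmetric; by [steinhaus] both factors of the convolution square exceed
    [del] on a set of measure at least [c]. *)
Lemma square_lower : exists2 c, 0 < c & exists2 eta, 0 < eta &
  forall x, `|x| <= eta -> c <= T f x.
Proof.
have [del del0 [K AK]] := superlevel_mass.
set A := _ `&` _ in AK.
have mA : measurable A.
  apply: measurableI; last exact: measurable_cball.
  rewrite -[X in measurable X]setTI.
  have -> : setT `&` [set x | del <= f x] = setT `&` f @^-1` `[del, +oo[.
    by apply/seteqP; split => x /=; rewrite in_itv/= andbT.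
  exact: mf.
have AN y : A y -> A (- y).
  by rewrite /A /cball/= !sub0r !normrN fE.
have [c c0 [eta eta0 H]] := steinhaus mA (@subIsetr _ _ _) AN AK.
exists (del ^+ 2 * c); first by rewrite mulr_gt0// exprn_gt0.
exists eta => // x /H hx.
pose B := A `&` [set y | A (x - y)].
have mB : measurable B.
  apply: measurableI => //; rewrite -[X in measurable X]setTI.
  exact: (measurable_subl x).
rewrite -lee_fin (bconvE x mf f0 fC) EFinM.
apply: (@le_trans _ _ ((del ^+ 2)%:E * beta B)%E); first by rewrite lee_wpmul2l// lee_fin sqr_ge0.
rewrite -integral_cst// integral_mkcond; apply: ge0_le_integral => //.
- by move=> y _; rewrite /patch; case: ifP => // _; rewrite lee_fin sqr_ge0.
- by apply/(measurable_restrictT _ mB).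
- by apply/measurable_EFinP; apply: measurable_funM => //; exact: measurable_refl.
- move=> y _; rewrite /patch; case: ifPn => [|_]; last by rewrite lee_fin mulr_ge0.
  by rewrite inE => -[[h1 _] [h2 _]]; rewrite lee_fin expr2 ler_pM// ltW.
Qed.

Lemma iter_bconv2 m x : (iter (2 * m.+1).+1 T f x)%:E =
  (\int[beta]_y (T f (x - y)%R * iter (2 * m).+1 T f y)%:E)%E.
Proof.
have -> : (2 * m.+1 = (2 * m).+2)%N by rewrite mulnS.
have [mk k0] := iter_bconv_ok mf f0 (2 * m).+1.
rewrite -[iter (2 * m).+3 T f]/(T (T (iter (2 * m).+1 T f))).
by apply: (@bconvA _ C) => // y; exact: (iter_bconv_le_cst mf f0 fI _ _ fC).
Qed.

(** Each further convolution square spreads the bound by [eta / 4]: the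
    points within [eta / 4] of [y1 = (m / (m + 2)) x] lie in the previous
    ball and at distance at most [eta] from [x], so they contribute the
    volume [V] of a ball. *)
Lemma ball_growth : exists2 kap, 0 < kap & exists2 rho, 0 < rho &
  forall m x, `|x| <= rho * m.+1%:R -> kap ^+ m.+1 <= iter (2 * m).+1 T f x.
Proof.
have [c c0 [eta eta0 H]] := square_lower.
pose V := (eta / 2) ^+ n.
have V0 : 0 < V by rewrite exprn_gt0// divr_gt0.
pose kap := Num.min c (c * V).
have k0 : 0 < kap by rewrite lt_min c0 mulr_gt0.
exists kap => //; exists (eta / 4); first by rewrite divr_gt0.
elim=> [|m ih] x hx.
  rewrite expr1; apply: le_trans (H x _); first by rewrite ge_min lexx.
  by move: hx; rewrite mulr1; lra.
have [mk p0] := iter_bconv_ok mf f0 (2 * m).+1.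
have /(_ x) := iter_bconv2 m.
move: mk p0 ih; move: (iter (2 * m).+1 T f) => P mk p0 ih E.
have mT : measurable_fun setT (T f) by exact: measurable_bconv.
have T0 y : 0 <= T f y by exact: bconv_ge0.
pose y1 := (m%:R / m.+2%:R) *: x.
have m2 : 0 < m.+2%:R :> R by [].
have y1n : `|y1| <= eta / 4 * m%:R.
  rewrite /y1 normrZ ger0_norm ?divr_ge0//.
  apply: (@le_trans _ _ (m%:R / m.+2%:R * (eta / 4 * m.+2%:R))); first by rewrite ler_wpM2l ?divr_ge0.
  by rewrite mulrCA divfK ?gt_eqF// le_refl.
have xy1 : `|x - y1| <= eta / 2.
  have -> : x - y1 = (2 / m.+2%:R) *: x.
    rewrite /y1 -{1}(scale1r x) -scalerBl; congr (_ *: _).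
    have e : m.+2%:R = m%:R + 2 :> R by rewrite -natrD addn2.
    by move: m2; rewrite e => m2; field; rewrite gt_eqF.
  rewrite normrZ ger0_norm ?divr_ge0//.
  apply: (@le_trans _ _ (2 / m.+2%:R * (eta / 4 * m.+2%:R))); first by rewrite ler_wpM2l ?divr_ge0.
  rewrite mulrCA divfK ?gt_eqF//; lra.
have key y : cball y1 (eta / 4) y -> c * kap ^+ m.+1 <= T f (x - y) * P y.
  rewrite /cball/= => yy1; apply: ler_pM; [exact: ltW|by rewrite exprn_ge0// ltW| |].
    apply: H; rewrite (_ : x - y = (x - y1) + (y1 - y)); last by rewrite addrA subrK.
    by apply: le_trans (ler_normD _ _) _; lra.
  apply: ih; rewrite (_ : y = y1 - (y1 - y)); last by rewrite subKr.
  apply: le_trans (ler_normB _ _) _.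
  by rewrite -[m.+1%:R]natr1; lra.
have VE : (c * kap ^+ m.+1 * V)%:E = (\int[beta]_(y in cball y1 (eta / 4)) (c * kap ^+ m.+1)%:E)%E.
  rewrite integral_cst//; last exact: measurable_cball.
  rewrite EFinM; congr (_ * _)%E; apply/esym.
  have e4 : 0 <= eta / 4 by rewrite divr_ge0// ltW.
  rewrite [LHS](borel_lebesgue_cball y1 e4) /V; congr (_ ^+ _)%:E.
  by field.
rewrite -lee_fin E.
apply: (@le_trans _ _ (c * kap ^+ m.+1 * V)%:E).
  rewrite lee_fin exprS mulrAC ler_wpM2r ?exprn_ge0 ?(ltW k0)//.
  by rewrite ge_min lexx orbT.
rewrite VE integral_mkcond; apply: ge0_le_integral => //.
- by move=> y _; rewrite /patch; case: ifP => // _; rewrite lee_fin mulr_ge0 ?exprn_ge0// ltW.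
- by apply/(measurable_restrictT _ (measurable_cball _ _)).
- by apply/measurable_EFinP; apply: measurable_funM => //; exact: measurable_refl.
- move=> y _; rewrite /patch; case: ifPn => [|_]; last by rewrite lee_fin mulr_ge0.
  by rewrite inE lee_fin => /key.
Qed.

(** Entries are pairs of a coefficient and a frequency. *)
Definition expsum (s : seq (R * 'rV[R]_n)) (x : 'rV[R]_n) : R :=
  \sum_(q <- s) q.1 * expR (- dot q.2 x).

Lemma measurable_expsum s : measurable_fun setT (expsum s).
Proof.
apply: measurable_sum => q; apply: measurable_funM => //; exact: measurable_expN.
Qed.

Lemma expsum_ge0 s x : all (fun q => 0 <= q.1) s -> 0 <= expsum s x.
Proof.
move=> /allP s0; rewrite /expsum big_seq; apply: sumr_ge0 => q /s0 q0.
by rewrite mulr_ge0// expR_ge0.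
Qed.

Definition expsum_next (s : seq (R * 'rV[R]_n)) := [seq (q.1 * lam q.2, q.2) | q <- s].

Lemma wint_expsum s x : all (fun q => (0 <= q.1) && dom q.2) s ->
  wint f (fun z : 'rV[R]_n => expsum s (x - z)%R) = (expsum (expsum_next s) x)%:E.
Proof.
elim: s => [|q s ih] /=.
  move=> _; rewrite /expsum big_nil.
  under eq_wint do rewrite big_nil.
  exact: wint_cst.
move=> /andP[/andP[q0 dq] sq].
have s0 : all (fun q => 0 <= q.1) s by apply: sub_all sq => u /andP[].
have mE : measurable_fun setT (fun z : 'rV[R]_n => expR (- dot q.2 (x - z)%R)%R).
  exact: (measurable_refl x (measurable_expN q.2)).
rewrite {2}/expsum big_cons -/(expsum _ x) EFinD -ih//.
transitivity (wint f (fun z : 'rV[R]_n =>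
    (q.1 * expR (- dot q.2 (x - z)%R) + expsum s (x - z))%R)).
  by apply: eq_wint => z; rewrite /expsum big_cons.
rewrite wintD//; last 4 first.
- exact: measurable_funM.
- exact: (measurable_refl x (measurable_expsum s)).
- by move=> z; rewrite mulr_ge0 ?expR_ge0.
- by move=> z; exact: expsum_ge0.
rewrite wintZ//; congr (_ + _)%E.
by rewrite wint_exp_refl// (domE f0 dq) -!EFinM/=; congr EFin; ring.
Qed.

(** Domination by a sum of exponentials is transported by convolution, a
    monotone operation that multiplies each exponential by its eigenvalue. *)
Lemma exp_domination k A g s h M : 0 <= A -> dom g ->
  all (fun q => (0 <= q.1) && dom q.2) s ->
  measurable_fun setT h -> (forall x, 0 <= h x) -> (forall x, h x <= M) ->
  (forall x, A * expR (- dot g x) <= h x + expsum s x) ->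
  forall x, A * lam g ^+ k * expR (- dot g x) <=
    iter k T h x + \sum_(q <- s) q.1 * lam q.2 ^+ k * expR (- dot q.2 x).
Proof.
move=> A0 dg sq mh h0 hM H.
have lge0 g' : dom g' -> 0 <= lam g' by move=> d; rewrite ltW// (lam_gt0 mf f0 fE fI d).
pose s' := fun j => [seq (q.1 * lam q.2 ^+ j, q.2) | q <- s].
suff [_ _ _ K] : [/\ measurable_fun setT (iter k T h), forall x, 0 <= iter k T h x,
    forall x, iter k T h x <= M &
    forall x, A * lam g ^+ k * expR (- dot g x) <= iter k T h x + expsum (s' k) x].
  by move=> x; apply: le_trans (K x) _; rewrite /expsum big_map.
elim: k => [|k [mk k0 kM ih]].
  split => // x; rewrite expr0 mulr1; apply: le_trans (H x) _.
  rewrite lerD2l /expsum big_map le_eqVlt; apply/orP; left; apply/eqP.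
  by apply: eq_bigr => q _; rewrite expr0 mulr1.
have sk : all (fun q => (0 <= q.1) && dom q.2) (s' k).
  apply/allP => _ /mapP[q qs ->] /=; have /andP[q0 dq] := allP sq q qs.
  by rewrite dq mulr_ge0 ?exprn_ge0 ?lge0.
split => /=.
- exact: measurable_bconv.
- by move=> x; exact: bconv_ge0.
- by move=> x; exact: (bconv_le_cst mf f0 fI).
move=> x.
have mE : measurable_fun setT (fun z : 'rV[R]_n => expR (- dot g (x - z)%R)%R).
  exact: (measurable_refl x (measurable_expN g)).
have Ak0 : 0 <= A * lam g ^+ k by rewrite mulr_ge0// exprn_ge0// lge0.
have sk0 : all (fun q => 0 <= q.1) (s' k) by apply: sub_all sk => u /andP[].
have s'S : s' k.+1 = expsum_next (s' k).
  by rewrite /expsum_next -map_comp; apply: eq_map => q /=; rewrite exprSr mulrA.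
have : (wint f (fun z : 'rV[R]_n => (A * lam g ^+ k * expR (- dot g (x - z)))%R) <=
    wint f (fun z : 'rV[R]_n => (iter k T h (x - z) + expsum (s' k) (x - z))%R))%E.
  apply: wint_le => //.
  - exact: measurable_funM.
  - apply: measurable_funD; first exact: measurable_refl.
    exact: (measurable_refl x (measurable_expsum _)).
  - by move=> z; rewrite mulr_ge0 ?expR_ge0.
rewrite wintZ// wint_exp_refl// (domE f0 dg) wintD//; last 3 first.
- exact: measurable_refl.
- exact: (measurable_refl x (measurable_expsum _)).
- by move=> z; exact: expsum_ge0.
rewrite (wint_refl_fin mf f0 fI x mk k0 kM) wint_expsum// -s'S -!EFinM -EFinD lee_fin.
by congr (_ <= _); rewrite exprSr; ring.
Qed.

End convolution_lower.

(** * Lower bound for the compound Poisson series *)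

Section poisson_term.
Context {R : realType}.

(** Stirling up to a power of [k], by induction from [1 - u <= expR (- u)]. *)
Lemma fact_upper (k : nat) : (1 <= k)%N ->
  k`!%:R <= k%:R ^+ k.+1 * expR (1 - k%:R) :> R.
Proof.
elim: k => [//|[|k] ih] _.
  by rewrite subrr expR0 mulr1 expr1n.
have := ih isT => {}ih.
rewrite factS natrM exprS -mulrA ler_pM2l//; apply: le_trans ih _.
have k1 : 0 < k.+1%:R :> R by [].
have k2 : 0 < k.+2%:R :> R by [].
have h : k.+1%:R <= k.+2%:R * expR (- k.+2%:R^-1) :> R.
  have := expR_ge1Dx (- k.+2%:R^-1 : R); rewrite -(ler_pM2l k2).
  rewrite mulrDr mulr1 mulrN mulfV ?gt_eqF// -{1}[k.+2%:R]natr1.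
  by rewrite addrK.
have := lerXn2r k.+2 (ltW k1) (le_trans (ltW k1) h) h.
rewrite exprMn -expRM_natl mulrN mulfV ?gt_eqF// => h2.
apply: le_trans (ler_wpM2r (expR_ge0 _) h2) _.
rewrite -mulrA -expRD le_eqVlt; apply/orP; left; apply/eqP.
by congr (_ * expR _); rewrite -[k.+2%:R]natr1; ring.
Qed.

Lemma fact_add_le (k j : nat) : ((k + j)`! <= k`! * (k + j) ^ j)%N.
Proof.
elim: j => [|j ih]; first by rewrite addn0 expn0 muln1.
rewrite addnS factS expnS mulnCA leq_mul2l; apply/orP; right.
apply: leq_trans ih _; rewrite leq_mul2l; apply/orP; right.
by case: j => // j; rewrite leq_exp2r.
Qed.

(** The weight at the mode, from [fact_upper]. *)
Lemma poisson_peak (y : R) : 1 <= y ->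
  expR (y - 2) / y <= y ^+ (Num.truncn y) / (Num.truncn y)`!%:R.
Proof.
move=> y1; have y0 : 0 < y by apply: lt_le_trans y1.
set k := Num.truncn y.
have ky : k%:R <= y by rewrite truncn_le ltW.
have yk : y < k%:R + 1 by rewrite natr1 truncnS_gt.
have k1 : (1 <= k)%N by rewrite /k -[X in (X <= _)%N](truncn1 R) le_truncn.
have k0 : 0 < k%:R :> R by rewrite ltr0n.
have kf : 0 < k`!%:R :> R by rewrite ltr0n fact_gt0.
rewrite ler_pdivlMr// mulrAC ler_pdivrMr//.
apply: (@le_trans _ _ (expR (k%:R - 1) * (k%:R ^+ k.+1 * expR (1 - k%:R)))).
  apply: ler_pM; [exact: expR_ge0|exact: ltW| |exact: fact_upper].
  by rewrite ler_expR; lra.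
rewrite mulrCA -expRD (_ : k%:R - 1 + (1 - k%:R) = 0 :> R) ?expR0 ?mulr1; last by ring.
by rewrite -exprSr lerXn2r ?nnegrE// ltW.
Qed.

(** Moving from [k] to [k + 2 m] factors multiplies the Poisson weight by
    [t] over a factor of the factorial, at most [k + 2 m <= (L + 3) t], for
    each of the additional ones. *)
Lemma poisson_term_lower (L t eps : R) (k m : nat) : 1 <= L -> 2 <= t -> eps <= 1 ->
  k = Num.truncn (L * t) -> m%:R <= eps * t + 1 ->
  expR (L * t - 2) / (L * t) * (L + 3) ^- (2 * m) <=
  t ^+ (k + 2 * m) / (k + 2 * m)`!%:R * L ^+ k.
Proof.
move=> L1 t2 e1 kE mle.
have L0 : 0 < L by apply: lt_le_trans L1.
have t0 : 0 < t by lra.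
have Lt1 : 1 <= L * t by rewrite -[leLHS]mulr1 ler_pM//; lra.
have D0 : 0 < L + 3 by lra.
set N := (k + 2 * m)%N.
have kf : 0 < k`!%:R :> R by rewrite ltr0n fact_gt0.
have Nf : 0 < N`!%:R :> R by rewrite ltr0n fact_gt0.
have ND : N%:R <= (L + 3) * t.
  have kL : k%:R <= L * t by rewrite kE truncn_le// ltW// mulr_gt0.
  rewrite /N natrD natrM; have et : eps * t <= t by rewrite ler_piMl// ltW.
  rewrite mulrDl; lra.
have h1 := poisson_peak Lt1; rewrite -kE in h1.
have h2 : N`!%:R <= k`!%:R * ((L + 3) * t) ^+ (2 * m) :> R.
  apply: (@le_trans _ _ (k`!%:R * N%:R ^+ (2 * m))).
    by rewrite -natrX -natrM ler_nat; exact: fact_add_le.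
  have DT0 : 0 <= (L + 3) * t by rewrite mulr_ge0// ltW.
  by apply: ler_wpM2l => //; apply: lerXn2r; rewrite ?nnegrE.
apply: (@le_trans _ _ ((L * t) ^+ k / k`!%:R * (L + 3) ^- (2 * m))).
  by rewrite ler_wpM2r// invr_ge0 exprn_ge0// ltW.
have P0 : 0 < t ^+ (2 * m) by rewrite exprn_gt0.
have Q0 : 0 < (L + 3) ^+ (2 * m) by rewrite exprn_gt0.
have PQ : (L * t) ^+ k / k`!%:R / (L + 3) ^+ (2 * m) =
    t ^+ N * L ^+ k / (k`!%:R * ((L + 3) * t) ^+ (2 * m)).
  rewrite !exprMn /N exprD; move: P0 Q0.
  move: (t ^+ (2 * m)) ((L + 3) ^+ _) (L ^+ k) (t ^+ k) => P Q A B P0 Q0.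
  by field; rewrite !gt_eqF.
rewrite PQ [leRHS]mulrAC; apply: ler_wpM2l; first by rewrite mulr_ge0// exprn_ge0// ltW.
by rewrite lef_pV2 ?posrE// mulr_gt0// exprn_gt0// mulr_gt0.
Qed.

Lemma expR_cost_le (q u : R) (m : nat) : 0 < q -> m%:R <= u ->
  expR (- (`|ln q| * u)) <= q ^+ m.
Proof.
move=> q0 mu; rewrite -[in leRHS](lnK (x := q)) ?posrE// -expRM_natl ler_expR lerNl.
apply: (@le_trans _ _ (m%:R * `|ln q|)); last by rewrite mulrC ler_wpM2l.
by rewrite -mulrN ler_wpM2l// -normrN ler_norm.
Qed.

End poisson_term.

Lemma half_absorb (R : realType) (X Y : R) : X <= Y + X / 2 -> X / 2 <= Y.
Proof. lra. Qed.

Section lower_bound.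
Context {R : realType} {n : nat}.
Notation beta := (@borel_lebesgue R n).
Variables a f : 'rV[R]_n -> R.
Implicit Types (h : R) (g r x w : 'rV[R]_n) (c M : R).
Hypothesis mf : measurable_fun setT f.
Hypothesis f0 : forall x, 0 <= f x.
Hypothesis fE : forall x, f (- x) = f x.
Hypothesis fI : (\int[beta]_x (f x)%:E = 1)%E.
Variable C : R.
Hypothesis fC : forall x, f x <= C.

Notation dom := (dom f).
Notation lam := (lam f).
Notation T := (bconv f).
Notation ei i := (delta_mx ord0 i : 'rV[R]_n).

Lemma expsum_ge_mem (s : seq (R * 'rV[R]_n)) q x : all (fun q => 0 <= q.1) s ->
  q \in s -> q.1 * expR (- dot q.2 x) <= expsum s x.
Proof.
elim: s => [//|u s ih] /= /andP[u0 s0]; rewrite inE /expsum big_cons -/(expsum s x).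
move=> /orP[/eqP ->|/(ih s0) h]; first by rewrite lerDl expsum_ge0.
by apply: le_trans h _; rewrite lerDr mulr_ge0 ?expR_ge0.
Qed.

Lemma coord_gt (e : R) x : 0 <= e -> e < `|x| -> exists i, e < `|x ord0 i|.
Proof.
move=> e0 ex; apply: contrapT => /forallNP H.
move: ex; rewrite ltNge => /negP; apply; rewrite mx_norm_le//; apply/forallP => i.
by rewrite leNgt; apply/negP.
Qed.

Definition axis_shifts (c h : R) g : seq (R * 'rV[R]_n) :=
  [seq (c, g + h *: ei i) | i : 'I_n] ++ [seq (c, g + (- h) *: ei i) | i : 'I_n].

(** Outside the ball some coordinate of [y] exceeds [rad] in absolute value,
    and shifting the frequency against it by [h] gains the factor [expR (h *
    rad)]. *)
Lemma exp_le_axis_shifts (c h rad : R) g y : 0 <= h -> 0 <= rad -> 0 <= c ->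
  rad < `|y| -> c * expR (h * rad) * expR (- dot g y) <= expsum (axis_shifts c h g) y.
Proof.
move=> h0 rad0 c0 ry.
have [i hi] := coord_gt rad0 ry.
have all0 : all (fun q => 0 <= q.1) (axis_shifts c h g).
  by rewrite all_cat; apply/andP; split; apply/allP => q /mapP[j _ ->].
have [s sE hs] : exists2 s, (c, g + s *: ei i) \in axis_shifts c h g & h * rad <= - (s * y ord0 i).
  have [yi|yi] := leP 0 (y ord0 i).
    exists (- h).
      by rewrite mem_cat; apply/orP; right; apply/mapP; exists i => //; rewrite mem_enum.
    by rewrite mulNr opprK ler_wpM2l// ltW//; move: hi; rewrite ger0_norm.
  exists h.
    by rewrite mem_cat; apply/orP; left; apply/mapP; exists i => //; rewrite mem_enum.
  by rewrite -mulrN ler_wpM2l// ltW//; move: hi; rewrite ltr0_norm.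
apply: le_trans (expsum_ge_mem y all0 sE) => /=.
rewrite -mulrA ler_wpM2l// -expRD ler_expR dotDl dotZl (dotC (ei i) y) dot_delta.
by move: hs; move: (s * _) (h * rad) => A B; lra.
Qed.

Section one_point.
Variables (g r : 'rV[R]_n) (kap rho h1 C2 : R).
Hypothesis kap_gt0 : 0 < kap.
Hypothesis rho_gt0 : 0 < rho.
Hypothesis growth : forall m x, `|x| <= rho * m.+1%:R -> kap ^+ m.+1 <= iter (2 * m).+1 T f x.
Hypothesis dg : dom g.
Hypothesis axis : forall i (s : R), `|s| <= h1 -> dom (g + s *: ei i) /\
  lam (g + s *: ei i) <= lam g + s * r ord0 i + C2 * s ^+ 2.

Let Gam : R := n%:R * enorm g.
Let Gam0 : 0 <= Gam. Proof. by rewrite mulr_ge0// enorm_ge0. Qed.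

(** Up to a constant [A], [expR (- dot g y)] is below the spread-out power
    inside the ball of radius [rho (m + 1)], by [growth], and below the
    shifted exponentials outside it. After [k] more convolutions the shifted
    exponentials at [x] are compared with the main one: by [axis] their
    ratio is at most [expR E], which [E] is assumed to make small. *)
Lemma conv_lower (k m : nat) (h E : R) x : 0 < h -> h <= h1 ->
  (forall i (s : R), `|s| = h ->
    - (h * rho * m.+1%:R) + k%:R / lam g * (s * r ord0 i + C2 * s ^+ 2) - s * x ord0 i <= E) ->
  (n + n)%:R * expR E <= 2^-1 ->
  2^-1 * (kap ^+ m.+1 * expR (- (Gam * rho * m.+1%:R))) * lam g ^+ k * expR (- dot g x)
    <= iter (k + (2 * m).+1) T f x.
Proof.
move=> h0 hh1 HE En.
have L1 := lam_ge1 mf f0 fE fI dg.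
have L0 : 0 < lam g by apply: lt_le_trans L1.
have M0 : 0 < m.+1%:R :> R by [].
set A := kap ^+ m.+1 * _.
have A0 : 0 < A by rewrite mulr_gt0 ?expR_gt0// exprn_gt0.
pose c := A * expR (- (h * (rho * m.+1%:R))).
have c0 : 0 <= c by rewrite mulr_ge0 ?expR_ge0// ltW.
pose s := axis_shifts c h g.
have sin q : q \in s -> exists i, exists2 u : R, `|u| = h & q = (c, g + u *: ei i).
  rewrite mem_cat => /orP[] /mapP[i _ ->].
    by exists i, h => //; rewrite gtr0_norm.
  by exists i, (- h) => //; rewrite normrN gtr0_norm.
have sdom : all (fun q => (0 <= q.1) && dom q.2) s.
  apply/allP => q /sin[i [u uh ->]] /=; rewrite c0/=.
  by apply: (axis i _).1; rewrite uh.
have [mP P0] := iter_bconv_ok mf f0 (2 * m).+1.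
have PC y : iter (2 * m).+1 T f y <= C by exact: (iter_bconv_le_cst mf f0 fI _ _ fC).
have R0 : 0 <= rho * m.+1%:R by rewrite mulr_ge0// ltW.
have dom0 y : A * expR (- dot g y) <= iter (2 * m).+1 T f y + expsum s y.
  have s00 : all (fun q => 0 <= q.1) s by apply: sub_all sdom => u /andP[].
  have [yr|yr] := leP `|y| (rho * m.+1%:R).
    apply: (@le_trans _ _ (kap ^+ m.+1)); last first.
      by apply: le_trans (growth yr) _; rewrite lerDl expsum_ge0.
    rewrite /A -mulrA ler_piMr ?exprn_ge0 ?(ltW kap_gt0)// -expRD -[leRHS](expR0 R) ler_expR.
    have h2 := normr_dot_le_normr y g; rewrite dotC in h2.
    have h3 : n%:R * `|y| * enorm g <= Gam * rho * m.+1%:R.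
      rewrite (_ : n%:R * `|y| * enorm g = Gam * `|y|); last by rewrite /Gam; ring.
      by rewrite -mulrA ler_wpM2l.
    have h4 : - dot g y <= `|dot g y| by rewrite lerNl; exact: lerNnormlW.
    by rewrite addrC subr_le0; apply: le_trans h4 (le_trans h2 h3).
  apply: le_trans (_ : expsum s y <= _); last by rewrite lerDr.
  apply: le_trans (exp_le_axis_shifts g (ltW h0) R0 c0 yr).
  have -> : c * expR (h * (rho * m.+1%:R)) = A; last by [].
  by rewrite /c -mulrA -expRD addNr expR0 mulr1.
have := exp_domination mf f0 fE fI k (ltW A0) dg sdom mP P0 PC dom0 x.
rewrite -iterD => key.
have sumle : \sum_(q <- s) q.1 * lam q.2 ^+ k * expR (- dot q.2 x) <=
    \sum_(q <- s) A * lam g ^+ k * expR (- dot g x) * expR E.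
  rewrite big_seq [leRHS]big_seq; apply: ler_sum => q /sin[i [u uh ->]] /=.
  have [du lu] := axis i (s := u) ltac:(by rewrite uh).
  (* the quadratic upper bound in exponential form, ready to be raised to
     the power [k] *)
  have lu2 : lam (g + u *: ei i) <= lam g * expR ((u * r ord0 i + C2 * u ^+ 2) / lam g).
    apply: le_trans lu _; rewrite -ler_pdivrMl//.
    apply: le_trans (expR_ge1Dx _); rewrite le_eqVlt; apply/orP; left; apply/eqP.
    by field; rewrite gt_eqF.
  have lu0 := lam_gt0 mf f0 fE fI du.
  have lu3 := lerXn2r k (ltW lu0) (le_trans (ltW lu0) lu2) lu2.
  rewrite exprMn -expRM_natl in lu3.
  apply: (@le_trans _ _ (c * (lam g ^+ k * expR (k%:R * ((u * r ord0 i + C2 * u ^+ 2) / lam g))) *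
    expR (- dot (g + u *: ei i) x))).
    by rewrite ler_wpM2r ?expR_ge0// ler_wpM2l.
  have -> : dot (g + u *: ei i) x = dot g x + u * x ord0 i.
    by rewrite dotDl dotZl (dotC (ei i) x) dot_delta.
  rewrite /c (_ : - (dot g x + _) = - dot g x + - (u * x ord0 i)); last by ring.
  rewrite expRD.
  have hE : expR (- (h * (rho * m.+1%:R))) *
      expR (k%:R * ((u * r ord0 i + C2 * u ^+ 2) / lam g)) * expR (- (u * x ord0 i)) <= expR E.
    rewrite -!expRD ler_expR; apply: le_trans (HE i u uh); rewrite le_eqVlt.
    by apply/orP; left; apply/eqP; move: (lam g) (r ord0 i) (x ord0 i) => A1 A2 A3; ring.
  have B0 : 0 <= A * lam g ^+ k * expR (- dot g x).
    exact: mulr_ge0 (mulr_ge0 (ltW A0) (exprn_ge0 k (ltW L0))) (expR_ge0 _).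
  have := ler_wpM2l B0 hE; congr (_ <= _); ring.
have szs : size s = (n + n)%N.
  by rewrite size_cat !size_image card_ord.
have sumE : \sum_(q <- s) A * lam g ^+ k * expR (- dot g x) * expR E =
    A * lam g ^+ k * expR (- dot g x) * ((n + n)%:R * expR E).
  rewrite big_const_seq count_predT szs iter_addr_0 -mulr_natr; ring.
have B0 : 0 <= A * lam g ^+ k * expR (- dot g x).
  exact: mulr_ge0 (mulr_ge0 (ltW A0) (exprn_ge0 k (ltW L0))) (expR_ge0 _).
have := ler_wpM2l B0 En; rewrite -sumE => h2.
have := le_trans key (lerD (lexx _) (le_trans sumle h2)).
have -> : 2^-1 * A * lam g ^+ k * expR (- dot g x) = A * lam g ^+ k * expR (- dot g x) / 2.
  by ring.
exact: half_absorb.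
Qed.

Hypothesis powE : forall k, conv_pow a k.+2 = iter k.+1 (bconv f) f.
Hypothesis single : forall x t N, 0 <= t -> (1 <= N)%N ->
  expR (- t) * (t ^+ N * conv_pow a N x / N`!%:R) <= v a x t.

(** The logarithm of what is lost for each pair of convolutions spent on
    spreading: the height [kap], the variation of the tilt over the larger
    ball, and the Poisson weight. *)
Let cost : R := `|ln (kap * expR (- (Gam * rho)) * (lam g + 3) ^- 2)|.

(** The Poisson term with [k + 2 (m + 1)] factors, [k] near [lam g * t] and
    [m] near [eps * t]: [poisson_term_lower] for its weight and [conv_lower]
    for the convolution power. *)
Lemma v_lower (eps t h E : R) x : 0 < eps -> eps <= 1 -> 2 <= t -> 0 < h -> h <= h1 ->
  (forall i (s : R), `|s| = h ->
    - (h * rho * (eps * t)) + (Num.truncn (lam g * t))%:R / lam g *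
      (s * r ord0 i + C2 * s ^+ 2) - s * x ord0 i <= E) ->
  (n + n)%:R * expR E <= 2^-1 ->
  2^-1 * expR (- (t - lam g * t + 2 + dot g x + cost * (eps * t + 1))) / (lam g * t)
    <= v a x t.
Proof.
move=> eps0 eps1 t2 h0 hh1 HE En.
have L1 := lam_ge1 mf f0 fE fI dg.
have L0 : 0 < lam g by apply: lt_le_trans L1.
have t0 : 0 < t by lra.
set k := Num.truncn (lam g * t) in HE *.
set m := Num.truncn (eps * t).
have et0 : 0 <= eps * t by rewrite mulr_ge0// ltW.
have mle : m.+1%:R <= eps * t + 1.
  by rewrite -[m.+1%:R]natr1 lerD2r truncn_le.
have mge : eps * t <= m.+1%:R by rewrite ltW// truncnS_gt.
have HE' i (s : R) : `|s| = h ->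
    - (h * rho * m.+1%:R) + k%:R / lam g * (s * r ord0 i + C2 * s ^+ 2) - s * x ord0 i <= E.
  move=> sh; apply: le_trans (HE i s sh); rewrite -!addrA lerD2r lerN2.
  by rewrite ler_wpM2l// mulr_ge0// ltW.
have low := conv_lower h0 hh1 HE' En.
have P := poisson_term_lower L1 t2 eps1 (erefl k) mle.
have N1 : (1 <= k + 2 * m.+1)%N by rewrite addn_gt0 muln_gt0 orbT.
apply: le_trans (single x (ltW t0) N1).
have -> : conv_pow a (k + 2 * m.+1) = iter (k + (2 * m).+1) T f.
  by rewrite mulnS addnCA add2n powE addnS.
set N := (k + 2 * m.+1)%N in P N1 *.
have Nf : 0 < N`!%:R :> R by rewrite ltr0n fact_gt0.
pose q := kap * expR (- (Gam * rho)) * (lam g + 3) ^- 2.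
have L3 : 0 < lam g + 3 by rewrite addr_gt0.
have q0 : 0 < q by rewrite !mulr_gt0 ?expR_gt0// invr_gt0 exprn_gt0.
have qm : expR (- (cost * (eps * t + 1))) <= q ^+ m.+1.
  exact: expR_cost_le.
have qE : q ^+ m.+1 = kap ^+ m.+1 * expR (- (Gam * rho * m.+1%:R)) * (lam g + 3) ^- (2 * m.+1).
  rewrite /q !exprMn -expRM_natl exprVn exprM.
  by congr (_ * expR _ * _); ring.
have e0 := expR_gt0 (- t).
pose X := expR (- dot g x) * 2^-1 * expR (- t).
have X0 : 0 <= X by rewrite !mulr_ge0 ?expR_ge0.
pose D := expR (lam g * t - 2) / (lam g * t).
have D0 : 0 <= D by rewrite divr_ge0 ?expR_ge0// ltW// mulr_gt0.
apply: (@le_trans _ _ (X * (D * q ^+ m.+1))).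
  apply: (@le_trans _ _ (X * (D * expR (- (cost * (eps * t + 1)))))); last first.
    by rewrite ler_wpM2l// ler_wpM2l.
  rewrite /X /D (_ : - (t - _ + _ + _ + _) =
    - dot g x + - t + (lam g * t - 2) + - (cost * (eps * t + 1))); last by ring.
  by rewrite !expRD le_eqVlt; apply/orP; left; apply/eqP; ring.
pose W := kap ^+ m.+1 * expR (- (Gam * rho * m.+1%:R)).
have W0 : 0 <= W by rewrite mulr_ge0 ?expR_ge0// exprn_ge0// ltW.
apply: (@le_trans _ _ (X * W * (t ^+ N / N`!%:R * lam g ^+ k))).
  rewrite qE -/W; have := ler_wpM2l (mulr_ge0 X0 W0) P; rewrite -/D.
  by congr (_ <= _); ring.
have tN : 0 <= expR (- t) * (t ^+ N / N`!%:R).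
  by rewrite mulr_ge0 ?expR_ge0// divr_ge0// exprn_ge0// ltW.
have := ler_wpM2l tN low; rewrite -/W /X.
move: (expR (- t)) (t ^+ N) (N`!%:R^-1) (lam g ^+ k) (expR (- dot g x)) (iter _ _ _ x).
by move=> Y1 Y2 Y3 Y4 Y5 Y6; congr (_ <= _); ring.
Qed.

End one_point.

End lower_bound.

(** * Logarithmic asymptotics along rays *)

Section ray_scaling.
Context {R : realType} {n : nat}.

Lemma near_ray (x : R -> 'rV[R]_n) (r : 'rV[R]_n) (eta : R) : 0 < eta ->
  t^-1 *: x t @[t --> +oo] --> r -> \forall t \near +oo, `|x t - t *: r| <= eta * t.
Proof.
move=> eta0 xr.
have H : \forall t \near +oo, `|r - t^-1 *: x t| <= eta.
  apply: (xr [set y | `|r - y| <= eta]); apply/nbhs_ballP; exists eta => //= y.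
  by rewrite -ball_normE/= => /ltW.
near=> t.
have t0 : 0 < t by near: t; exact: nbhs_pinfty_gt (num_real _).
have h : `|r - t^-1 *: x t| <= eta.
  by near: t; exact: H.
have -> : x t - t *: r = - (t *: (r - t^-1 *: x t)).
  by rewrite scalerBr scalerA mulfV ?gt_eqF// scale1r opprB.
by rewrite normrN normrZ gtr0_norm// mulrC ler_wpM2r// ltW.
Unshelve. all: by end_near. Qed.

End ray_scaling.

Section scalar_estimates.
Context {R : realType}.

(** The exponent that [conv_lower] asks to be small. In it [kL * s * ri],
    from the tangent of [Lambda], cancels [s * xi] up to errors, and the
    gain [h rho e t] of the ball beats these and the quadratic term once [C2
    * h] is small against [rho * e]. *)
Lemma tilt_error (h rho e t kL C2 s ri xi nr : R) :
  0 < h -> 0 <= rho -> 0 <= e -> 0 <= C2 -> `|s| = h -> C2 * h <= rho * e / 4 ->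
  t - 1 <= kL -> kL <= t -> 0 <= t -> `|ri| <= nr -> `|xi - t * ri| <= rho * e / 4 * t ->
  - (h * rho * (e * t)) + kL * (s * ri + C2 * s ^+ 2) - s * xi <=
  h * (nr - rho * e * t / 2).
Proof.
move=> h0 rho0 e0 C20 sh C2h k1 k2 t0 rn xn.
have s2 : s ^+ 2 = h ^+ 2 by rewrite -sh real_normK// num_real.
have b1 : (kL - t) * (s * ri) <= h * nr.
  apply: le_trans (ler_norm _) _; rewrite !normrM sh.
  have : `|kL - t| <= 1 by rewrite ler_norml; apply/andP; split; lra.
  move=> h1; rewrite -[leRHS]mul1r; apply: ler_pM => //; first by rewrite mulr_ge0// ltW.
  by rewrite ler_wpM2l// ltW.
have b2 : - (s * (xi - t * ri)) <= h * (rho * e / 4 * t).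
  apply: le_trans (ler_norm _) _; rewrite normrN normrM sh ler_wpM2l// ltW//.
have b3 : kL * (C2 * s ^+ 2) <= t * (rho * e / 4 * h).
  rewrite s2; apply: (@le_trans _ _ (t * (C2 * h ^+ 2))).
    by rewrite ler_wpM2r// mulr_ge0// sqr_ge0.
  by rewrite ler_wpM2l// expr2 mulrA ler_wpM2r// ltW.
have -> : - (h * rho * (e * t)) + kL * (s * ri + C2 * s ^+ 2) - s * xi =
  - (h * rho * (e * t)) + (kL - t) * (s * ri) + kL * (C2 * s ^+ 2) + - (s * (xi - t * ri)) by ring.
have -> : h * (nr - rho * e * t / 2) = - (h * rho * (e * t)) + h * nr +
  t * (rho * e / 4 * h) + h * (rho * e / 4 * t) by field.
lra.
Qed.

(** Collects the error terms, each at most [eps / 8 * t] in the exponent;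
    the prefactor [2 * (L * t)] uses up two of them. *)
Lemma final_lower (eps L t P D Q cost e : R) : 0 < eps -> 1 <= L -> 0 < t ->
  cost * e <= eps / 8 -> 2 + cost <= eps / 8 * t -> P - L + 1 = Q ->
  D <= P * t + eps / 8 * t -> ln (16 * L / eps) <= eps / 8 * t ->
  expR (- ((Q + eps) * t)) <=
  2^-1 * expR (- (t - L * t + 2 + D + cost * (e * t + 1))) / (L * t).
Proof.
move=> eps0 L1 t0 ce c2 QE DE lnE.
have L0 : 0 < L by apply: lt_le_trans L1.
have X0 : 0 < 16 * L / eps by rewrite divr_gt0// mulr_gt0.
have et0 : 0 < eps / 8 * t by rewrite mulr_gt0// divr_gt0.
have h1 : 16 * L / eps <= expR (eps / 8 * t) by rewrite -[leLHS]lnK ?posrE// ler_expR.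
have h2 : eps / 8 * t <= expR (eps / 8 * t).
  by have := expR_ge1Dx (eps / 8 * t); lra.
have h3 : 2 * (L * t) <= expR (eps / 8 * t + eps / 8 * t).
  rewrite expRD; apply: le_trans (_ : 16 * L / eps * (eps / 8 * t) <= _).
    by rewrite le_eqVlt; apply/orP; left; apply/eqP; field; rewrite gt_eqF.
  by apply: ler_pM => //; exact: ltW.
rewrite ler_pdivlMr ?mulr_gt0// -(ler_pM2l (ltr0n R 2)).
rewrite [leRHS]mulrA mulfV// mul1r.
rewrite mulrCA.
apply: le_trans (ler_wpM2l (expR_ge0 _) h3) _.
rewrite -expRD ler_expR.
have : cost * (e * t) <= eps / 8 * t by rewrite mulrA ler_wpM2r// ltW.
by move=> ?; rewrite -QE; lra.
Qed.

End scalar_estimates.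

Section log_asymptotics.
Context {R : realType} {n : nat}.
Notation beta := (@borel_lebesgue R n).
Variables a f : 'rV[R]_n -> R.
Implicit Types (g r x w : 'rV[R]_n).
Hypothesis mf : measurable_fun setT f.
Hypothesis f0 : forall x, 0 <= f x.
Hypothesis fE : forall x, f (- x) = f x.
Hypothesis fI : (\int[beta]_x (f x)%:E = 1)%E.
Notation dom := (dom f).
Notation lam := (lam f).
Notation ei i := (delta_mx ord0 i : 'rV[R]_n).

(** By maximality [Lambda] lies above its affine tangent of slope [r] at
    [g]. The sum of the values at [g + s e_i] and [g - s e_i] is bounded by
    [lam_second_difference], and the tangent bounds one of the two from
    below. *)
Lemma axis_bound g r (G : R) : is_maxL dom lam r g -> enorm g < G ->
  (forall g', enorm g' <= G -> dom g') ->
  exists2 h1, 0 < h1 & exists2 C2, 0 <= C2 & forall i (s : R), `|s| <= h1 ->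
    dom (g + s *: ei i) /\
    lam (g + s *: ei i) <= lam g + s * r ord0 i + C2 * s ^+ 2.
Proof.
move=> [dg gmax] gG domG.
pose h0 := G - enorm g; have h00 : 0 < h0 by rewrite subr_gt0.
have dax i (s : R) : `|s| <= h0 -> dom (g + s *: ei i).
  move=> sh; apply: domG; apply: le_trans (enormD _ _) _.
  by rewrite enormZ enorm_delta mulr1 -lerBrDl.
have dsub i : dom (g - h0 *: ei i).
  by rewrite -scaleNr; apply: dax; rewrite normrN gtr0_norm.
have dadd i : dom (g + h0 *: ei i) by apply: dax; rewrite gtr0_norm.
have /boolp.choice [Cf HC] : forall i, exists C, 0 <= C /\ forall t, 0 <= t -> t <= h0 / 2 ->
    [/\ dom (g + t *: ei i), dom (g - t *: ei i) &
      lam (g + t *: ei i) + lam (g - t *: ei i) <= 2 * lam g + C * t ^+ 2].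
  move=> i; have [C C0 H] := lam_second_difference mf f0 fE fI h00 (dadd i) (dsub i).
  by exists C.
pose C2 := \sum_i Cf i.
have C2ge i : Cf i <= C2.
  by rewrite /C2 (bigD1 i)//= lerDl; apply: sumr_ge0 => j _; have [] := HC j.
exists (h0 / 2); first by rewrite divr_gt0.
exists C2; first by apply: sumr_ge0 => j _; have [] := HC j.
move=> i s sh; split.
  by apply: dax; apply: le_trans sh _; rewrite ler_pdivrMr//; lra.
have [_ H] := HC i.
have quadC t : Cf i * t ^+ 2 <= C2 * t ^+ 2 by rewrite ler_wpM2r ?sqr_ge0.
have tang u : dom u -> dot u r - lam u <= dot g r - lam g by exact: gmax.
have [s0|s0] := leP 0 s.
  have st : s <= h0 / 2 by move: sh; rewrite ger0_norm.
  have [_ dm hl] := H s s0 st.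
  have := tang _ dm; have := quadC s; rewrite dotBl dotZl (dotC (ei i) r) dot_delta.
  move: hl; move: (lam _) (lam _) (lam _) (C2 * _) (Cf i * _) (dot g r) (s * _) => *; lra.
have t0 : 0 <= - s by rewrite oppr_ge0 ltW.
have st : - s <= h0 / 2 by move: sh; rewrite ltr0_norm.
have [dp _ hl] := H (- s) t0 st.
have := tang _ dp; have := quadC (- s); rewrite dotDl dotZl (dotC (ei i) r) dot_delta.
move: hl; rewrite scaleNr opprK sqrrN.
move: (lam _) (lam _) (lam _) (C2 * _) (Cf i * _) (dot g r) => A1 A2 A3 A4 A5 A6.
by rewrite mulNr; move: (s * _) => *; lra.
Qed.

Hypothesis fa : forall x, 0 <= f x <= a x.
Hypothesis powE : forall k, conv_pow a k.+2 = iter k.+1 (bconv f) f.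
Variables (r g : 'rV[R]_n) (G M C : R).
Hypothesis gmax : is_maxL dom lam r g.
Hypothesis PhiE : Phi a r = dot g r - lam g + 1.
Hypothesis gG : enorm g < G.
Hypothesis domG : forall g', enorm g' <= G -> dom g'.
Hypothesis aM : forall x, a x <= M * expR (- dot g x).
Hypothesis fC : forall x, f x <= C.

(** The parameters are chosen one after the other: [e] so that the spreading
    costs little, [h] so that the quadratic term is small against the gain
    of the ball, [eta] so that the deviation of [x t] from [t *: r] is small
    against both. *)
Lemma v_log_bounds (x : R -> 'rV[R]_n) (eps : R) : 0 < eps ->
  t^-1 *: x t @[t --> +oo] --> r ->
  \forall t \near +oo, expR (- ((Phi a r + eps) * t)) <= v a (x t) t /\
    v a (x t) t <= expR (- ((Phi a r - eps) * t)).
Proof.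
move=> eps0 xr; have dg := gmax.1.
have L1 := lam_ge1 mf f0 fE fI dg.
have L0 : 0 < lam g by apply: lt_le_trans L1.
have M0 : 0 <= M.
  have := aM 0; rewrite dot0r oppr0 expR0 mulr1; apply: le_trans.
  by have /andP[/le_trans] := fa 0; apply.
have between y t : 0 <= t -> _ := fun t0 => v_between mf f0 fE fI fa powE y t0 M0 dg aM.
have single y t N : 0 <= t -> (1 <= N)%N ->
    expR (- t) * (t ^+ N * conv_pow a N y / N`!%:R) <= v a y t.
  by move=> t0; have [_] := between y t t0; apply.
have [kap kap0 [rho rho0 growth]] := ball_growth mf f0 fE fI fC.
have [h1 h10 [C2 C20 axis]] := axis_bound gmax gG domG.
pose Gam := n%:R * enorm g.
have Gam0 : 0 <= Gam by rewrite mulr_ge0// enorm_ge0.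
pose cost := `|ln (kap * expR (- (Gam * rho)) * (lam g + 3) ^- 2)|.
have cost0 : 0 <= cost by exact: normr_ge0.
pose e := Num.min 1 (eps / (8 * (cost + 1))).
have c1 : 0 < cost + 1 by rewrite ltr_wpDl.
have e0 : 0 < e by rewrite lt_min ltr01 divr_gt0// mulr_gt0.
have e1 : e <= 1 by rewrite ge_min lexx.
have ce : cost * e <= eps / 8.
  apply: (@le_trans _ _ ((cost + 1) * e)); first by rewrite ler_wpM2r ?lerDl// ltW.
  have : e <= eps / (8 * (cost + 1)) by rewrite ge_min lexx orbT.
  rewrite ler_pdivlMr ?mulr_gt0// => h.
  rewrite ler_pdivlMr//; apply: le_trans h; rewrite le_eqVlt; apply/orP; left; apply/eqP; ring.
pose h := Num.min h1 (rho * e / (4 * (C2 + 1))).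
have c21 : 0 < C2 + 1 by rewrite ltr_wpDl.
have h0 : 0 < h by rewrite lt_min h10 divr_gt0// mulr_gt0.
have hh1 : h <= h1 by rewrite ge_min lexx.
have C2h : C2 * h <= rho * e / 4.
  apply: (@le_trans _ _ ((C2 + 1) * h)); first by rewrite ler_wpM2r ?lerDl// ltW.
  have : h <= rho * e / (4 * (C2 + 1)) by rewrite ge_min lexx orbT.
  rewrite ler_pdivlMr ?mulr_gt0// => hh.
  rewrite ler_pdivlMr//; apply: le_trans hh; rewrite le_eqVlt; apply/orP; left; apply/eqP; ring.
have Gam1 : 0 < Gam + 1 by rewrite ltr_wpDl.
pose eta := Num.min (rho * e / 4) (eps / 8 / (Gam + 1)).
have eta0 : 0 < eta by rewrite lt_min !divr_gt0// mulr_gt0.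
have eta1 : eta <= rho * e / 4 by rewrite ge_min lexx.
have eta2 : Gam * eta <= eps / 8.
  apply: (@le_trans _ _ ((Gam + 1) * eta)); first by rewrite ler_wpM2r ?lerDl// ltW.
  by rewrite mulrC -ler_pdivlMr// ge_min lexx orbT.
pose lq := ln (4 * (n%:R + 1) : R).
have n1 : 0 < 4 * (n%:R + 1) :> R by rewrite mulr_gt0// ltr_wpDl.
near=> t.
have t2 : 2 <= t by near: t; exact: nbhs_pinfty_ge (num_real _).
have t0 : 0 < t by apply: lt_le_trans t2.
have xt : `|x t - t *: r| <= eta * t by near: t; exact: near_ray.
have tE : (`|r| + lq / h) * 2 / (rho * e) <= t by near: t; exact: nbhs_pinfty_ge (num_real _).
have tc : (2 + cost) / (eps / 8) <= t by near: t; exact: nbhs_pinfty_ge (num_real _).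
have tL : ln (16 * lam g / eps) / (eps / 8) <= t by near: t; exact: nbhs_pinfty_ge (num_real _).
have tM : ln (M + 1) / (eps / 2) <= t by near: t; exact: nbhs_pinfty_ge (num_real _).
have e80 : 0 < eps / 8 by rewrite divr_gt0.
have dgx : `|dot g (x t) - dot g r * t| <= eps / 8 * t.
  have -> : dot g (x t) - dot g r * t = dot (x t - t *: r) g.
    by rewrite dotBl dotZl (dotC (x t)) (dotC r) mulrC.
  apply: le_trans (normr_dot_le_normr _ _) _.
  apply: (@le_trans _ _ (Gam * (eta * t))).
    by rewrite /Gam mulrAC ler_wpM2l.
  by rewrite mulrA ler_wpM2r// ltW.
have [dg1 dg2] : dot g r * t - eps / 8 * t <= dot g (x t) /\
    dot g (x t) <= dot g r * t + eps / 8 * t.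
  move: dgx; rewrite ler_norml => /andP[].
  by move: (dot g (x t)) (dot g r * t) (eps / 8 * t) => A B D; split; lra.
split.
- pose E := h * (`|r| - rho * e * t / 2).
  have HE i (s : R) : `|s| = h ->
      - (h * rho * (e * t)) + (Num.truncn (lam g * t))%:R / lam g *
      (s * r ord0 i + C2 * s ^+ 2) - s * x t ord0 i <= E.
    move=> sh; have Lt0 : 0 <= lam g * t by rewrite mulr_ge0// ltW.
    apply: tilt_error; rewrite ?(ltW rho0) ?(ltW e0) ?(ltW t0)//.
    + have := ltW (truncnS_gt (lam g * t)); rewrite -natr1 => hk.
      rewrite lerBlDr -(ler_pM2r L0) mulrDl mul1r divfK ?gt_eqF// mulrC.
      by apply: le_trans hk _; rewrite lerD2l.
    + by rewrite ler_pdivrMr// [leRHS]mulrC truncn_le.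
    + exact: ler_coord_norm.
    + apply: (@le_trans _ _ (eta * t)); last by rewrite ler_wpM2r// ltW.
      by apply: le_trans xt; have := ler_coord_norm (x t - t *: r) i; rewrite !mxE.
  have En : (n + n)%:R * expR E <= 2^-1.
    have EL : E <= - lq.
      move: tE; rewrite ler_pdivrMr ?mulr_gt0// mulrDl => tE.
      rewrite /E -ler_pdivlMl// mulrN mulrC; lra.
    apply: (@le_trans _ _ ((n + n)%:R * expR (- lq))); first by rewrite ler_wpM2l// ler_expR.
    rewrite expRN lnK ?posrE// ler_pdivrMr// natrD; lra.
  have low := v_lower mf f0 fE fI fC kap0 rho0 growth dg axis powE single
    e0 e1 t2 h0 hh1 HE En.
  apply: le_trans low.
  have tc' : 2 + cost <= eps / 8 * t by rewrite [leRHS]mulrC -ler_pdivrMr.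
  have tL' : ln (16 * lam g / eps) <= eps / 8 * t by rewrite [leRHS]mulrC -ler_pdivrMr.
  exact: (final_lower eps0 L1 t0 ce tc' (esym PhiE) dg2 tL').
- have [up _] := between (x t) t (ltW t0).
  apply: le_trans up _.
  have M1 : M <= expR (eps / 2 * t).
    apply: (@le_trans _ _ (M + 1)); first by rewrite lerDl.
    have M10 : 0 < M + 1 by rewrite ltr_wpDl.
    rewrite -[leLHS](lnK M10) ler_expR.
    by rewrite mulrC -ler_pdivrMr// divr_gt0.
  apply: le_trans (ler_wpM2r (expR_ge0 _) M1) _.
  rewrite -expRD ler_expR PhiE.
  move: dg1; move: (dot g (x t)) (dot g r) (lam g) => A B D.
  have := mulr_gt0 e80 t0; lra.
Unshelve. all: by end_near. Qed.

Lemma v_asymp (x : R -> 'rV[R]_n) : 0 < Phi a r ->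
  t^-1 *: x t @[t --> +oo] --> r ->
  exists2 e : R -> R, e t @[t --> +oo] --> (0 : R)
    & \forall t \near +oo, v a (x t) t = expR (- (Phi a r * t * (1 + e t))).
Proof.
move=> P0 xr; have Pn : Phi a r != 0 by rewrite gt_eqF.
exists (fun t => - ln (v a (x t) t) / (Phi a r * t) - 1).
  apply/cvgr0Pnorm_le => eps eps0.
  have eP0 : 0 < eps * Phi a r by rewrite mulr_gt0.
  near=> t.
  have t0 : 0 < t by near: t; exact: nbhs_pinfty_gt (num_real _).
  have [lo hi] : expR (- ((Phi a r + eps * Phi a r) * t)) <= v a (x t) t /\
    v a (x t) t <= expR (- ((Phi a r - eps * Phi a r) * t)).
    by near: t; exact: v_log_bounds.
  have v0 : 0 < v a (x t) t by apply: lt_le_trans lo; exact: expR_gt0.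
  have Pt0 : 0 < Phi a r * t by rewrite mulr_gt0.
  have l1 : - ((Phi a r + eps * Phi a r) * t) <= ln (v a (x t) t).
    by rewrite -ler_expR lnK.
  have l2 : ln (v a (x t) t) <= - ((Phi a r - eps * Phi a r) * t).
    by rewrite -ler_expR lnK.
  rewrite ler_norml lerBrDr lerBlDr ler_pdivlMr// ler_pdivrMr//.
  move: l1 l2; move: (ln _) => A l1 l2; apply/andP; split; lra.
near=> t.
have t0 : 0 < t by near: t; exact: nbhs_pinfty_gt (num_real _).
have [lo _] : expR (- ((Phi a r + 1) * t)) <= v a (x t) t /\
  v a (x t) t <= expR (- ((Phi a r - 1) * t)) by near: t; exact: v_log_bounds.
have v0 : 0 < v a (x t) t by apply: lt_le_trans lo; exact: expR_gt0.
rewrite addrCA subrr addr0 mulrC divfK ?opprK ?lnK//.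
by rewrite mulf_neq0// gt_eqF.
Unshelve. all: by end_near. Qed.

End log_asymptotics.

(** If [a] were nonzero on the sphere it would be so at nearby points
    outside the ball. *)
Lemma supp_ball_vanish (R : realType) (d : nat) (a : 'rV[R]_d -> R) (m : R) :
  continuous a -> 0 < m ->
  closure [set x | a x != 0] `<=` [set x | enorm x <= m] ->
  forall x, m <= enorm x -> a x = 0.
Proof.
move=> ca m0 sub x mx; apply/eqP; apply: contraT => ax.
have clo y : a y != 0 -> enorm y <= m by move=> ay; apply: sub; exact: subset_closure.
have ex : enorm x = m by apply/eqP; rewrite eq_le mx clo.
have : \forall y \near x, a y != 0.
  have := ca x; move=> cx.
  have : nbhs (a x) [set z | z != 0] by apply: open_nbhs_nbhs; split => //; exact: open_neq.
  exact: cx.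
move=> /nbhs_ballP[e /= e0 he].
have nx : 0 < `|x| + 1 by rewrite ltr_wpDl.
pose s := e / 2 / (`|x| + 1).
have s0 : 0 < s by rewrite !divr_gt0.
have : a ((1 + s) *: x) != 0.
  apply: he; rewrite -ball_normE/= scalerDl scale1r opprD addrA subrr add0r normrN normrZ gtr0_norm//.
  apply: (@le_lt_trans _ _ (s * (`|x| + 1))); first by rewrite ler_pM2l// lerDl.
  by rewrite divfK ?gt_eqF//; lra.
move=> /clo; rewrite enormZ gtr0_norm ?addr_gt0// ex mulrDl mul1r gerDl.
by rewrite leNgt mulr_gt0.
Qed.

Lemma expR_norm_bound (R : realType) (d : nat) (a : 'rV[R]_d -> R) (p b C1 : R) (g : 'rV[R]_d) :
  1 <= p -> 0 < b -> 0 <= C1 -> (1 < p \/ enorm g < b) ->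
  (forall x, a x <= C1 * expR (- (b * enorm x `^ p))) ->
  exists M, forall x, a x <= M * expR (- dot g x).
Proof.
move=> p1 b0 C10 pb da.
have [C [c [C0 c0 H]]] := decay_tilt p1 b0 C10 (enorm_ge0 g) pb.
exists C => x; apply: le_trans (da x) _.
have h := H (enorm x) (enorm_ge0 x).
have h1 : C1 * expR (- (b * enorm x `^ p)) <= C * expR (- (enorm g * enorm x)).
  rewrite -ler_pdivrMr ?expR_gt0// -expRN opprK; apply: le_trans h _.
  by rewrite ler_piMr// -[leRHS](expR0 R) ler_expR oppr_le0 mulr_ge0 ?enorm_ge0// ltW.
apply: le_trans h1 _; rewrite ler_wpM2l// ler_expR lerN2.
exact: dot_le_enorm.
Qed.

Unset Implicit Arguments.
Set Strict Implicit.

Theorem theorem3p8 (R : realType) (d : nat) (p b C1 : R) (a : 'rV[R]_d -> R)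
    (d_gt0 : (0 < d)%N) (p_ge1 : 1 <= p)
    (a_ge0 : forall x, 0 <= a x)
    (a_even : forall x, a x = a (- x))
    (a_Linfty : (a : rV_lebesgue R d -> R) \in Lfun lebesgue_rV +oo%E)
    (a_L1 : (a : rV_lebesgue R d -> R) \in Lfun lebesgue_rV 1%E)
    (a_int : (\int[lebesgue_rV]_x (a x)%:E = 1)%E)
    (a_mom2 : (\int[lebesgue_rV]_x (enorm x ^+ 2 * a x)%:E < +oo)%E)
    (C1_gt0 : 0 < C1) (b_gt0 : 0 < b)
    (a_decay : forall x, a x <= C1 * expR (- (b * enorm x `^ p)))
    (a_steep : p = 1 -> forall th : 'rV[R]_d, enorm th = 1 ->
      (\int[lebesgue_rV]_x (enorm x * expR (b * dot x th) * a x)%:E = +oo)%E) :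
  [/\ forall (r : 'rV[R]_d) (x : R -> 'rV[R]_d), r != 0 ->
        t^-1 *: x t @[t --> +oo] --> r ->
        exists2 e : R -> R, e t @[t --> +oo] --> (0 : R)
          & \forall t \near +oo, v a (x t) t = expR (- (Phi a r * t * (1 + e t))),
      [/\ Phi a 0 = 0,
          forall r : 'rV[R]_d, r != 0 -> 0 < Phi a r,
          convex_function [set: 'rV[R]_d] (Phi a),
          asymp (0 : 'rV[R]_d)^' (Phi a)
            (fun r => 2^-1 * dot (r *m (invmx (covariance_mx a))^T) r)
        & Phi a r @[r --> rV_infty] --> +oo],
      p = 1 -> asymp rV_infty (Phi a) (fun r => b * enorm r),
      1 < p ->
        (exists2 e : 'rV[R]_d -> R, e g @[g --> rV_infty] --> (0 : R)
          & \forall g \near rV_infty, logLambda a g =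
              ((p - 1) / p * (b * p) `^ (- (p - 1)^-1)
                * enorm g `^ (p / (p - 1)) * (1 + e g))%:E) ->
        asymp rV_infty (Phi a)
          (fun r => p / (p - 1) * (b * (p - 1)) `^ p^-1
                    * enorm r * ln (enorm r) `^ ((p - 1) / p))
    & forall m : R, continuous a ->
        compact (closure [set x | a x != 0]) ->
        0 < m ->
        closure [set x | a x != 0] `<=` [set x | enorm x <= m] ->
        (forall m', closure [set x | a x != 0] `<=` [set x | enorm x <= m'] ->
          m <= m') ->
        \forall r \near rV_infty, m^-1 * enorm r * ln (enorm r) <= Phi a r].
Proof.
have ma : measurable_fun setT (a : rV_lebesgue R d -> R).
  by move: a_L1 => /[!inE] /andP[]; rewrite inE.
have [f [mf fa fE transfer powE]] := borel_version ma a_ge0 a_even.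
have f0 x : 0 <= f x by have /andP[] := fa x.
have f_decay x : f x <= C1 * expR (- (b * enorm x `^ p)).
  by apply: le_trans (a_decay x); have /andP[] := fa x.
have C10 := ltW C1_gt0.
have fI : (\int[@borel_lebesgue R d]_x (f x)%:E = 1)%E.
  rewrite -a_int; have := transfer (fun=> 1) (measurable_cst _) (fun=> ler01).
  by under eq_integral do rewrite mul1r; under [in RHS]eq_integral do rewrite mul1r.
have mom2 : (wint f (fun x => (enorm x ^+ 2)%R) < +oo)%E.
  rewrite /wint -transfer//; first by apply: measurable_funX; exact: measurable_enorm.
  by move=> x; exact: sqr_ge0.
have steep : p = 1 -> forall th : 'rV[R]_d, enorm th = 1 ->
    wint f (fun x => enorm x * expR (b * dot x th)) = +oo%E.
  move=> p1 th th1; rewrite /wint -transfer ?a_steep//.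
    apply: measurable_funM; first exact: measurable_enorm.
    by apply: measurableT_comp => //; apply: measurable_funM => //; exact: measurable_dot.
  by move=> x; rewrite mulr_ge0 ?enorm_ge0 ?expR_ge0.
have fC x : f x <= C1.
  apply: le_trans (f_decay x) _; rewrite ler_piMr// -[leRHS](expR0 R) ler_expR oppr_le0.
  by rewrite mulr_ge0 ?powR_ge0// ltW.
have duality := Phi_dual mf f0 fE fI transfer.
have Pge := Phi_ge mf f0 fE fI transfer.
have ball := mgf_ball_bounded mf f0 p_ge1 b_gt0 C10 f_decay.
have [G3 G30 [C3 C30 third]] := lam_third_order mf f0 fE fI p_ge1 b_gt0 C10 f_decay.
have lower := lam_lower mf f0 fE fI p_ge1 b_gt0 C10 f_decay.
have Pgt0 := Phi_gt0 mf f0 fE fI a_ge0 transfer mom2 G30 C30 third.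
have p1E : ~ (1 < p) -> p = 1.
  by move=> /negP; rewrite -leNgt => p1; apply/eqP; rewrite eq_le p1.
split.
- move=> r x rn xr; have [g gmax PE] := duality r.
  have [G gG [domG pb]] : exists2 G, enorm g < G &
      (forall g', enorm g' <= G -> dom f g') /\ (1 < p \/ enorm g < b).
    have [p1|/p1E p1] := pselect (1 < p).
      exists (enorm g + 1); first by rewrite ltrDl.
      have G0 : 0 <= enorm g + 1 by rewrite addr_ge0// enorm_ge0.
      have [M H] := ball _ G0 (or_introl p1).
      by split; [move=> g' /H[]|left].
    have gb := is_maxL_lt_b mf f0 fE fI p_ge1 b_gt0 C10 f_decay (steep p1) gmax.
    have mid : (enorm g + b) / 2 < b by rewrite ltr_pdivrMr//; lra.
    exists ((enorm g + b) / 2); first by rewrite ltr_pdivlMr//; lra.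
    have G0 : 0 <= (enorm g + b) / 2 by rewrite divr_ge0// addr_ge0 ?enorm_ge0// ltW.
    have [M H] := ball _ G0 (or_intror mid).
    by split; [move=> g' /H[]|right].
  have [M aM] := expR_norm_bound p_ge1 b_gt0 C10 pb a_decay.
  exact: (v_asymp mf f0 fE fI fa powE gmax PE gG domG aM fC (Pgt0 r rn) xr).
- split.
  + exact: (Phi_zero mf f0 fE fI transfer).
  + exact: Pgt0.
  + exact: (Phi_convex mf f0 fE fI transfer).
  + exact: (Phi_gauss_asymp mf f0 fE fI a_ge0 transfer mom2 G30 C30 third lower).
  + have b20 : 0 < b / 2 by rewrite divr_gt0.
    have bb : b / 2 < b by rewrite ltr_pdivrMr//; lra.
    have [M H] := ball _ (ltW b20) (or_intror bb).
    have lin := Phi_ge_linear mf f0 fE fI transfer (ltW b20) H.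
    apply/cvgryPge => A; near=> r.
    apply: le_trans (lin r); rewrite lerBrDr -ler_pdivrMl//.
    apply/ltW; near: r; exact: near_infty.
- move=> p1; apply: asympP => eps eps0.
  pose e := Num.min (b / 2) (eps * b / 2).
  have e0 : 0 < e by rewrite lt_min !divr_gt0// mulr_gt0.
  have be : b - e < b by rewrite ltrBlDr ltrDl.
  have be0 : 0 <= b - e.
    have : e <= b / 2 by rewrite ge_min lexx.
    by have := b_gt0; lra.
  have [M H] := ball _ be0 (or_intror be).
  have lin := Phi_ge_linear mf f0 fE fI transfer be0 H.
  have up := Phi_le_radius mf f0 fE fI transfer
    (dom_le_b mf f0 p_ge1 b_gt0 C10 f_decay (steep p1)).
  have eb : 0 < eps * b / 2 by rewrite divr_gt0// mulr_gt0.
  near=> r.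
  have r0 : 0 < enorm r by near: r; exact: near_infty.
  have rM : M / (eps * b / 2) < enorm r by near: r; exact: near_infty.
  split; first by rewrite mulr_gt0.
  rewrite ltr_pdivrMr// in rM.
  have h : e * enorm r <= eps * b / 2 * enorm r.
    by rewrite ler_pM2r// ge_min lexx orbT.
  have := lin r; have := up r; rewrite mulrBl ler_norml.
  move: (Phi a r) h rM => A; move: (enorm r) r0 => u *.
  have bu : 0 <= eps * b * u by rewrite !mulr_ge0// ltW.
  by apply/andP; split; lra.
- move=> p1 [e e0 LE].
  pose q := p / (p - 1); pose c := (p - 1) / p * (b * p) `^ (- (p - 1)^-1).
  have p0 : 0 < p by apply: lt_trans p1.
  have p10 : 0 < p - 1 by rewrite subr_gt0.
  have c0 : 0 < c by rewrite mulr_gt0 ?divr_gt0// powR_gt0// mulr_gt0.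
  have q1 : 1 < q by rewrite ltr_pdivlMr//; lra.
  have domT g : dom f g.
    have [M H] := ball _ (enorm_ge0 g) (or_introl p1).
    by have [] := H g (lexx _).
  have qE : (p - 1) / p = q^-1 by rewrite /q invf_div.
  rewrite -superlinear_const// -/c -/q qE.
  apply: (Phi_super_asymp mf f0 fE fI duality Pge q1 c0 domT) => del del0.
  have : \forall g \near rV_infty, expR (c * enorm g `^ q * (1 - del)) <= lam f g <=
      expR (c * enorm g `^ q * (1 + del)).
    near=> g.
    have Lg : logLambda a g = (c * enorm g `^ q * (1 + e g))%:E by near: g; exact: LE.
    have eg : `|e g| <= del.
      by near: g; apply: cvgr0_norm_le.
    have l0 := lam_gt0 mf f0 fE fI (domT g).
    have {}Lg : lam f g = expR (c * enorm g `^ q * (1 + e g)).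
      move: Lg; rewrite /logLambda (Lambda_mgf transfer) (domE f0 (domT g)) lne_EFin//.
      by move=> [] <-; rewrite lnK.
    have W0 : 0 <= c * enorm g `^ q by rewrite mulr_ge0 ?powR_ge0// ltW.
    move: eg; rewrite ler_norml => /andP[h1 h2].
    by rewrite Lg !ler_expR !ler_wpM2l//; lra.
  move=> [S _ HS]; exists (Num.max 1 S); first by rewrite le_max lexx.
  by move=> g; rewrite gt_max => /andP[_]; exact: HS.
- move=> m ca _ m0 sub _.
  have av := supp_ball_vanish ca m0 sub.
  have fv x : m <= enorm x -> f x = 0.
    move=> /av ax; apply/eqP; rewrite eq_le f0 andbT -ax.
    by have /andP[] := fa x.
  exact: (Phi_ge_support mf f0 fI Pge m0 fv).
Unshelve. all: by end_near. Qed.
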